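(* Let $(\mathbb X,\mathcal Z,\iota,K)$ be a proper and discrete Iwasawa continued fraction, and let $\mathcal M=\langle \mathcal Z,\iota\rangle$ be its generalized modular group. Then: (i) a point $x\in\mathbb X$ has a finite continued fraction expansion if and only if $x$ is a fixed point of a parabolic element of $\mathcal M$; (ii) a point $x\in\mathbb X$ has an eventually-periodic continued fraction expansion if and only if $x$ is a fixed point of a loxodromic element of $\mathcal M$.
   Context: Iwasawa inversion space. Fix $k\in\{\mathbb R,\mathbb C,\mathbb H_{\mathrm{quat}}\}$ (reals, complex numbers, quaternions) and $n\in\mathbb N$. Let $\mathbb X=k^n\times \operatorname{Im}(k)$ with group law $(z,t)*(z',t')=(z+z',\,t+t'+2\operatorname{Im}(\overline z\cdot z'))$, where $\overline z\cdot z'=\sum_i \overline{z_i}z'_i$; the identity is $0=(0,0)$ and $(z,t)^{-1}=(-z,-t)$. The gauge is $\|(z,t)\|=(|z|^4+|t|^2)^{1/4}$ and the metric is $d(p,q)=\|p^{-1}*q\|$. The Koranyi inversion is $\iota_-(z,t)=\big(-z(|z|^2+t)^{-1},\ -t/\,||z|^2+t|^2\big)$, extended to $\hat{\mathbb X}=\mathbb X\cup\{\infty\}$ by swapping $0$ and $\infty$. Hyperbolic space. $\hat{\mathbb X}$ is the boundary of the rank-one symmetric space $\mathbb H=\mathbb H^{n+1}_k$ (real, complex or quaternionic hyperbolic space), modeled in horospherical coordinates as $\mathbb X\times\mathbb R_{>0}\ni (z,t,s)$; writing $w=s+t\in k$, this is the Siegel domain $\{(z,w'):\operatorname{Re} w'>|z|^2\}$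 via $w'=|z|^2+w$. Left translations $(p,s)\mapsto(p_0*p,s)$, dilations $(p,s)\mapsto(\delta_r p,r^2s)$ with $\delta_r(z,t)=(rz,r^2t)$, and the extended Koranyi inversion $\iota_-(z,w)=\big(-z(|z|^2+w)^{-1},\ \overline w/\,||z|^2+w|^2\big)$ are isometries of $\mathbb H$, and isometries of $\mathbb H$ act continuously on $\partial\mathbb H=\hat{\mathbb X}$. An isometry $g$ of $\mathbb H$ is parabolic if it has exactly one fixed point in $\hat{\mathbb X}$, which is neither attracting nor repelling; it is loxodromic if it has exactly two fixed points in $\hat{\mathbb X}$, one attracting and one repelling. Iwasawa continued fraction. The data $(\mathbb X,\mathcal Z,\iota,K)$ consists of: a discrete group $\mathcal Z$ of isometries of $(\mathbb X,d)$ whose elements extend to isometries of $\mathbb H$; a fundamental domain $K\subset\mathbb X$ for $\mathcal Z$ contained in the closed unit ball $\{\|p\|\le 1\}$; and an inversion $\iota=O\circ\iota_-$ where $O$ is an isometry of $\mathbb X$ fixing $0$ that extends to an isometry of $\mathbb H$. For $p\in\mathbb X$, $[p]_K\in\mathcal Z$ is the unique element with $[p]_K^{-1}(p)\in K$. The Gauss map $T:K\setminus\{0\}\to K$ is $T(p)=[\iota p]_K^{-1}(\iota p)$. The digits of $p\in K$ are $a_i(p)=[\iota T^{i-1}p]_K$, $i=1,2,\dots$; if $T^np=0$ the sequence stops at $i=n$ and the expansion is finite. The expansion is eventually periodic if it is infinite and the digit sequence is eventually periodic (equivalently $T^ip=T^jp$ for some $i\ne j$). For $x\in\mathbb X$ not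 in $K$, its expansion is that of $[x]_K^{-1}(x)\in K$ preceded by the digit $[x]_K$. The generalized modular group is $\mathcal M=\langle\mathcal Z,\iota\rangle\subset\operatorname{Isom}(\mathbb H)$. The CF is discrete if $\mathcal M$ is a discrete subgroup of $\operatorname{Isom}(\mathbb H)$, and proper if $\operatorname{rad}(K)=\sup\{\|p\|:p\in K\}<1$. *)

(* Defs.v *)
From HB Require Import structures.
From mathcomp Require Import all_boot all_order all_algebra.
From mathcomp Require Import all_classical all_reals all_analysis.
From mathcomp Require Import ring lra.

Set Implicit Arguments.
Unset Strict Implicit.
Unset Printing Implicit Defensive.

Import Order.TTheory GRing.Theory Num.Theory.

Local Open Scope classical_set_scope.
Local Open Scope ring_scope.

Section Quaternions.
Context {R : realType}.

Record quat : Type := Quat { qre : R; qi : R; qj : R; qk : R }.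

Definition quat_tuple (x : quat) : R * R * R * R := (qre x, qi x, qj x, qk x).
Definition tuple_quat (u : R * R * R * R) : quat :=
  let: (a, b, c, d) := u in Quat a b c d.
Lemma quat_tupleK : cancel quat_tuple tuple_quat. Proof. by case. Qed.

HB.instance Definition _ := Choice.copy quat (can_type quat_tupleK).

Lemma quat_eq (x y : quat) : qre x = qre y -> qi x = qi y -> qj x = qj y ->
  qk x = qk y -> x = y.
Proof. by case: x => ? ? ? ?; case: y => ? ? ? ? /= -> -> -> ->. Qed.

Definition qzero := Quat 0 0 0 0.
Definition qone := Quat 1 0 0 0.
Definition qopp (x : quat) := Quat (- qre x) (- qi x) (- qj x) (- qk x).
Definition qadd (x y : quat) :=
  Quat (qre x + qre y) (qi x + qi y) (qj x + qj y) (qk x + qk y).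
Definition qmul (x y : quat) :=
  Quat (qre x * qre y - qi x * qi y - qj x * qj y - qk x * qk y)
       (qre x * qi y + qi x * qre y + qj x * qk y - qk x * qj y)
       (qre x * qj y - qi x * qk y + qj x * qre y + qk x * qi y)
       (qre x * qk y + qi x * qj y - qj x * qi y + qk x * qre y).

Fact qaddA : associative qadd.
Proof. by move=> x y z; apply: quat_eq => /=; ring. Qed.
Fact qaddC : commutative qadd.
Proof. by move=> x y; apply: quat_eq => /=; ring. Qed.
Fact qadd0 : left_id qzero qadd.
Proof. by move=> x; apply: quat_eq => /=; ring. Qed.
Fact qaddN : left_inverse qzero qopp qadd.
Proof. by move=> x; apply: quat_eq => /=; ring. Qed.

HB.instance Definition _ := GRing.isZmodule.Build quat qaddA qaddC qadd0 qaddN.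

Fact qmulA : associative qmul.
Proof. by move=> x y z; apply: quat_eq => /=; ring. Qed.
Fact qmul1 : left_id qone qmul.
Proof. by move=> x; apply: quat_eq => /=; ring. Qed.
Fact qmulr1 : right_id qone qmul.
Proof. by move=> x; apply: quat_eq => /=; ring. Qed.
Fact qmulDl : left_distributive qmul +%R.
Proof. by move=> x y z; apply: quat_eq => /=; ring. Qed.
Fact qmulDr : right_distributive qmul +%R.
Proof. by move=> x y z; apply: quat_eq => /=; ring. Qed.
Fact qone_neq0 : qone != 0 :> quat.
Proof. by apply/eqP => -[] /eqP; rewrite oner_eq0. Qed.

HB.instance Definition _ := GRing.Zmodule_isNzRing.Build quat
  qmulA qmul1 qmulr1 qmulDl qmulDr qone_neq0.

Definition qreal (r : R) : quat := Quat r 0 0 0.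
Definition qconj (x : quat) : quat := Quat (qre x) (- qi x) (- qj x) (- qk x).
Definition qim (x : quat) : quat := Quat 0 (qi x) (qj x) (qk x).

(* the square |x|^2 of the modulus *)
Definition qnorm2 (x : quat) : R :=
  qre x ^+ 2 + qi x ^+ 2 + qj x ^+ 2 + qk x ^+ 2.
Definition qnorm (x : quat) : R := Num.sqrt (qnorm2 x).

Definition qinv (x : quat) : quat := qconj x * qreal (qnorm2 x)^-1.

Lemma qnorm2_ge0 x : 0 <= qnorm2 x.
Proof. by rewrite !addr_ge0 ?sqr_ge0. Qed.

Lemma qnorm2_eq0 x : (qnorm2 x == 0) = (x == 0).
Proof.
apply/idP/eqP => [|->]; last by rewrite /qnorm2 /= !expr0n /= !addr0.
rewrite /qnorm2 !paddr_eq0 ?addr_ge0 ?sqr_ge0 // !sqrf_eq0.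
by move=> /andP[/andP[/andP[/eqP a /eqP b] /eqP c] /eqP d]; apply: quat_eq.
Qed.

Fact qmulV : {in [pred x | x != 0], left_inverse 1 qinv *%R}.
Proof.
move=> x; rewrite inE -qnorm2_eq0 => x0; apply: quat_eq => /=;
  by move: x0; rewrite /qnorm2; case: x => a b c d /= x0; field.
Qed.
Fact qmulrV : {in [pred x | x != 0], right_inverse 1 qinv *%R}.
Proof.
move=> x; rewrite inE -qnorm2_eq0 => x0; apply: quat_eq => /=;
  by move: x0; rewrite /qnorm2; case: x => a b c d /= x0; field.
Qed.
Fact qunitP (x y : quat) : y * x = 1 /\ x * y = 1 -> [pred x | x != 0] x.
Proof. by case=> _; apply: contra_eqN => /eqP->; rewrite mul0r eq_sym oner_eq0. Qed.
Fact qinv_out : {in [predC [pred x | x != 0]], qinv =1 id}.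
Proof.
by move=> x; rewrite !inE negbK => /eqP->; apply: quat_eq => /=; ring.
Qed.

HB.instance Definition _ :=
  GRing.NzRing_hasMulInverse.Build quat qmulV qmulrV qunitP qinv_out.

End Quaternions.
Arguments quat R : clear implicits.

(* k is realized as a subalgebra of the quaternions through the inclusions
   R < C = R + Ri < quaternions, so that one set of formulas serves all three *)
Inductive scalars := RealScalars | ComplexScalars | QuatScalars.

Section IwasawaSpace.
Context {R : realType}.

Definition in_scalars (k : scalars) : {pred quat R} :=
  fun x => match k with
  | RealScalars => [&& qi x == 0, qj x == 0 & qk x == 0]
  | ComplexScalars => (qj x == 0) && (qk x == 0)
  | QuatScalars => true
  end.

Section Closure.
Variable k : scalars.
Implicit Types x y : quat R.
Local Notation kk := (in_scalars k).

Let unfold_in x : (x \in kk) = in_scalars k x. Proof. by []. Qed.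

Lemma in_scalars_real (r : R) : qreal r \in kk.
Proof. by rewrite unfold_in; case: k => //=; rewrite !eqxx. Qed.
Lemma in_scalarsD x y : x \in kk -> y \in kk -> x + y \in kk.
Proof.
rewrite !unfold_in; case: k => //=.
- by move=> /and3P[/eqP-> /eqP-> /eqP->] /and3P[/eqP-> /eqP-> /eqP->];
    rewrite !addr0 eqxx.
- by move=> /andP[/eqP-> /eqP->] /andP[/eqP-> /eqP->]; rewrite !addr0 eqxx.
Qed.
Lemma in_scalarsM x y : x \in kk -> y \in kk -> x * y \in kk.
Proof.
rewrite !unfold_in; case: k => //=.
- by move=> /and3P[/eqP-> /eqP-> /eqP->] /and3P[/eqP-> /eqP-> /eqP->];
    rewrite !(mulr0, mul0r, addr0, subr0) eqxx.
- by move=> /andP[/eqP-> /eqP->] /andP[/eqP-> /eqP->];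
    rewrite !(mulr0, mul0r, addr0, subr0) eqxx.
Qed.
Lemma in_scalarsN x : x \in kk -> - x \in kk.
Proof. by rewrite !unfold_in; case: k => //=; rewrite !oppr_eq0. Qed.
Lemma in_scalars_conj x : x \in kk -> qconj x \in kk.
Proof. by rewrite !unfold_in; case: k => //=; rewrite !oppr_eq0. Qed.
Lemma in_scalars_im x : x \in kk -> qim x \in kk.
Proof. by rewrite !unfold_in; case: k. Qed.
Lemma in_scalarsV x : x \in kk -> x^-1 \in kk.
Proof.
by move=> kx; apply: in_scalarsM (in_scalars_real _); apply: in_scalars_conj.
Qed.
Lemma in_scalars_sum n (f : 'I_n -> quat R) :
  (forall i, f i \in kk) -> \sum_i f i \in kk.
Proof.
by move=> kf; elim/big_ind: _ => //; [exact: (in_scalars_real 0)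
                                      | exact: in_scalarsD].
Qed.

End Closure.

Section Group.
Variables (k : scalars) (n : nat).

(* zbar . z' = \sum_i conj(z_i) z'_i *)
Definition vdot (z z' : 'rV[quat R]_n) : quat R :=
  \sum_i qconj (z 0 i) * z' 0 i.

(* the square |z|^2 of the euclidean norm on k^n *)
Definition vnorm2 (z : 'rV[quat R]_n) : R := \sum_i qnorm2 (z 0 i).

(* k^n * Im(k) *)
Definition ipoint_pred (u : 'rV[quat R]_n * quat R) : bool :=
  [&& [forall i, u.1 0 i \in in_scalars k], u.2 \in in_scalars k & qre u.2 == 0].

Record ipoint : Type := IPoint {
  ival : 'rV[quat R]_n * quat R;
  ivalP : ipoint_pred ival
}.

HB.instance Definition _ := [isSub for ival].
HB.instance Definition _ := [Choice of ipoint by <:].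

Definition zc (p : ipoint) : 'rV[quat R]_n := (ival p).1.
Definition tc (p : ipoint) : quat R := (ival p).2.

Lemma zc_in p i : zc p 0 i \in in_scalars k.
Proof. by have /and3P[/forallP zk _ _] := ivalP p; exact: zk. Qed.
Lemma tc_in p : tc p \in in_scalars k.
Proof. by have /and3P[] := ivalP p. Qed.
Lemma tc_im p : qre (tc p) = 0.
Proof. by have /and3P[_ _ /eqP] := ivalP p. Qed.

Lemma ipointP (z : 'rV[quat R]_n) (t : quat R) :
  (forall i, z 0 i \in in_scalars k) -> t \in in_scalars k -> qre t = 0 ->
  ipoint_pred (z, t).
Proof. by move=> zk tk t0; apply/and3P; split=> //=; [apply/forallP|apply/eqP]. Qed.

Fact iorigin_subproof : ipoint_pred (0, 0).
Proof.
by apply: ipointP => [i||] //; rewrite ?mxE; exact: (in_scalars_real k 0).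
Qed.
Definition iorigin : ipoint := IPoint iorigin_subproof.

HB.instance Definition _ := isPointed.Build ipoint iorigin.

Fact imul_subproof (p q : ipoint) :
  ipoint_pred (zc p + zc q, tc p + tc q + qim (vdot (zc p) (zc q)) *+ 2).
Proof.
apply: ipointP => [i||].
- by rewrite mxE; apply: in_scalarsD; exact: zc_in.
- apply: in_scalarsD; first by apply: in_scalarsD; exact: tc_in.
  suff im : qim (vdot (zc p) (zc q)) \in in_scalars k by exact: in_scalarsD.
  apply/in_scalars_im/in_scalars_sum => i.
  by apply: in_scalarsM (zc_in _ _); exact: in_scalars_conj (zc_in _ _).
- by rewrite mulr2n /= !tc_im !addr0.
Qed.
Definition imul (p q : ipoint) : ipoint := IPoint (imul_subproof p q).

Fact iinv_subproof (p : ipoint) : ipoint_pred (- zc p, - tc p).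
Proof.
apply: ipointP => [i||]; last by rewrite /= tc_im oppr0.
- by rewrite mxE; exact: in_scalarsN (zc_in _ _).
- exact: in_scalarsN (tc_in _).
Qed.
Definition iinv (p : ipoint) : ipoint := IPoint (iinv_subproof p).

Definition gauge (p : ipoint) : R :=
  (vnorm2 (zc p) ^+ 2 + qnorm2 (tc p)) `^ 4^-1.

Definition idist (p q : ipoint) : R := gauge (imul (iinv p) q).

(* the coordinate w' = |z|^2 + s + t of the Siegel domain Re w' > |z|^2;
   s = 0 on the boundary *)
Definition siegel (p : ipoint) (s : R) : quat R :=
  qreal (vnorm2 (zc p)) + (qreal s + tc p).

Fact koranyi_subproof (p : ipoint) (s : R) :
  ipoint_pred (map_mx (fun x => - x * (siegel p s)^-1) (zc p),
               - tc p * qreal (qnorm2 (siegel p s))^-1).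
Proof.
have sk : siegel p s \in in_scalars k.
  apply: in_scalarsD; first exact: in_scalars_real.
  by apply: in_scalarsD (tc_in _); exact: in_scalars_real.
apply: ipointP => [i||].
- by rewrite mxE; apply: in_scalarsM; [exact: in_scalarsN (zc_in _ _)
                                     | exact: in_scalarsV].
- by apply: in_scalarsM (in_scalars_real _ _); exact: in_scalarsN (tc_in _).
- by rewrite /= tc_im; ring.
Qed.
(* the X-component of the Koranyi inversion of (z, t, s) *)
Definition koranyi (p : ipoint) (s : R) : ipoint :=
  IPoint (koranyi_subproof p s).

(* the Koranyi inversion on X; junk at the origin, which is sent to infinity *)
Definition iota_minus (p : ipoint) : ipoint := koranyi p 0.

(* hyperbolic space in horospherical coordinates (p, s), s > 0 *)
Definition hpoint : Type := (ipoint * {posnum R})%type.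

Definition hsiegel (h : hpoint) : quat R := siegel h.1 h.2%:num.

(* the Hermitian form of signature (1, n + 1) on the lifts (z, w', 1);
   hform h h = 2 s *)
Definition hform (h h' : hpoint) : quat R :=
  qconj (hsiegel h) + hsiegel h' - vdot (zc h.1) (zc h'.1) *+ 2.

Definition acosh (x : R) : R := ln (x + Num.sqrt (x ^+ 2 - 1)).

(* cosh d = |<h, h'>| / sqrt (<h, h> <h', h'>) *)
Definition hdist (h h' : hpoint) : R :=
  acosh (qnorm (hform h h') / Num.sqrt (qre (hform h h) * qre (hform h' h'))).

Fact hsiegel_gt0 (h : hpoint) : 0 < qnorm2 (hsiegel h).
Proof.
rewrite lt_neqAle qnorm2_ge0 andbT eq_sym qnorm2_eq0; apply/eqP => -[].
rewrite tc_im addr0 => /eqP; rewrite gt_eqF // ltr_wpDl //.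
by apply: sumr_ge0 => i _; exact: qnorm2_ge0.
Qed.

Fact iota_hyp_subproof (h : hpoint) : 0 < h.2%:num / qnorm2 (hsiegel h).
Proof. by rewrite divr_gt0 // hsiegel_gt0. Qed.

Definition iota_hyp (h : hpoint) : hpoint :=
  (koranyi h.1 h.2%:num, PosNum (iota_hyp_subproof h)).

(* the boundary X u {infinity}, infinity being None *)
Definition bpoint : Type := option ipoint.

Definition bnbhs (xi : bpoint) : set_system bpoint :=
  match xi with
  | Some p => [set U | exists2 e : R, 0 < e &
                 forall q, idist p q < e -> U (Some q)]
  | None => [set U | U None /\
                 exists M : R, forall q, M < gauge q -> U (Some q)]
  end.

(* the trace on hyperbolic space of the neighbourhoods of a boundary point in
   the one-point compactification of X * [0, +oo[ *)
Definition hnbhs (xi : bpoint) : set_system hpoint :=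
  match xi with
  | Some p => [set U | exists2 e : R, 0 < e &
                 forall h : hpoint, idist p h.1 < e -> h.2%:num < e -> U h]
  | None => [set U | exists M : R,
                 forall h : hpoint, M < gauge h.1 \/ M < h.2%:num -> U h]
  end.

(* g (h) tends to eta when h tends to xi *)
Definition btends (g : hpoint -> hpoint) (xi eta : bpoint) : Prop :=
  hnbhs eta `<=` g @ hnbhs xi.

(* the action on the boundary of an isometry of hyperbolic space *)
Definition bact (g : hpoint -> hpoint) (xi : bpoint) : bpoint :=
  xget None [set eta | btends g xi eta].

End Group.
End IwasawaSpace.
Arguments ipoint R k n : clear implicits.
Arguments hpoint R k n : clear implicits.
Arguments bpoint R k n : clear implicits.

Section MapGroups.
Context {R : realType} {T : Type}.

Definition isometry (d : T -> T -> R) (f : T -> T) : Prop :=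
  (forall x y, d (f x) (f y) = d x y) /\ (forall y, exists x, f x = y).

Definition map_group (G : set (T -> T)) : Prop :=
  [/\ G idfun,
      forall f g, G f -> G g -> G (f \o g) &
      forall f, G f -> exists g, [/\ G g, cancel f g & cancel g f]].

Definition generated_group (S : set (T -> T)) : set (T -> T) :=
  smallest map_group S.

(* discreteness for the topology of pointwise convergence, which on the isometry
   group of a metric space is the compact-open topology *)
Definition discrete_maps (d : T -> T -> R) (G : set (T -> T)) : Prop :=
  forall g0, G g0 -> exists F : set T, exists e : R,
    [/\ finite_set F, 0 < e &
        forall g, G g -> (forall x, F x -> d (g x) (g0 x) < e) -> g = g0].

End MapGroups.

Section Dynamics.
Context {R : realType} {k : scalars} {n : nat}.
Implicit Types (g : hpoint R k n -> hpoint R k n) (xi : bpoint R k n).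

Definition bfixed g xi : Prop := bact g xi = xi.

(* Attraction is uniform on a neighbourhood: pointwise, the iterates of a
   parabolic isometry also converge to its fixed point. *)
Definition attracting g xi : Prop :=
  exists2 U, bnbhs xi U & forall V, bnbhs xi V ->
    exists N, forall m, (N <= m)%N -> iter m (bact g) @` U `<=` V.

(* attracting for the inverse isometry *)
Definition repelling g xi : Prop :=
  exists2 U, bnbhs xi U & forall V, bnbhs xi V ->
    exists N, forall m, (N <= m)%N -> iter m (bact g) @^-1` U `<=` V.

Definition parabolic g : Prop :=
  isometry (@hdist R k n) g /\
  exists xi, [/\ bfixed g xi, forall eta, bfixed g eta -> eta = xi,
                 ~ attracting g xi & ~ repelling g xi].

Definition loxodromic g : Prop :=
  isometry (@hdist R k n) g /\
  exists xi eta, [/\ xi <> eta, bfixed g xi /\ bfixed g eta,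
                     forall zeta, bfixed g zeta -> zeta = xi \/ zeta = eta,
                     attracting g xi & repelling g eta].

(* g is an isometry of hyperbolic space extending f : X -> X, infinity being
   fixed *)
Definition extends g (f : ipoint R k n -> ipoint R k n) : Prop :=
  [/\ isometry (@hdist R k n) g,
      forall p, btends g (Some p) (Some (f p)) & btends g None None].

End Dynamics.

Section ContinuedFraction.
Variables (R : realType) (k : scalars) (n : nat).
Local Notation X := (ipoint R k n).
Local Notation H := (hpoint R k n).
Local Notation O := (iorigin k n : X).

Record iwasawaCF : Type := IwasawaCF {
  cfZ : set (X -> X);
  cfO : X -> X;
  cfK : set X;
  cfZ_group : map_group cfZ;
  cfZ_isometry : forall f, cfZ f -> isometry (@idist R k n) f;
  cfZ_extends : forall f, cfZ f -> exists g : H -> H, extends g f;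
  cfZ_discrete : discrete_maps (@idist R k n) cfZ;
  cfK_ball : forall p, cfK p -> gauge p <= 1;
  cfK_fundamental : forall p, exists! f, cfZ f /\ cfK (pinv [set: X] f p);
  cfO_isometry : isometry (@idist R k n) cfO;
  cfO_origin : cfO O = O;
  cfO_extends : exists g : H -> H, extends g cfO
}.

Variable cf : iwasawaCF.

(* iota on X minus the origin *)
Definition cf_iota (p : X) : X := cfO cf (iota_minus p).

(* the element [p]_K of Z *)
Definition cf_floor (p : X) : X -> X :=
  xget (idfun : X -> X) [set f | cfZ cf f /\ cfK cf (pinv [set: X] f p)].

(* [p]_K^-1 (p) *)
Definition cf_frac (p : X) : X := pinv [set: X] (cf_floor p) p.

(* the Gauss map; junk at the origin *)
Definition gauss_map (p : X) : X := cf_frac (cf_iota p).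

(* the digit a_(i+1) of p in K, None once the expansion has stopped *)
Definition cf_digit (p : X) (i : nat) : option (X -> X) :=
  if has (fun j => iter j gauss_map p == O) (iota 0 i.+1) then None
  else Some (cf_floor (cf_iota (iter i gauss_map p))).

Definition cf_expansion (x : X) (i : nat) : option (X -> X) :=
  if `[< cfK cf x >] then cf_digit x i
  else if i is i'.+1 then cf_digit (cf_frac x) i' else Some (cf_floor x).

Definition finite_expansion (x : X) : Prop :=
  exists i, cf_expansion x i = None.

Definition eventually_periodic_expansion (x : X) : Prop :=
  (forall i, cf_expansion x i <> None) /\
  exists N m, (0 < m)%N /\
    forall i, (N <= i)%N -> cf_expansion x (i + m)%N = cf_expansion x i.

Definition modular_group : set (H -> H) :=
  generated_group
    ([set g | exists2 f, cfZ cf f & extends g f] `|`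
     [set g \o @iota_hyp R k n | g in [set g | extends g (cfO cf)]]).

Definition cf_discrete : Prop := discrete_maps (@hdist R k n) modular_group.

Definition cf_proper : Prop := sup [set gauge p | p in cfK cf] < 1.

End ContinuedFraction.

(* Main.v *)
From mathcomp Require Import all_boot all_order all_algebra.
From mathcomp Require Import all_classical all_reals all_analysis.
From mathcomp Require Import ring lra.
Require Import Defs.

(** An isometry [g] of hyperbolic space with a boundary map [b] rescales the
    exponentials of Busemann functions: [B(b xi, g h) = j(xi) B(xi, h)].  An
    isometry fixing a boundary point [xi] acts, after moving [xi] to infinity, as
    a similarity of [X] with ratio [j(xi)^(-1/2)]; if [j(xi) <> 1] the contraction
    principle gives a second fixed point and the isometry is loxodromic.

    Let [x_i = T^i x] be an infinite Gauss orbit and [m_i] the element of the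
    modular group with [m_i x = x_i].  Since [rad K = r < 1], the factors
    [j_(m_i)(x)] increase strictly, and [d(x_i, m_i oo) >= 1/r - r] by induction.
    Hence, if [L] in the modular group fixes [x], the conjugates
    [m_i L m_i^-1] displace the points [(x_i, 1)] by a bounded amount, so by
    discreteness they take finitely many values.  Each value fixes at most two
    boundary points when [L] is loxodromic, so [x_i = x_j] for some [i < j].  If
    [L] is parabolic and [m_i L m_i^-1 = m_j L m_j^-1], then [m_j^-1 m_i] commutes
    with [L] and fixes [x] with factor [<> 1], so [L] fixes its second fixed point
    as well, a contradiction: the orbit of a parabolic fixed point is finite.

    Conversely, the uniqueness of [f] in the definition of a fundamental domain
    makes the action of [Z] on [X] free, so a nontrivial element of [Z] is
    parabolic with fixed point infinity, and a finite orbit carries [x] to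
    infinity.  A loxodromic element of the modular group cannot fix infinity, as
    conjugating a nontrivial element of [Z] by its powers would contradict
    discreteness.  Finally [x_i = x_j] makes [m_j^-1 m_i] loxodromic. *)

Set Implicit Arguments.
Unset Strict Implicit.
Unset Printing Implicit Defensive.

Import Order.TTheory GRing.Theory Num.Theory.
Local Open Scope classical_set_scope.
Local Open Scope ring_scope.

(** * Norm and conjugation of quaternions *)

Section QuatNorm.
Context {R : realType}.
Implicit Types x y : quat R.

Lemma qnorm2M x y : qnorm2 (x * y) = qnorm2 x * qnorm2 y.
Proof. by rewrite /qnorm2 /=; ring. Qed.

Lemma qnorm_ge0 x : 0 <= qnorm x. Proof. exact: sqrtr_ge0. Qed.

Lemma sqr_qnorm x : qnorm x ^+ 2 = qnorm2 x.
Proof. by rewrite sqr_sqrtr // qnorm2_ge0. Qed.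

Lemma qnormM x y : qnorm (x * y) = qnorm x * qnorm y.
Proof. by rewrite /qnorm qnorm2M sqrtrM // qnorm2_ge0. Qed.

Lemma qnorm_eq0 x : (qnorm x == 0) = (x == 0).
Proof. by rewrite sqrtr_eq0 le_eqVlt ltNge qnorm2_ge0 orbF qnorm2_eq0. Qed.

Lemma qnorm0 : qnorm (0 : quat R) = 0.
Proof. by apply/eqP; rewrite qnorm_eq0. Qed.

Lemma qnorm_conj x : qnorm (qconj x) = qnorm x.
Proof. by rewrite /qnorm /qnorm2 /= !sqrrN. Qed.

Lemma qnormN x : qnorm (- x) = qnorm x.
Proof. by rewrite /qnorm /qnorm2 /= !sqrrN. Qed.

Lemma qnorm_real (r : R) : 0 <= r -> qnorm (qreal r) = r.
Proof. by move=> r0; rewrite /qnorm /qnorm2 /= !expr0n /= !addr0 sqrtr_sqr ger0_norm. Qed.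

Lemma qnormV x : qnorm x^-1 = (qnorm x)^-1.
Proof.
have [->|x0] := eqVneq x 0.
  by rewrite (_ : 0^-1 = 0) ?qnorm0 ?invr0 //; apply: invr_out; rewrite unfold_in /= eqxx.
apply: (mulIf (_ : qnorm x != 0)); first by rewrite qnorm_eq0.
rewrite -qnormM mulVr ?unfold_in // mulVf ?qnorm_eq0 //.
by rewrite (_ : 1 = qreal 1) // qnorm_real.
Qed.

Lemma qre_le_norm x : qre x <= qnorm x.
Proof.
rewrite (le_trans (ler_norm _)) // -sqrtr_sqr ler_wsqrtr //.
by rewrite /qnorm2 -!addrA lerDl !addr_ge0 ?sqr_ge0.
Qed.

Lemma ler_qnormD x y : qnorm (x + y) <= qnorm x + qnorm y.
Proof.
rewrite -(@ler_pXn2r _ 2) ?nnegrE ?addr_ge0 ?qnorm_ge0 //.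
rewrite sqrrD !sqr_qnorm.
have := qre_le_norm (qconj x * y); rewrite qnormM qnorm_conj /= /qnorm2 /=.
by move: (qnorm x) (qnorm y) => a b; lra.
Qed.

Lemma qnorm_im x : qnorm (qim x) <= qnorm x.
Proof.
by rewrite ler_wsqrtr // /qnorm2 /= expr0n /= add0r -!addrA lerDr sqr_ge0.
Qed.

Lemma norm_coord_le x :
  [/\ `|qre x| <= qnorm x, `|qi x| <= qnorm x, `|qj x| <= qnorm x & `|qk x| <= qnorm x].
Proof.
rewrite -!sqrtr_sqr; have := (sqr_ge0 (qre x), sqr_ge0 (qi x), sqr_ge0 (qj x), sqr_ge0 (qk x)).
by move=> [[[? ?] ?] ?]; split; rewrite ler_wsqrtr // /qnorm2; lra.
Qed.

Lemma qnorm_le_coord x :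
  qnorm x <= `|qre x| + `|qi x| + `|qj x| + `|qk x|.
Proof.
rewrite -(@ler_pXn2r _ 2) ?nnegrE ?addr_ge0 ?qnorm_ge0 //.
rewrite sqr_qnorm /qnorm2 -!(real_normK (num_real (qre x))) -!(real_normK (num_real (qi x)))
  -!(real_normK (num_real (qj x))) -!(real_normK (num_real (qk x))).
move: (normr_ge0 (qre x)) (normr_ge0 (qi x)) (normr_ge0 (qj x)) (normr_ge0 (qk x)).
move: `|qre x| `|qi x| `|qj x| `|qk x| => a b c d a0 b0 c0 d0.
have := (mulr_ge0 a0 b0, mulr_ge0 a0 c0, mulr_ge0 a0 d0).
by have := (mulr_ge0 b0 c0, mulr_ge0 b0 d0, mulr_ge0 c0 d0); nra.
Qed.

Lemma qconjM x y : qconj (x * y) = qconj y * qconj x.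
Proof. by apply: quat_eq => /=; ring. Qed.

Lemma qconjD x y : qconj (x + y) = qconj x + qconj y.
Proof. by apply: quat_eq => /=; ring. Qed.

Lemma qconjK : involutive (@qconj R).
Proof. by move=> x; apply: quat_eq => /=; rewrite ?opprK. Qed.

Lemma qinvE x : x^-1 = qconj x * qreal (qnorm2 x)^-1.
Proof. by []. Qed.

End QuatNorm.

(** * The group law and the gauge extended to the half-space *)

Section Gauge.
Context {R : realType} {k : scalars} {n : nat}.
Local Notation X := (ipoint R k n).
Implicit Types (p q r : X) (z : 'rV[quat R]_n) (a b : R).

Lemma ipoint_eq p q : zc p = zc q -> tc p = tc q -> p = q.
Proof.
rewrite /zc /tc => h1 h2; apply: val_inj => /=; move: h1 h2.
by case: (ival p); case: (ival q) => ? ? ? ? /= -> ->.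
Qed.

Lemma zcM p q : zc (imul p q) = zc p + zc q. Proof. by []. Qed.
Lemma tcM p q : tc (imul p q) = tc p + tc q + qim (vdot (zc p) (zc q)) *+ 2.
Proof. by []. Qed.
Lemma zcV p : zc (iinv p) = - zc p. Proof. by []. Qed.
Lemma tcV p : tc (iinv p) = - tc p. Proof. by []. Qed.
Lemma zc0 : zc (iorigin k n : X) = 0. Proof. by []. Qed.
Lemma tc0 : tc (iorigin k n : X) = 0. Proof. by []. Qed.
Definition ipointE := (zcM, tcM, zcV, tcV, zc0, tc0).

Lemma vdotDl z z' z2 : vdot (z + z') z2 = vdot z z2 + vdot z' z2.
Proof. by rewrite /vdot -big_split; apply: eq_bigr => i _; rewrite mxE qconjD mulrDl. Qed.
Lemma vdotDr z z' z2 : vdot z2 (z + z') = vdot z2 z + vdot z2 z'.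
Proof. by rewrite /vdot -big_split; apply: eq_bigr => i _; rewrite mxE mulrDr. Qed.
Lemma vdotNl z z' : vdot (- z) z' = - vdot z z'.
Proof.
rewrite /vdot -sumrN; apply: eq_bigr => i _; rewrite mxE -mulNr; congr (_ * _).
Qed.
Lemma vdotNr z z' : vdot z (- z') = - vdot z z'.
Proof. by rewrite /vdot -sumrN; apply: eq_bigr => i _; rewrite mxE mulrN. Qed.

Lemma qimD (x y : quat R) : qim (x + y) = qim x + qim y.
Proof. by apply: quat_eq => /=; ring. Qed.
Lemma qconj_sum (I : Type) (s : seq I) (f : I -> quat R) :
  qconj (\sum_(i <- s) f i) = \sum_(i <- s) qconj (f i).
Proof.
elim/big_rec2: _ => [|i x y _ <-]; last by rewrite qconjD.
by apply: quat_eq => /=; rewrite ?oppr0.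
Qed.
Lemma qreal_sum (I : Type) (s : seq I) (f : I -> R) :
  qreal (\sum_(i <- s) f i) = \sum_(i <- s) qreal (f i).
Proof. by elim/big_rec2: _ => [|i x y _ <-] //; apply: quat_eq => /=; ring. Qed.

Lemma vdot_conj z z' : qconj (vdot z z') = vdot z' z.
Proof. by rewrite /vdot qconj_sum; apply: eq_bigr => i _; rewrite qconjM qconjK. Qed.

Lemma vdotzz z : vdot z z = qreal (vnorm2 z).
Proof.
rewrite /vdot /vnorm2 qreal_sum; apply: eq_bigr => i _.
by apply: quat_eq; rewrite /qnorm2 /=; ring.
Qed.

Lemma vnorm2_ge0 z : 0 <= vnorm2 z.
Proof. by apply: sumr_ge0 => i _; exact: qnorm2_ge0. Qed.

Lemma vnorm2_eq0 z : vnorm2 z = 0 -> z = 0.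
Proof.
move=> /eqP; rewrite psumr_eq0; last by move=> i _; exact: qnorm2_ge0.
move=> /allP h; apply/rowP => i; rewrite mxE; apply/eqP.
by rewrite -qnorm2_eq0; apply: h; rewrite mem_index_enum.
Qed.

Lemma qnorm_sum (I : Type) (s : seq I) (f : I -> quat R) :
  qnorm (\sum_(i <- s) f i) <= \sum_(i <- s) qnorm (f i).
Proof.
by elim/big_rec2: _ => [|i x y _ h]; rewrite ?qnorm0 // (le_trans (ler_qnormD _ _)) // lerD2l.
Qed.

(** Cauchy-Schwarz by induction on the sum: the two sums of squares and the mixed sum are carried
    together by [big_rec3]. *)
Lemma qnorm_vdot z z' : qnorm (vdot z z') <= Num.sqrt (vnorm2 z) * Num.sqrt (vnorm2 z').
Proof.
apply: (le_trans (qnorm_sum _ _)).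
under eq_bigr do rewrite qnormM qnorm_conj.
rewrite /vnorm2.
suff [] : 0 <= \sum_i qnorm2 (z 0 i) /\ 0 <= \sum_i qnorm2 (z' 0 i) /\
   \sum_i qnorm (z 0 i) * qnorm (z' 0 i) <=
     Num.sqrt (\sum_i qnorm2 (z 0 i)) * Num.sqrt (\sum_i qnorm2 (z' 0 i)) by move=> ? [].
apply: (big_rec3 (fun u v w => 0 <= u /\ 0 <= v /\ w <= Num.sqrt u * Num.sqrt v)).
  by rewrite !lexx sqrtr0 mulr0.
move=> i u v w _ [u0 [v0 h]].
split; first by rewrite addr_ge0 ?qnorm2_ge0.
split; first by rewrite addr_ge0 ?qnorm2_ge0.
rewrite (le_trans (lerD (lexx _) h)) //.
rewrite -(@ler_pXn2r _ 2) ?nnegrE ?addr_ge0 ?mulr_ge0 ?qnorm_ge0 ?sqrtr_ge0 //.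
rewrite [leRHS]exprMn.
rewrite !sqr_sqrtr ?(addr_ge0 (qnorm2_ge0 _)) // -!sqr_qnorm.
have := (sqr_sqrtr u0, sqr_sqrtr v0).
move: (Num.sqrt u) (Num.sqrt v) => s t [<- <-].
(* With s^2 = u and t^2 = v, the inductive step reduces to 2abst <= a^2 t^2 + b^2 s^2. *)
have := sqr_ge0 (qnorm (z 0 i) * t - qnorm (z' 0 i) * s); nra.
Qed.

Lemma imulA : associative (@imul R k n).
Proof.
move=> p q r; apply: ipoint_eq; rewrite ?ipointE; first by rewrite addrA.
rewrite vdotDr vdotDl !qimD !mulr2n.
by apply: quat_eq => /=; ring.
Qed.
Lemma imul0p p : imul (iorigin k n) p = p.
Proof.
apply: ipoint_eq; rewrite ?ipointE; first by rewrite add0r.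
rewrite /vdot big1; last by move=> i _; rewrite mxE; apply: quat_eq => /=; ring.
by apply: quat_eq => /=; ring.
Qed.
Lemma imulp0 p : imul p (iorigin k n) = p.
Proof.
apply: ipoint_eq; rewrite ?ipointE; first by rewrite addr0.
rewrite /vdot big1; last by move=> i _; rewrite mxE mulr0.
by apply: quat_eq => /=; ring.
Qed.
Lemma imulVp p : imul (iinv p) p = iorigin k n.
Proof.
apply: ipoint_eq; rewrite ?ipointE; first by rewrite addNr.
by rewrite vdotNl vdotzz; apply: quat_eq => /=; ring.
Qed.
Lemma imulpV p : imul p (iinv p) = iorigin k n.
Proof.
apply: ipoint_eq; rewrite ?ipointE; first by rewrite addrN.
by rewrite vdotNr vdotzz; apply: quat_eq => /=; ring.
Qed.
Lemma iinvK : involutive (@iinv R k n).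
Proof. by move=> p; apply: ipoint_eq; rewrite ?ipointE; rewrite opprK. Qed.
Lemma imulKV p q : imul p (imul (iinv p) q) = q.
Proof. by rewrite imulA imulpV imul0p. Qed.
Lemma imulK p q : imul (iinv p) (imul p q) = q.
Proof. by rewrite imulA imulVp imul0p. Qed.
Lemma iinvM p q : iinv (imul p q) = imul (iinv q) (iinv p).
Proof.
rewrite -[RHS](imulK (imul p q)) -imulA (imulA q) imulpV imul0p imulpV imulp0 //.
Qed.

(* Extends the gauge to the closed half-space; [gam p 0 = gauge p]. *)
Definition gam p a : R := Num.sqrt (qnorm (siegel p a)).

Lemma gam_ge0 p a : 0 <= gam p a. Proof. exact: sqrtr_ge0. Qed.

Lemma sqr_gam p a : gam p a ^+ 2 = qnorm (siegel p a).
Proof. by rewrite sqr_sqrtr ?qnorm_ge0. Qed.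

Lemma gam4 p a : gam p a ^+ 4 = qnorm2 (siegel p a).
Proof. by rewrite (exprM _ 2 2) sqr_gam sqr_qnorm. Qed.

Lemma siegel_norm2 p a :
  qnorm2 (siegel p a) = (vnorm2 (zc p) + a) ^+ 2 + qnorm2 (tc p).
Proof. by rewrite /qnorm2 /= tc_im; ring. Qed.

Lemma gam4E p a : gam p a ^+ 4 = (vnorm2 (zc p) + a) ^+ 2 + qnorm2 (tc p).
Proof. by rewrite gam4 siegel_norm2. Qed.

Lemma gaugeE p : gauge p = gam p 0.
Proof.
rewrite /gauge -(addr0 (vnorm2 _)) -gam4E -powR_mulrn ?gam_ge0 // -powRrM.
by rewrite divff ?pnatr_eq0 // powRr1 // gam_ge0.
Qed.

Lemma idistE p q : idist p q = gam (imul (iinv p) q) 0.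
Proof. by rewrite /idist gaugeE. Qed.

Lemma gam_leX p a q b : (gam p a <= gam q b) = (gam p a ^+ 4 <= gam q b ^+ 4).
Proof. by rewrite ler_pXn2r ?nnegrE ?gam_ge0. Qed.

Lemma gam_homo p a b : 0 <= a -> a <= b -> gam p a <= gam p b.
Proof.
move=> a0 ab; rewrite gam_leX !gam4E lerD2r ler_pXn2r ?nnegrE ?lerD2l //.
  by rewrite addr_ge0 // vnorm2_ge0.
by rewrite addr_ge0 ?vnorm2_ge0 // (le_trans a0).
Qed.

(** The real part of [vdot] comes from expanding |z + z'|^2 and its imaginary part from the group
    law; together they form a single quaternionic cross term. *)
Lemma siegelM p q a b : siegel (imul p q) (a + b) =
  siegel p a + siegel q b + vdot (zc p) (zc q) *+ 2.
Proof.
rewrite /siegel !ipointE -!vdotzz vdotDl !vdotDr !mulr2n.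
rewrite -(vdot_conj (zc p) (zc q)).
by apply: quat_eq => /=; ring.
Qed.

Lemma vnorm_gam p a : 0 <= a -> Num.sqrt (vnorm2 (zc p)) <= gam p a.
Proof.
move=> a0; rewrite -(@ler_pXn2r _ 4) ?nnegrE ?gam_ge0 ?sqrtr_ge0 //.
rewrite gam4E (exprM _ 2 2) sqr_sqrtr ?vnorm2_ge0 //.
have := vnorm2_ge0 (zc p); have := qnorm2_ge0 (tc p).
move: (vnorm2 _) (qnorm2 _) => u v; nra.
Qed.

(** By [siegelM] the square of the left side is at most the sum of the squares of the two gauges
    plus twice |[vdot]|, and the horizontal norms in Cauchy-Schwarz are bounded by the gauges. *)
Lemma gamM p q a b : 0 <= a -> 0 <= b ->
  gam (imul p q) (a + b) <= gam p a + gam q b.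
Proof.
move=> a0 b0; rewrite -(@ler_pXn2r _ 2) ?nnegrE ?addr_ge0 ?gam_ge0 //.
rewrite sqr_gam siegelM sqrrD !sqr_gam mulr2n [X in _ <= X]addrAC.
rewrite (le_trans (ler_qnormD _ _)) // lerD ?ler_qnormD //.
rewrite (le_trans (ler_qnormD _ _)) // mulr2n.
suff h : qnorm (vdot (zc p) (zc q)) <= gam p a * gam q b by rewrite lerD.
by rewrite (le_trans (qnorm_vdot _ _)) // ler_pM ?sqrtr_ge0 ?vnorm_gam.
Qed.

Lemma gamV p a : gam (iinv p) a = gam p a.
Proof.
apply/eqP; rewrite eq_le !gam_leX !gam4E !ipointE /qnorm2 /= !sqrrN.
suff -> : vnorm2 (- zc p) = vnorm2 (zc p) by rewrite lexx.
by rewrite /vnorm2; apply: eq_bigr => i _; rewrite mxE /qnorm2 /= !sqrrN.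
Qed.

Lemma gam_origin a : 0 <= a -> gam (iorigin k n) a = Num.sqrt a.
Proof.
move=> a0; rewrite /gam /siegel !ipointE (_ : vnorm2 0 = 0); last first.
  by rewrite /vnorm2 big1 // => i _; apply/eqP; rewrite mxE qnorm2_eq0.
by rewrite (_ : _ + _ = qreal a) ?qnorm_real //; apply: quat_eq => /=; ring.
Qed.

Lemma gam0_eq0 p : gam p 0 = 0 -> p = iorigin k n.
Proof.
move=> h; have := gam4E p 0; rewrite h expr0n /= addr0 => /esym/eqP.
rewrite paddr_eq0 ?sqr_ge0 ?qnorm2_ge0 // sqrf_eq0 qnorm2_eq0 => /andP[/eqP h1 /eqP h2].
by apply: ipoint_eq => //=; exact: vnorm2_eq0.
Qed.

Lemma sqrt_le_gam p a : 0 <= a -> Num.sqrt a <= gam p a.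
Proof.
move=> a0; rewrite -(@ler_pXn2r _ 4) ?nnegrE ?gam_ge0 ?sqrtr_ge0 //.
rewrite gam4E (exprM _ 2 2) sqr_sqrtr //.
have := vnorm2_ge0 (zc p); have := qnorm2_ge0 (tc p).
move: (vnorm2 _) (qnorm2 _) => u v; nra.
Qed.

Lemma gam_gt0 p a : 0 < a -> 0 < gam p a.
Proof. by move=> a0; rewrite (lt_le_trans _ (sqrt_le_gam p (ltW a0))) // sqrtr_gt0. Qed.

Lemma gam_le_gauge p a : 0 <= a -> gam p a <= gam p 0 + Num.sqrt a.
Proof.
move=> a0; have := gamM p (iorigin k n) (lexx 0) a0.
by rewrite imulp0 add0r gam_origin.
Qed.

Lemma idist_ge0 p q : 0 <= idist p q. Proof. by rewrite idistE gam_ge0. Qed.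
Lemma idistC p q : idist p q = idist q p.
Proof. by rewrite !idistE -gamV iinvM iinvK. Qed.
Lemma idistxx p : idist p p = 0.
Proof. by rewrite idistE imulVp gam_origin // sqrtr0. Qed.
Lemma idist_eq0 p q : idist p q = 0 -> p = q.
Proof.
rewrite idistE => /gam0_eq0 h.
by rewrite -(imulKV p q) h imulp0.
Qed.
Lemma idist_gt0 p q : p <> q -> 0 < idist p q.
Proof. by move=> pq; rewrite lt_def idist_ge0 andbT; apply/eqP => /idist_eq0. Qed.
Lemma idist0p p : idist (iorigin k n) p = gam p 0.
Proof.
by rewrite idistE -[imul _ p]imul0p imulKV.
Qed.

Lemma gam_triangle p q r a b : 0 <= a -> 0 <= b ->
  gam (imul (iinv p) r) (a + b) <= gam (imul (iinv p) q) a + gam (imul (iinv q) r) b.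
Proof.
by move=> a0 b0; rewrite (le_trans _ (gamM _ _ a0 b0)) // -imulA imulKV.
Qed.

Lemma idist_triangle p q r : idist p r <= idist p q + idist q r.
Proof. by rewrite !idistE (le_trans _ (gam_triangle _ _ _ (lexx 0) (lexx 0))) // addr0. Qed.

End Gauge.

(** * Horospherical coordinates, the Koranyi inversion and boundary neighbourhoods *)

Section Hyperbolic.
Context {R : realType} {k : scalars} {n : nat}.
Local Notation X := (ipoint R k n).
Local Notation H := (hpoint R k n).
Implicit Types (p q r : X) (a b : R) (h : H) (xi eta : bpoint R k n).

Lemma hgt_gt0 h : 0 < h.2%:num. Proof. by []. Qed.

Lemma hpoint_eq h h' : h.1 = h'.1 -> h.2%:num = h'.2%:num -> h = h'.
Proof. by case: h h' => [p s] [p' s'] /= -> /val_inj ->. Qed.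

Lemma siegelV p a : siegel (iinv p) a = qconj (siegel p a).
Proof.
rewrite /siegel !ipointE (_ : vnorm2 (- zc p) = vnorm2 (zc p)).
  by apply: quat_eq => /=; rewrite ?tc_im; ring.
by rewrite /vnorm2; apply: eq_bigr => i _; rewrite mxE /qnorm2 /= !sqrrN.
Qed.

(** When [a] and [b] are heights, the right side is the Hermitian form [hform]. This turns
    hyperbolic distances into values of [gam]. *)
Lemma siegelVM p q a b : siegel (imul (iinv p) q) (a + b) =
  qconj (siegel p a) + siegel q b - vdot (zc p) (zc q) *+ 2.
Proof. by rewrite siegelM siegelV zcV vdotNl mulNrn. Qed.

(* [4 (cosh (hdist h h'))^2], which is easier to compute with than [hdist] *)
Definition cdist h h' : R :=
  gam (imul (iinv h.1) h'.1) (h.2%:num + h'.2%:num) ^+ 4 / (h.2%:num * h'.2%:num).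

Lemma cdist_gt0 h h' : 0 < cdist h h'.
Proof. by rewrite divr_gt0 ?exprn_gt0 ?gam_gt0 ?mulr_gt0 ?addr_gt0. Qed.

Lemma hdistE h h' : hdist h h' = acosh (Num.sqrt (cdist h h' / 4)).
Proof.
rewrite /hdist; congr acosh.
have re h0 : qre (hform h0 h0) = h0.2%:num + h0.2%:num.
  rewrite /hform -siegelVM imulVp /siegel !ipointE /= addr0.
  by rewrite /vnorm2 big1 ?add0r // => i _; apply/eqP; rewrite mxE qnorm2_eq0.
rewrite !re /hform /hsiegel -siegelVM -sqr_gam /cdist.
rewrite -[X in X / _]ger0_norm ?sqr_ge0 // -sqrtr_sqr -exprM.
rewrite -sqrtrV; last by rewrite mulr_ge0 ?addr_ge0.
rewrite -sqrtrM ?exprn_ge0 ?gam_ge0 //; congr Num.sqrt.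
by field; rewrite !gt_eqF.
Qed.

(** [Num.sqrt] vanishes on negative numbers, so x + sqrt(x^2 - 1) is strictly increasing on all
    positive reals, including those below 1. *)
Lemma acosh_inj (x y : R) : 0 < x -> 0 < y -> acosh x = acosh y -> x = y.
Proof.
have lt (u v : R) : 0 < u -> u < v -> u + Num.sqrt (u ^+ 2 - 1) < v + Num.sqrt (v ^+ 2 - 1).
  move=> u0 uv; rewrite ltr_leD // ler_wsqrtr // lerD2r ler_pXn2r ?nnegrE ?ltW //.
  exact: lt_trans uv.
have pos (u : R) : 0 < u -> u + Num.sqrt (u ^+ 2 - 1) \in Num.pos.
  by move=> u0; rewrite posrE ltr_wpDr ?sqrtr_ge0.
move=> x0 y0 /(ln_inj (pos _ x0) (pos _ y0)) e.
case: (ltgtP x y) => // h.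
  by have := lt _ _ x0 h; rewrite e ltxx.
by have := lt _ _ y0 h; rewrite e ltxx.
Qed.

Lemma hdist_cdist h1 h2 h3 h4 : hdist h1 h2 = hdist h3 h4 <-> cdist h1 h2 = cdist h3 h4.
Proof.
have c4 h h' : 0 < cdist h h' / 4 by rewrite divr_gt0 ?cdist_gt0.
rewrite !hdistE; split=> [/acosh_inj|-> //].
rewrite !sqrtr_gt0 !c4 => /(_ isT isT) /eqP.
rewrite eqr_sqrt ?ltW // => /eqP; apply: mulIf.
by rewrite invr_eq0 pnatr_eq0.
Qed.

(* exponentials of the Busemann functions at the boundary points *)
Definition bus xi h : R :=
  if xi is Some q then gam (imul (iinv h.1) q) h.2%:num ^+ 4 / h.2%:num else h.2%:num^-1.

(** Fourth power of the distance, extended to infinity by the normalisation 1. With it every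
    isometry of hyperbolic space in play satisfies one relation, [mob_bdist], with no exception at
    infinity. *)
Definition bdist xi eta : R :=
  match xi, eta with
  | Some p, Some q => idist p q ^+ 4
  | None, None => 0
  | _, _ => 1
  end.

(** In Siegel coordinates the inversion is w' -> 1/w' on the last coordinate. *)
Lemma siegel_koranyi p a :
  siegel (koranyi p a) (a / qnorm2 (siegel p a)) = (siegel p a)^-1.
Proof.
rewrite /siegel {1}/zc /tc /= -/(siegel p a) -/(tc p).
have -> : vnorm2 (map_mx (fun x => - x * (siegel p a)^-1) (zc p)) =
          vnorm2 (zc p) / qnorm2 (siegel p a).
  rewrite /vnorm2 mulr_suml; apply: eq_bigr => i _.
  by rewrite mxE -!sqr_qnorm qnormM qnormN qnormV exprMn exprVn.
by rewrite qinvE; move: (qnorm2 _)^-1 => c; apply: quat_eq => /=; rewrite ?tc_im; ring.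
Qed.

Lemma vdot_koranyi p a q b :
  vdot (zc (koranyi p a)) (zc (koranyi q b)) =
  qconj (siegel p a)^-1 * vdot (zc p) (zc q) * (siegel q b)^-1.
Proof.
rewrite {1 2}/zc /= /vdot mulr_sumr mulr_suml; apply: eq_bigr => i _.
rewrite !mxE qconjM !mulrA; congr (_ * _); rewrite mulrN -mulNr; congr (_ * _).
by rewrite -mulrN; congr (_ * _); apply: quat_eq => /=; rewrite ?opprK.
Qed.

(** Inversion multiplies the form of two lifts by the inverse of each Siegel coordinate, one on
    either side: conj(u)^-1 + v^-1 - 2 conj(u)^-1 w v^-1 = conj(u)^-1 (conj(u) + v - 2w) v^-1.
    Taking moduli gives the formula. *)
Lemma gam_koranyi p a q b : siegel p a != 0 -> siegel q b != 0 ->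
  gam (imul (iinv (koranyi p a)) (koranyi q b))
      (a / qnorm2 (siegel p a) + b / qnorm2 (siegel q b)) =
  gam (imul (iinv p) q) (a + b) / (gam p a * gam q b).
Proof.
move=> p0 q0; rewrite /gam (siegelVM (koranyi p a)) !siegel_koranyi vdot_koranyi.
have -> : qconj (siegel p a)^-1 + (siegel q b)^-1 -
   qconj (siegel p a)^-1 * vdot (zc p) (zc q) * (siegel q b)^-1 *+ 2 =
   qconj (siegel p a)^-1 * siegel (imul (iinv p) q) (a + b) * (siegel q b)^-1.
  rewrite siegelVM; move: (siegel p a) (siegel q b) (vdot _ _) p0 q0 => u v w u0 v0.
  rewrite !mulrDr !mulrDl -qconjM mulrV ?unfold_in //.
  rewrite (_ : qconj 1 = 1); last by apply: quat_eq => /=; rewrite ?oppr0.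
  rewrite mul1r (mulrK (_ : v \is a GRing.unit)) ?unfold_in //.
  by rewrite mulrN mulNr !mulrnAr !mulrnAl; congr (_ + _); rewrite addrC.
rewrite (qnormM _ (siegel q b)^-1) (qnormM (qconj _)) qnorm_conj !qnormV invfM.
rewrite sqrtrM ?mulr_ge0 ?invr_ge0 ?qnorm_ge0 // sqrtrM ?invr_ge0 ?qnorm_ge0 //.
by rewrite !sqrtrV ?qnorm_ge0 //; ring.
Qed.

Lemma gam_koranyi1 p a :
  gam (koranyi p a) (a / qnorm2 (siegel p a)) = (gam p a)^-1.
Proof. by rewrite /gam siegel_koranyi qnormV sqrtrV ?qnorm_ge0. Qed.

Lemma koranyiK p a : siegel p a != 0 ->
  koranyi (koranyi p a) (a / qnorm2 (siegel p a)) = p.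
Proof.
move=> p0; have c0 : qnorm2 (siegel p a) != 0 by rewrite qnorm2_eq0.
apply: ipoint_eq.
  apply/rowP => i; rewrite {1}/zc /= mxE siegel_koranyi invrK {1}/zc /= mxE.
  by rewrite -mulNr opprK -mulrA mulVr ?mulr1 ?unfold_in.
rewrite {1}/tc /= siegel_koranyi.
have -> : qnorm2 (siegel p a)^-1 = (qnorm2 (siegel p a))^-1.
  by rewrite -!sqr_qnorm qnormV exprVn.
rewrite invrK {1}/tc /=; move: c0; move: (qnorm2 _) => c c0.
by apply: quat_eq => /=; field.
Qed.

Lemma siegel_neq0 p a : 0 < gam p a -> siegel p a != 0.
Proof. by rewrite sqrtr_gt0 lt_def qnorm_eq0 => /andP[]. Qed.

Lemma hnbhsS p (U : set H) : hnbhs (Some p) U <->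
  exists2 e : R, 0 < e & forall h, gam (imul (iinv p) h.1) h.2%:num < e -> U h.
Proof.
split=> -[e e0 eU].
  exists (Num.min e (Num.sqrt e)); first by rewrite lt_min e0 sqrtr_gt0.
  move=> h; rewrite lt_min => /andP[h1 h2]; apply: eU.
    by rewrite idistE (le_lt_trans _ h1) // gam_homo.
  have := le_lt_trans (sqrt_le_gam (imul (iinv p) h.1) (ltW (hgt_gt0 h))) h2.
  by rewrite ltr_sqrt.
exists (Num.min (e / 2) ((e / 2) ^+ 2)).
  by rewrite lt_min ?exprn_gt0 ?divr_gt0.
move=> h; rewrite !lt_min idistE => /andP[h1 _] /andP[_ h2]; apply: eU.
rewrite (le_lt_trans (gam_le_gauge _ (ltW (hgt_gt0 h)))) //.
suff : Num.sqrt h.2%:num < e / 2 by move: h1; lra.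
rewrite -(@ger0_norm _ (e / 2)) ?divr_ge0 ?ltW // -sqrtr_sqr ltr_sqrt //.
by rewrite exprn_gt0 ?divr_gt0.
Qed.

Lemma hnbhsN (U : set H) : hnbhs None U <->
  exists M : R, forall h, M < gam h.1 h.2%:num -> U h.
Proof.
split=> -[M MU].
  exists (`|M| + Num.sqrt `|M|) => h hM; apply: MU; rewrite gaugeE.
  have [h1|h1] := ltP `|M| (gam h.1 0); first by left; exact: le_lt_trans (ler_norm _) h1.
  right; rewrite (le_lt_trans (ler_norm _)) // -ltr_sqrt //.
  by have := gam_le_gauge h.1 (ltW (hgt_gt0 h)); lra.
exists (`|M| + M ^+ 2) => h hM; apply: MU.
have hM' := ler_norm M; have M2 := sqr_ge0 M; have M0 := normr_ge0 M.
case: hM => [|hM]; first by rewrite gaugeE; have := gam_homo h.1 (lexx 0) (ltW (hgt_gt0 h)); lra.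
rewrite (le_lt_trans (ler_norm _)) // (lt_le_trans _ (sqrt_le_gam _ _)) //.
by rewrite -sqrtr_sqr ltr_sqrt //; lra.
Qed.

Lemma bnbhsN (U : set (bpoint R k n)) : bnbhs None U <->
  U None /\ exists M : R, forall q, M < gam q 0 -> U (Some q).
Proof. by split=> -[? [M h]]; split=> //; exists M => q; move: (h q); rewrite gaugeE. Qed.

End Hyperbolic.

(** * Isometries with their boundary action and conformal factor *)

Section Mobius.
Context {R : realType} {k : scalars} {n : nat}.
Local Notation X := (ipoint R k n).
Local Notation H := (hpoint R k n).
Local Notation bX := (bpoint R k n).
Local Notation O := (iorigin k n : X).
Implicit Types (p q r : X) (a b : R) (h : H) (xi eta : bX).

Definition bcontinuous (f : bX -> bX) : Prop :=
  forall xi V, bnbhs (f xi) V -> bnbhs xi (f @^-1` V).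

(* An isometry of hyperbolic space together with its boundary map [mb] and the
   conformal factor [mj] of the latter. *)
Record mob : Type := Mob {
  mh : H -> H;
  mhV : H -> H;
  mb : bX -> bX;
  mbV : bX -> bX;
  mj : bX -> R;
  mhK : cancel mh mhV;
  mhVK : cancel mhV mh;
  mbK : cancel mb mbV;
  mbVK : cancel mbV mb;
  mj_gt0 : forall xi, 0 < mj xi;
  mob_bus : forall xi h, bus (mb xi) (mh h) = mj xi * bus xi h;
  mob_bdist : forall xi eta, bdist (mb xi) (mb eta) = mj xi * mj eta * bdist xi eta;
  mob_cdist : forall h h', cdist (mh h) (mh h') = cdist h h';
  mob_tends : forall xi, btends mh xi (mb xi);
  mobV_tends : forall xi, btends mhV xi (mbV xi);
  mob_cont : bcontinuous mb;
  mobV_cont : bcontinuous mbV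
}.

Definition mcomp (m1 m2 : mob) : mob.
Proof.
refine (@Mob (mh m1 \o mh m2) (mhV m2 \o mhV m1) (mb m1 \o mb m2) (mbV m2 \o mbV m1)
  (fun xi => mj m1 (mb m2 xi) * mj m2 xi) _ _ _ _ _ _ _ _ _ _ _ _).
- exact: can_comp (mhK m1) (mhK m2).
- exact: can_comp (mhVK m2) (mhVK m1).
- exact: can_comp (mbK m1) (mbK m2).
- exact: can_comp (mbVK m2) (mbVK m1).
- by move=> xi; rewrite mulr_gt0 ?mj_gt0.
- by move=> xi h /=; rewrite !mob_bus mulrA.
- by move=> xi eta /=; rewrite !mob_bdist; ring.
- by move=> h h' /=; rewrite !mob_cdist.
- move=> xi U /mob_tends; exact: mob_tends.
- move=> xi U /mobV_tends; exact: mobV_tends.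
- move=> xi U /mob_cont; exact: mob_cont.
- move=> xi U /mobV_cont; exact: mobV_cont.
Defined.

Definition minv (m : mob) : mob.
Proof.
refine (@Mob (mhV m) (mh m) (mbV m) (mb m)
  (fun xi => (mj m (mbV m xi))^-1)
  (mhVK m) (mhK m) (mbVK m) (mbK m) _ _ _ _
  (@mobV_tends m) (@mob_tends m) (@mobV_cont m) (@mob_cont m)).
- by move=> xi; rewrite invr_gt0 mj_gt0.
- move=> xi h; have := mob_bus m (mbV m xi) (mhV m h); rewrite mbVK mhVK => ->.
  by rewrite mulKf // gt_eqF ?mj_gt0.
- move=> xi eta; have := mob_bdist m (mbV m xi) (mbV m eta); rewrite !mbVK => ->.
  by field; rewrite !gt_eqF ?mj_gt0.
- by move=> h h'; rewrite -(mob_cdist m) !mhVK.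
Defined.

Lemma mj_quot (m1 m2 : mob) xi : mb (mcomp (minv m1) m2) xi = xi ->
  mj (mcomp (minv m1) m2) xi = mj m2 xi / mj m1 xi.
Proof. by move=> /= ->; rewrite mulrC. Qed.

(** A point straight above [p] at small height, or above the origin at large height, lies in both
    sets. Together with [hnbhs_sep] this makes boundary limits unique, which identifies the choice
    made by [bact]. *)
Lemma hnbhs_meet xi (U V : set H) : hnbhs xi U -> hnbhs xi V -> exists2 h, U h & V h.
Proof.
case: xi => [p|].
  move=> /hnbhsS[e e0 eU] /hnbhsS[d d0 dV].
  have s0 : 0 < (Num.min e d / 2) ^+ 2 by rewrite exprn_gt0 // divr_gt0 // lt_min e0.
  have : gam (imul (iinv p) p) ((Num.min e d / 2) ^+ 2) < Num.min e d.
    rewrite imulVp gam_origin ?sqr_ge0 // sqrtr_sqr ger0_norm ?divr_ge0 ?le_min ?ltW //.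
    by rewrite ltr_pdivrMr // ltr_pMr ?lt_min ?e0 // ltr1n.
  rewrite lt_min => /andP[h1 h2]; exists (p, PosNum s0); [exact: eU|exact: dV].
move=> /hnbhsN[M MU] /hnbhsN[N NV].
have s0 : 0 < (`|M| + `|N| + 1) ^+ 2 by rewrite exprn_gt0 // ltr_wpDl ?addr_ge0.
have e : gam O ((`|M| + `|N| + 1) ^+ 2) = `|M| + `|N| + 1.
  by rewrite gam_origin ?sqr_ge0 // sqrtr_sqr ger0_norm // !addr_ge0.
have := (ler_norm M, ler_norm N, normr_ge0 M, normr_ge0 N) => -[[[? ?] ?] ?].
by exists (O, PosNum s0); [apply: MU|apply: NV] => /=; rewrite e; lra.
Qed.

Lemma hnbhs_sep xi eta : xi <> eta ->
  exists U V, [/\ hnbhs xi U, hnbhs eta V & forall h, U h -> V h -> False].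
Proof.
have aux p : exists U V, [/\ hnbhs (Some p) U, hnbhs None V & forall h, U h -> V h -> False].
  exists [set h | gam (imul (iinv p) h.1) h.2%:num < 1].
  exists [set h | gam p 0 + 1 < gam h.1 h.2%:num].
  split; [by apply/hnbhsS; exists 1|by apply/hnbhsN; exists (gam p 0 + 1)|].
  move=> h /= h1 h2; have := gamM p (imul (iinv p) h.1) (lexx 0) (ltW (hgt_gt0 h)).
  by rewrite imulKV add0r; lra.
case: xi eta => [p|] [q|] // pq; last first.
  by have [U [V [? ? h]]] := aux q; exists V, U; split=> // x /h{}h /h.
have e0 : 0 < idist p q by rewrite idist_gt0 // => e; apply: pq; rewrite e.
exists [set h | gam (imul (iinv p) h.1) h.2%:num < idist p q / 2].
exists [set h | gam (imul (iinv q) h.1) h.2%:num < idist p q / 2].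
split; try by apply/hnbhsS; exists (idist p q / 2) => //; rewrite divr_gt0.
move=> h /= h1 h2; have := idist_triangle p h.1 q.
rewrite (idistC h.1) (idistE p h.1) (idistE q h.1).
have := gam_homo (imul (iinv p) h.1) (lexx 0) (ltW (hgt_gt0 h)).
by have := gam_homo (imul (iinv q) h.1) (lexx 0) (ltW (hgt_gt0 h)); lra.
Qed.

Lemma bactE (g : H -> H) xi eta : btends g xi eta -> bact g xi = eta.
Proof.
move=> ge; rewrite /bact; case: xgetP => [zeta _ gz|/(_ eta)] //.
apply: contrapT => /hnbhs_sep[U [V [/gz Uz /ge Ve UV]]].
by have [h /UV] := hnbhs_meet Uz Ve; apply.
Qed.

Lemma bact_mob m xi : bact (mh m) xi = mb m xi.
Proof. exact/bactE/mob_tends. Qed.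

Lemma bact_mobF m : bact (mh m) = mb m.
Proof. by apply/funext => xi; exact: bact_mob. Qed.

Lemma mob_isometry m : isometry (@hdist R k n) (mh m).
Proof.
split=> [h h'|h]; first by apply/hdist_cdist; exact: mob_cdist.
by exists (mhV m h); rewrite mhVK.
Qed.

(** Preserving [gam] at every height amounts to preserving |z| and |t| separately, whereas an
    isometry for [idist] is only known to preserve |z|^4 + |t|^2. The stronger form is what makes
    [hmap f] an isometry of hyperbolic space. *)
Definition giso (f : X -> X) : Prop := forall a p q, 0 <= a ->
  gam (imul (iinv (f p)) (f q)) a = gam (imul (iinv p) q) a.

Lemma giso_inv f g : cancel g f -> giso f -> giso g.
Proof. by move=> gK fi a p q a0; rewrite -fi // !gK. Qed.

Definition hmap (f : X -> X) h : H := (f h.1, h.2).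

Lemma giso_tends f : giso f -> forall xi, btends (hmap f) xi (omap f xi).
Proof.
move=> fi [p|] U /=.
  move=> /hnbhsS[e e0 eU]; apply/hnbhsS; exists e => // h he.
  by apply: eU; rewrite /= fi.
move=> /hnbhsN[M MU]; apply/hnbhsN; exists (M + gam (f O) 0) => h hM; apply: MU => /=.
have := gamM (iinv (f O)) (f h.1) (lexx 0) (ltW (hgt_gt0 h)).
rewrite add0r fi // gamV -[imul _ h.1]imul0p imulKV; lra.
Qed.

Lemma giso_dist f p q : giso f -> idist (f p) (f q) = idist p q.
Proof. by move=> fi; rewrite !idistE fi. Qed.

Lemma giso_cont f : giso f -> bcontinuous (omap f).
Proof.
move=> fi [p|] U.
  move=> [e e0 eU]; exists e; first exact: e0.
  move=> q; rewrite -(giso_dist _ _ fi).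
  exact: eU.
move=> /bnbhsN[UN [M MU]]; apply/bnbhsN; split=> //.
exists (M + gam (f O) 0) => q qM; apply: MU.
have := idist_triangle (f O) O (f q).
by rewrite giso_dist // (idistC _ O) !idist0p; lra.
Qed.

Definition mob_iso (f g : X -> X) (fK : cancel f g) (gK : cancel g f) (fi : giso f) : mob.
Proof.
refine (@Mob (hmap f) (hmap g) (omap f) (omap g) (fun=> 1) _ _ _ _ _ _ _ _
  (giso_tends fi) (giso_tends (giso_inv gK fi))
  (giso_cont fi) (giso_cont (giso_inv gK fi))).
- by move=> [p s]; rewrite /hmap /= fK.
- by move=> [p s]; rewrite /hmap /= gK.
- by move=> [p|] //=; rewrite fK.
- by move=> [p|] //=; rewrite gK.
- by move=> _; exact: ltr01.
- by move=> [q|] h /=; rewrite mul1r ?fi.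
- by move=> [q|] [r|] /=; rewrite !mul1r ?giso_dist.
- by move=> h h'; rewrite /cdist /= fi // addr_ge0.
Defined.

Lemma giso_id : giso idfun. Proof. by []. Qed.

Definition mid : mob := @mob_iso idfun idfun (fun=> erefl) (fun=> erefl) giso_id.

Lemma giso_mul r : giso (imul r).
Proof. by move=> a p q _; rewrite iinvM -imulA imulK. Qed.

Definition mtrans r : mob := mob_iso (imulK r) (imulKV r) (@giso_mul r).

Lemma gam0_gt0 p : p <> O -> 0 < gam p 0.
Proof. by move=> p0; rewrite lt_def gam_ge0 andbT; apply/eqP => /gam0_eq0. Qed.

Lemma siegel0_neq0 p : p <> O -> siegel p 0 != 0.
Proof. by move=> /gam0_gt0/siegel_neq0. Qed.

Lemma hsiegel_neq0 h : siegel h.1 h.2%:num != 0.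
Proof. exact/siegel_neq0/gam_gt0/hgt_gt0. Qed.

Lemma gam_iota p : gam (iota_minus p) 0 = (gam p 0)^-1.
Proof. by rewrite -gam_koranyi1 mul0r. Qed.

Lemma iota_neq0 p : p <> O -> iota_minus p <> O.
Proof.
move=> p0 e; have := gam_iota p; rewrite e gam_origin // sqrtr0 => /esym/eqP.
by rewrite invr_eq0 gt_eqF // gam0_gt0.
Qed.

Lemma iota_minusK p : p <> O -> iota_minus (iota_minus p) = p.
Proof. by move=> /siegel0_neq0 p0; rewrite -{2}(koranyiK p0) mul0r. Qed.

Lemma idist_iota p q : p <> O -> q <> O ->
  idist (iota_minus p) (iota_minus q) = idist p q / (gam p 0 * gam q 0).
Proof.
move=> p0 q0; rewrite !idistE; have := gam_koranyi (siegel0_neq0 p0) (siegel0_neq0 q0).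
by rewrite !mul0r !addr0.
Qed.

Lemma iota_hyp_num h : (iota_hyp h).2%:num = h.2%:num / gam h.1 h.2%:num ^+ 4.
Proof. by rewrite gam4. Qed.

Lemma gam_iotah1 h :
  gam (iota_hyp h).1 (iota_hyp h).2%:num = (gam h.1 h.2%:num)^-1.
Proof. by rewrite -gam_koranyi1. Qed.

Lemma iota_hypK : involutive (@iota_hyp R k n).
Proof.
move=> h; apply: hpoint_eq; first exact/koranyiK/hsiegel_neq0.
rewrite iota_hyp_num gam_iotah1 iota_hyp_num.
by field; rewrite gt_eqF ?gam_gt0.
Qed.

Definition biota xi : bX :=
  if xi is Some p then if p == O then None else Some (iota_minus p) else Some O.

(** The factor is |p|^-4 because [bdist] is a fourth power; the value 1 at the origin and at
    infinity is forced by the normalisation of [bdist] at infinity. *)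
Definition jiota xi : R :=
  if xi is Some p then if p == O then 1 else (gam p 0 ^+ 4)^-1 else 1.

Lemma biotaK : involutive biota.
Proof.
move=> [p|] /=; last by rewrite eqxx.
have [->//|/eqP p0 /=] := eqVneq p O.
by rewrite iota_minusK //; case: eqP => // /(iota_neq0 p0).
Qed.

Lemma gam_iotah h q : q <> O ->
  gam (imul (iinv (iota_minus q)) (iota_hyp h).1) (iota_hyp h).2%:num =
  gam (imul (iinv q) h.1) h.2%:num / (gam q 0 * gam h.1 h.2%:num).
Proof.
move=> q0; have := gam_koranyi (siegel0_neq0 q0) (hsiegel_neq0 h).
by rewrite mul0r !add0r.
Qed.

Lemma bus_iota xi h : bus (biota xi) (iota_hyp h) = jiota xi * bus xi h.
Proof.
have g0 : gam h.1 h.2%:num != 0 by rewrite gt_eqF ?gam_gt0.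
have s0 : h.2%:num != 0 by rewrite gt_eqF.
case: xi => [q|]; last first.
  rewrite /bus /biota /jiota imulp0 gamV gam_iotah1 iota_hyp_num.
  by field; rewrite ?g0 ?s0.
rewrite /biota /jiota; have [->|/eqP q0] := eqVneq q O.
  by rewrite mul1r /bus imulp0 gamV iota_hyp_num; field; rewrite ?g0 ?s0.
have q1 : gam q 0 != 0 by rewrite gt_eqF ?gam0_gt0.
rewrite /bus -gamV iinvM iinvK gam_iotah // iota_hyp_num.
rewrite -(gamV (imul (iinv h.1) q)) iinvM iinvK.
by field; rewrite ?g0 ?s0 ?q1.
Qed.

Lemma bdist_iota xi eta : bdist (biota xi) (biota eta) = jiota xi * jiota eta * bdist xi eta.
Proof.
have aux q : bdist (biota None) (biota (Some q)) =
    jiota None * jiota (Some q) * bdist None (Some q).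
  rewrite /=; have [_|_] := eqVneq q O; first by rewrite !mul1r.
  by rewrite /= idist0p gam_iota mulr1 mul1r exprVn.
have bC (x y : bX) : bdist x y = bdist y x by case: x y => [?|] [?|] //=; rewrite idistC.
case: xi eta => [p|] [q|]; first last.
- by rewrite /= idistxx expr0n mulr0.
- exact: aux.
- by rewrite [LHS]bC aux /=; ring.
rewrite /=; have [->|/eqP p0] := eqVneq p O; have [->|/eqP q0] := eqVneq q O => /=.
- by rewrite idistxx expr0n mulr0.
- by rewrite idist0p mul1r mulVf // expf_neq0 // gt_eqF ?gam0_gt0.
- by rewrite idistC idist0p mulr1 mulVf // expf_neq0 // gt_eqF ?gam0_gt0.
by rewrite idist_iota // !exprMn !exprVn exprMn invfM; ring.
Qed.

Lemma cdist_iota h h' : cdist (iota_hyp h) (iota_hyp h') = cdist h h'.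
Proof.
rewrite /cdist gam_koranyi ?hsiegel_neq0 // !iota_hyp_num.
by field; rewrite !gt_eqF ?gam_gt0.
Qed.

(** Continuity of the inversion away from the origin: for gauges P and y of two points at distance
    x, their images are at distance x / (P y). *)
Lemma ratio_lt (P e x y : R) : 0 < P -> 0 < e -> x < Num.min (P / 2) (e * P ^+ 2 / 2) ->
  0 <= x -> P <= y + x -> x / (P * y) < e.
Proof.
move=> P0 e0; rewrite lt_min => /andP[h1 h2] x0 h3.
have y0 : P / 2 < y by lra.
rewrite ltr_pdivrMr; last by nra.
have : 0 < e * P * (y - P / 2) by rewrite !mulr_gt0 ?subr_gt0.
by nra.
Qed.

Lemma iota_tends xi : btends (@iota_hyp R k n) xi (biota xi).
Proof.
case: xi => [p|] U; last first.
  move=> /hnbhsS[e e0 eU]; apply/hnbhsN; exists e^-1 => h he; apply: eU.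
  rewrite -gamV iinvM iinvK imulp0 gamV gam_iotah1.
  by rewrite -[e]invrK ltf_pV2 ?posrE ?invr_gt0 ?gam_gt0.
rewrite /=; have [->|/eqP p0] := eqVneq p O.
  move=> /hnbhsN[M MU]; apply/hnbhsS; exists (`|M| + 1)^-1 => [|h he].
    by rewrite invr_gt0 ltr_wpDl.
  apply: MU; rewrite gam_iotah1.
  move: he; rewrite -[imul _ _]imul0p imulKV => he.
  have : `|M| + 1 < (gam h.1 h.2%:num)^-1.
    by rewrite -[`|M| + 1]invrK ltf_pV2 ?posrE ?invr_gt0 ?gam_gt0 // ltr_wpDl.
  by have := ler_norm M; lra.
move=> /hnbhsS[e e0 eU]; apply/hnbhsS.
exists (Num.min (gam p 0 / 2) (e * gam p 0 ^+ 2 / 2)).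
  by rewrite lt_min !divr_gt0 ?mulr_gt0 ?exprn_gt0 ?gam0_gt0.
move=> h he; apply: eU; rewrite gam_iotah // ratio_lt ?gam0_gt0 ?gam_ge0 //.
have := gamM h.1 (imul (iinv h.1) p) (ltW (hgt_gt0 h)) (lexx 0).
rewrite imulKV addr0 -(gamV (imul _ p)) iinvM iinvK.
have := gam_homo p (lexx 0) (ltW (hgt_gt0 h)).
have := gam_homo (imul (iinv p) h.1) (lexx 0) (ltW (hgt_gt0 h)).
by lra.
Qed.

Lemma iota_cont : bcontinuous biota.
Proof.
case=> [p|] U; last first.
  move=> [e e0 eU]; apply/bnbhsN; split; first by apply: eU; rewrite idistxx.
  exists e^-1 => q he; rewrite /preimage /=.
  have q0 : 0 < gam q 0 by rewrite (lt_trans _ he) ?invr_gt0.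
  have /eqP/negbTE -> : q <> O by move=> e1; move: q0; rewrite e1 gam_origin // sqrtr0 ltxx.
  apply: eU; rewrite idist0p gam_iota.
  by rewrite -[e]invrK ltf_pV2 ?posrE ?invr_gt0.
rewrite /=; have [->|/eqP p0] := eqVneq p O.
  move=> /bnbhsN[UN [M MU]]; exists (`|M| + 1)^-1 => [|q he].
    by rewrite invr_gt0 ltr_wpDl.
  rewrite /preimage /=; have [//|/eqP q0] := eqVneq q O.
  apply: MU; rewrite gam_iota; move: he; rewrite idist0p => he.
  have : `|M| + 1 < (gam q 0)^-1.
    by rewrite -[`|M| + 1]invrK ltf_pV2 ?posrE ?invr_gt0 ?gam0_gt0 // ltr_wpDl.
  by have := ler_norm M; lra.
move=> [e e0 eU].
exists (Num.min (gam p 0 / 2) (e * gam p 0 ^+ 2 / 2)).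
  by rewrite lt_min !divr_gt0 ?mulr_gt0 ?exprn_gt0 ?gam0_gt0.
move=> q he; rewrite /preimage /=.
have tr : gam p 0 <= gam q 0 + idist p q.
  by have := idist_triangle O q p; rewrite !idist0p idistC.
have q0 : q <> O.
  move=> e1; move: he tr; rewrite e1 gam_origin // sqrtr0 lt_min => /andP[].
  by have := gam0_gt0 p0; lra.
have /eqP/negbTE -> := q0; apply: eU; rewrite idist_iota //.
by rewrite ratio_lt ?gam0_gt0 ?idist_ge0.
Qed.

Definition miota : mob.
Proof.
refine (@Mob (@iota_hyp R k n) (@iota_hyp R k n) biota biota jiota
  iota_hypK iota_hypK biotaK biotaK _ bus_iota bdist_iota cdist_iota
  iota_tends iota_tends iota_cont iota_cont).
move=> [p|] /=; last exact: ltr01.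
by case: eqP => [_|p0]; rewrite ?ltr01 // invr_gt0 exprn_gt0 ?gam0_gt0.
Defined.

(** A translation takes the point to the origin and the inversion takes the origin to infinity.
    Statements about a fixed point thereby reduce to similarities of [X]. *)
Lemma mob_to_infinity xi : exists m : mob, mb m xi = None.
Proof.
case: xi => [p|]; last by exists mid.
exists (mcomp miota (mtrans (iinv p))).
by rewrite /= imulVp eqxx.
Qed.

End Mobius.
Arguments mob R k n : clear implicits.

(** * Completeness of the gauge metric and the contraction principle *)

Section Complete.
Context {R : realType}.

Lemma exists_expr_lt (c e : R) : 0 <= c -> c < 1 -> 0 < e ->
  exists N, forall m, (N <= m)%N -> c ^+ m < e.
Proof.
move=> c0 c1 e0; have : `|c| < 1 by rewrite ger0_norm.
move=> /cvg_expr/cvgr0Pnorm_lt/(_ e e0)[N _ h]; exists N => m Nm.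
by have := h m Nm; rewrite ger0_norm // exprn_ge0.
Qed.

Lemma geometric_eq0 (A c x : R) : 0 <= c -> c < 1 ->
  (forall m, `|x| <= A * c ^+ m) -> x = 0.
Proof.
move=> c0 c1 h; apply/eqP; rewrite -normr_eq0 eq_le normr_ge0 andbT leNgt; apply/negP => x0.
have A0 : 0 <= A by have := h 0%N; rewrite expr0 mulr1; lra.
have [N /(_ N (leqnn _)) Nh] := exists_expr_lt c0 c1 (divr_gt0 x0 (ltr_wpDl A0 ltr01)).
have := h N; rewrite leNgt => /negP; apply.
move: Nh; rewrite ltr_pdivlMr ?ltr_wpDl //.
by have := exprn_ge0 N c0; move: (c ^+ N) => y; nra.
Qed.

(** With B (1 - c) = A, the sequence u_m - B c^m is nondecreasing, u_m + B c^m is nonincreasing, and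
    the supremum of the former lies between the two. *)
Lemma geometric_limit (u : nat -> R) (A c : R) : 0 <= c -> c < 1 ->
  (forall m, `|u m.+1 - u m| <= A * c ^+ m) ->
  exists l, forall m, `|l - u m| <= A / (1 - c) * c ^+ m.
Proof.
move=> c0 c1 h; pose B := A / (1 - c).
have A0 : 0 <= A by have := h 0%N; rewrite expr0 mulr1; apply: le_trans.
have d0 : 0 < 1 - c by lra.
have BA : B * (1 - c) = A by rewrite /B divfK // gt_eqF.
have B0 : 0 <= B by rewrite divr_ge0 // ltW.
have lo m j : u m - B * c ^+ m <= u (m + j)%N - B * c ^+ (m + j).
  elim: j => [|j IH]; first by rewrite addn0.
  rewrite addnS (le_trans IH) //; have := h (m + j)%N; rewrite ler_norml exprS -BA.
  by move=> /andP[]; move: (c ^+ _) => y; lra.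
have hi m j : u (m + j)%N + B * c ^+ (m + j) <= u m + B * c ^+ m.
  elim: j => [|j IH]; first by rewrite addn0.
  rewrite addnS (le_trans _ IH) //; have := h (m + j)%N; rewrite ler_norml exprS -BA.
  by move=> /andP[]; move: (c ^+ _) => y; lra.
have lohi m j : u m - B * c ^+ m <= u j + B * c ^+ j.
  have := lo m j; have := hi j m; rewrite addnC.
  by have := mulr_ge0 B0 (exprn_ge0 (m + j) c0); lra.
pose E := range (fun m => u m - B * c ^+ m).
exists (sup E) => m; rewrite ler_norml; apply/andP; split.
  have : u m - B * c ^+ m <= sup E; last by rewrite -/B; lra.
  apply: ub_le_sup; last by exists m.
  by exists (u 0%N + B * c ^+ 0) => _ [j _ <-].
have : sup E <= u m + B * c ^+ m; last by rewrite -/B; lra.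
by apply: ge_sup; [exists (u 0%N - B * c ^+ 0), 0%N|move=> _ [j _ <-]].
Qed.

Lemma quat_geometric_limit (u : nat -> quat R) (A c : R) : 0 <= c -> c < 1 ->
  (forall m, qnorm (u m.+1 - u m) <= A * c ^+ m) ->
  exists l, forall m, qnorm (l - u m) <= 4 * (A / (1 - c)) * c ^+ m.
Proof.
move=> c0 c1 h.
have [||m|l1 h1] := @geometric_limit (fun m => qre (u m)) A c => //.
  by apply: le_trans (h m); have [] := norm_coord_le (u m.+1 - u m).
have [||m|l2 h2] := @geometric_limit (fun m => qi (u m)) A c => //.
  by apply: le_trans (h m); have [] := norm_coord_le (u m.+1 - u m).
have [||m|l3 h3] := @geometric_limit (fun m => qj (u m)) A c => //.
  by apply: le_trans (h m); have [] := norm_coord_le (u m.+1 - u m).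
have [||m|l4 h4] := @geometric_limit (fun m => qk (u m)) A c => //.
  by apply: le_trans (h m); have [] := norm_coord_le (u m.+1 - u m).
exists (Quat l1 l2 l3 l4) => m; rewrite (le_trans (qnorm_le_coord _)) //=.
by move: (h1 m) (h2 m) (h3 m) (h4 m); lra.
Qed.

Lemma in_scalars_limit k (u : nat -> quat R) l (A c : R) : 0 <= c -> c < 1 ->
  (forall m, u m \in in_scalars k) ->
  (forall m, qnorm (l - u m) <= A * c ^+ m) -> l \in in_scalars k.
Proof.
move=> c0 c1 uk h.
have pi : (forall m, qi (u m) = 0) -> qi l = 0.
  move=> e; apply: (geometric_eq0 c0 c1) => m; apply: le_trans (h m).
  by have [_ + _ _] := norm_coord_le (l - u m); rewrite /= e subr0.
have pj : (forall m, qj (u m) = 0) -> qj l = 0.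
  move=> e; apply: (geometric_eq0 c0 c1) => m; apply: le_trans (h m).
  by have [_ _ + _] := norm_coord_le (l - u m); rewrite /= e subr0.
have pk : (forall m, qk (u m) = 0) -> qk l = 0.
  move=> e; apply: (geometric_eq0 c0 c1) => m; apply: le_trans (h m).
  by have [_ _ _ +] := norm_coord_le (l - u m); rewrite /= e subr0.
rewrite unfold_in; move: uk; case: k => uk //=.
  by rewrite pi ?pj ?pk ?eqxx // => m; have /and3P[/eqP ? /eqP ? /eqP] := uk m.
by rewrite pj ?pk ?eqxx // => m; have /andP[/eqP ? /eqP] := uk m.
Qed.

Context {k : scalars} {n : nat}.
Local Notation X := (ipoint R k n).
Local Notation O := (iorigin k n : X).
Implicit Types p q : X.

Lemma zc_diff_le p q : Num.sqrt (vnorm2 (zc q - zc p)) <= idist p q.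
Proof.
by rewrite idistE (_ : zc q - zc p = zc (imul (iinv p) q)) ?vnorm_gam // !ipointE addrC.
Qed.

Lemma tc_diff p q :
  tc (imul (iinv p) q) = tc q - tc p - qim (vdot (zc p) (zc q - zc p)) *+ 2.
Proof.
rewrite !ipointE vdotNl vdotDr vdotNr vdotzz !mulr2n.
by apply: quat_eq => /=; rewrite ?tc_im; ring.
Qed.

Lemma qnorm_tc_diff p q : qnorm (qim (vdot (zc p) (zc q - zc p)) *+ 2) <=
  2 * gam p 0 * Num.sqrt (vnorm2 (zc q - zc p)).
Proof.
rewrite mulr2n (le_trans (ler_qnormD _ _)) //.
have h : qnorm (qim (vdot (zc p) (zc q - zc p))) <=
         gam p 0 * Num.sqrt (vnorm2 (zc q - zc p)).
  rewrite (le_trans (qnorm_im _)) // (le_trans (qnorm_vdot _ _)) //.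
  by rewrite ler_wpM2r ?sqrtr_ge0 ?vnorm_gam.
by move: h; lra.
Qed.

(** The group law twists the difference of vertical coordinates by a term of size 2 |p| d. This
    bound and [idist_coord_le] compare the gauge metric with the coordinates on bounded sets. *)
Lemma tc_diff_le p q :
  qnorm (tc q - tc p) <= idist p q ^+ 2 + 2 * gam p 0 * idist p q.
Proof.
have -> : tc q - tc p = tc (imul (iinv p) q) + qim (vdot (zc p) (zc q - zc p)) *+ 2.
  by rewrite tc_diff subrK.
rewrite (le_trans (ler_qnormD _ _)) // lerD //.
  rewrite idistE -(@ler_pXn2r _ 2) ?nnegrE ?exprn_ge0 ?gam_ge0 ?qnorm_ge0 //.
  by rewrite sqr_qnorm -exprM gam4E addr0 lerDr sqr_ge0.
rewrite (le_trans (qnorm_tc_diff _ _)) // ler_wpM2l ?zc_diff_le //.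
by rewrite mulr_ge0 ?gam_ge0.
Qed.

Lemma idist_coord_le p q : idist p q ^+ 2 <= vnorm2 (zc q - zc p) +
  (qnorm (tc q - tc p) + 2 * gam p 0 * Num.sqrt (vnorm2 (zc q - zc p))).
Proof.
rewrite idistE sqr_gam /siegel tc_diff (le_trans (ler_qnormD _ _)) // lerD //.
  rewrite qnorm_real ?vnorm2_ge0 // (_ : zc (imul _ _) = zc q - zc p) //.
  by rewrite !ipointE addrC.
rewrite (_ : qreal 0 = 0) // add0r (le_trans (ler_qnormD _ _)) // lerD2l qnormN.
exact: qnorm_tc_diff.
Qed.

Lemma vnorm2_le (z : 'rV[quat R]_n) (A : R) :
  0 <= A -> (forall i, qnorm (z 0 i) <= A) -> vnorm2 z <= (n%:R * A) ^+ 2.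
Proof.
move=> A0 h; apply: (@le_trans _ _ (\sum_(i < n) A ^+ 2)).
  by apply: ler_sum => i _; rewrite -sqr_qnorm ler_pXn2r ?nnegrE ?qnorm_ge0.
rewrite sumr_const card_ord exprMn -[leLHS]mulr_natl ler_wpM2r ?sqr_ge0 //.
by rewrite -natrX ler_nat; case: n => // j; rewrite -{1}[j.+1]expn1 leq_pexp2l.
Qed.

Lemma contraction_fixpoint (f : X -> X) (c : R) : 0 <= c -> c < 1 ->
  (forall p q, idist (f p) (f q) = c * idist p q) -> exists q, f q = q.
Proof.
move=> c0 c1 fc; pose u m := iter m f O; pose d := idist O (f O).
have d0 : 0 <= d by exact: idist_ge0.
have ud m : idist (u m) (u m.+1) = d * c ^+ m.
  elim: m => [|m IH]; first by rewrite expr0 mulr1.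
  by rewrite /u 2!iterS fc IH exprS mulrCA.
have e1 : 0 < 1 - c by lra.
pose B := d / (1 - c).
have B0 : 0 <= B by rewrite divr_ge0 // ltW.
(* The comparison of vertical coordinates involves the gauge of the point, so the iterates are first
   shown to stay bounded. *)
have uB m : gam (u m) 0 <= B * (1 - c ^+ m).
  elim: m => [|m IH]; first by rewrite gam_origin // sqrtr0 expr0 subrr mulr0.
  have := idist_triangle O (u m) (u m.+1); rewrite !idist0p ud.
  have dB : d = B * (1 - c) by rewrite /B divfK // gt_eqF.
  by rewrite exprS dB; move: IH; lra.
have {}uB m : gam (u m) 0 <= B.
  rewrite (le_trans (uB m)) // mulrBr mulr1 gerBl mulr_ge0 // exprn_ge0 //.
have cm1 m : c ^+ m <= 1 by rewrite exprn_ile1 // ltW.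
have cm0 m : 0 <= c ^+ m by rewrite exprn_ge0.
have /choice[l lP] i : exists l, forall m,
    qnorm (l - zc (u m) 0 i) <= 4 * (d / (1 - c)) * c ^+ m.
  apply: quat_geometric_limit => // m; rewrite -ud (le_trans _ (zc_diff_le _ _)) //.
  rewrite ler_wsqrtr // /vnorm2 (bigD1 i) //= !mxE lerDl.
  by apply: sumr_ge0 => *; exact: qnorm2_ge0.
have [||m|t tP] := @quat_geometric_limit (fun m => tc (u m)) (d ^+ 2 + 2 * B * d) c => //.
  rewrite (le_trans (tc_diff_le _ _)) // ud [leRHS]mulrDl; apply: lerD.
    by rewrite exprMn ler_wpM2l ?sqr_ge0 // expr2 ler_piMl.
  rewrite mulrA; apply: ler_wpM2r => //; rewrite ler_wpM2r //.
  by rewrite ler_wpM2l // uB.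
have zk i : l i \in in_scalars k.
  exact: (in_scalars_limit c0 c1 (fun m => zc_in (u m) i) (lP i)).
have tk : t \in in_scalars k.
  exact: (in_scalars_limit c0 c1 (fun m => tc_in (u m)) tP).
have t0 : qre t = 0.
  apply: (geometric_eq0 c0 c1) => m; apply: le_trans (tP m).
  by have [+ _ _ _] := norm_coord_le (t - tc (u m)); rewrite /= tc_im subr0.
have Pp : ipoint_pred k (\row_i l i, t) by apply: ipointP => // i; rewrite mxE.
pose P : X := IPoint Pp.
set A := 4 * (d / (1 - c)) in lP; set T := 4 * (_ / (1 - c)) in tP.
have A0 : 0 <= A by rewrite mulr_ge0.
have T0 : 0 <= T.
  apply: mulr_ge0 => //; apply: divr_ge0; last exact: ltW.
  by apply: addr_ge0; [exact: sqr_ge0|apply: mulr_ge0 => //; exact: mulr_ge0].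
have nA : 0 <= n%:R * A by rewrite mulr_ge0.
(* The vertical coordinate converges at rate c^m and enters the squared distance linearly, hence
   only the square of the distance is bounded by a multiple of c^m. *)
have uP m : idist (u m) P ^+ 2 <= ((n%:R * A) ^+ 2 + (T + 2 * B * (n%:R * A))) * c ^+ m.
  rewrite (le_trans (idist_coord_le _ _)) //.
  have vn : vnorm2 (zc P - zc (u m)) <= (n%:R * A * c ^+ m) ^+ 2.
    rewrite -mulrA; apply: vnorm2_le; first by rewrite mulr_ge0.
    by move=> i; rewrite !mxE; exact: lP.
  have vs : Num.sqrt (vnorm2 (zc P - zc (u m))) <= n%:R * A * c ^+ m.
    have xx : 0 <= n%:R * A * c ^+ m by rewrite mulr_ge0.
    by rewrite -(ger0_norm xx) -sqrtr_sqr ler_wsqrtr.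
  rewrite [leRHS]mulrDl; apply: lerD; last rewrite [leRHS]mulrDl; last apply: lerD.
  - rewrite (le_trans vn) // exprMn ler_wpM2l ?sqr_ge0 // expr2 ler_piMl //.
  - exact: tP.
  - rewrite -[leRHS]mulrA; apply: ler_pM => //; rewrite ?sqrtr_ge0 ?mulr_ge0 ?gam_ge0 //.
    by rewrite ler_wpM2l.
clearbody P.
exists P; apply: idist_eq0; apply/eqP; rewrite eq_le idist_ge0 andbT leNgt; apply/negP => e0.
set W := (_ + _) in uP.
have W0 : 0 <= W.
  apply: addr_ge0; first exact: sqr_ge0.
  by apply: addr_ge0 => //; apply: mulr_ge0 => //; exact: mulr_ge0.
pose e := idist (f P) P.
have ee : 0 < (e / 2) ^+ 2 / (W + 1) by rewrite divr_gt0 ?exprn_gt0 ?divr_gt0 ?ltr_wpDl.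
have [N Nh] := exists_expr_lt c0 c1 ee.
have uPe m : (N <= m)%N -> idist (u m) P < e / 2.
  move=> /Nh; rewrite ltr_pdivlMr ?ltr_wpDl // => h.
  rewrite -(@ltr_pXn2r _ 2) ?nnegrE ?idist_ge0 ?divr_ge0 ?(ltW e0) //.
  rewrite (le_lt_trans (uP m)) // (le_lt_trans _ h) // mulrC ler_wpM2l // lerDl //.
have lt1 : idist (f P) (u N.+1) < e / 2.
  rewrite [u N.+1]/u iterS fc -/(u N) idistC (le_lt_trans _ (uPe N (leqnn _))) //.
  by rewrite ler_piMl ?idist_ge0 // ltW.
have := idist_triangle (f P) (u N.+1) P.
by rewrite leNgt -/e [ltRHS](splitr e) ltrD // uPe.
Qed.

End Complete.

(** * Dynamics of an isometry at a boundary fixed point *)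

Section FixedPoints.
Context {R : realType} {k : scalars} {n : nat}.
Local Notation X := (ipoint R k n).
Local Notation H := (hpoint R k n).
Local Notation bX := (bpoint R k n).
Local Notation O := (iorigin k n : X).
Implicit Types (p q r : X) (h : H) (xi eta : bX) (m ka : mob R k n).

Definition hone p : H := (p, PosNum (@ltr01 R)).

Lemma gam_min_eq0 p (a : R) : 0 <= a -> gam p a ^+ 4 = a ^+ 2 -> p = O.
Proof.
rewrite gam4E => a0 h; apply: gam0_eq0.
suff /eqP : gam p 0 ^+ 4 = 0 by rewrite expf_eq0 /= => /eqP.
rewrite gam4E addr0; have := vnorm2_ge0 (zc p); have := qnorm2_ge0 (tc p).
by move: h; move: (vnorm2 _) (qnorm2 _) => u v h u0 v0; nra.
Qed.

Lemma mob_fix_infty m : mb m None = None ->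
  exists c : R, exists f : X -> X,
  [/\ 0 < c, c ^+ 2 = (mj m None)^-1,
      forall p, mb m (Some p) = Some (f p),
      forall p q, idist (f p) (f q) = c * idist p q &
      forall h, (mh m h).1 = f h.1 /\ (mh m h).2%:num = c ^+ 2 * h.2%:num].
Proof.
move=> mN; pose lam := (mj m None)^-1.
have l0 : 0 < lam by rewrite invr_gt0 mj_gt0.
exists (Num.sqrt lam), (fun p => odflt O (mb m (Some p))).
have c2 : Num.sqrt lam ^+ 2 = lam by rewrite sqr_sqrtr // ltW.
have c0 : 0 < Num.sqrt lam by rewrite sqrtr_gt0.
have mS p : mb m (Some p) = Some (odflt O (mb m (Some p))).
  case e : (mb m (Some p)) => [q|]; first by [].
  by have := can_inj (mbK m) (etrans e (esym mN)).
(* [bdist None (Some p)] is always 1, so the factor at any finite point is the inverse of the factor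
   at infinity. *)
have jS p : mj m (Some p) = lam.
  have := mob_bdist m None (Some p); rewrite mN mS /= mulr1 => e.
  rewrite /lam; apply: (mulfI (x := mj m None)); first by rewrite gt_eqF ?mj_gt0.
  by rewrite -e divff // gt_eqF ?mj_gt0.
have hS h : (mh m h).2%:num = lam * h.2%:num.
  have := mob_bus m None h; rewrite mN /= => e.
  by rewrite -[LHS]invrK e invfM invrK.
split=> //.
- move=> p q; have := mob_bdist m (Some p) (Some q).
  rewrite !jS (mS p) (mS q) /= => e; apply/eqP.
  rewrite -(@eqrXn2 _ 4) ?idist_ge0 ?mulr_ge0 ?idist_ge0 ?sqrtr_ge0 // e exprMn.
  by rewrite (exprM (Num.sqrt _) 2 2) c2.
(* The value of [bus (Some q) h] is at least the height of [h], with equality only for [q = h.1].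
   Equality persists in the image, which therefore lies straight above [f h.1]. *)
- move=> h; rewrite c2; split=> //.
  have := mob_bus m (Some h.1) h; rewrite jS mS /= imulVp gam_origin // hS.
  rewrite (exprM (Num.sqrt h.2%:num) 2 2) (sqr_sqrtr (ltW (hgt_gt0 h))) => e.
  set P := odflt _ _ in e *.
  have : imul (iinv (mh m h).1) P = O.
    apply: (@gam_min_eq0 _ (lam * h.2%:num)); first by rewrite mulr_ge0 // ltW.
    have s0 : h.2%:num != 0 by rewrite gt_eqF.
    have {e} := congr1 (fun x => x * (lam * h.2%:num)) e.
    rewrite divfK ?mulf_neq0 ?gt_eqF // => ->.
    by field.
  by move=> e1; rewrite -(imulKV (mh m h).1 P) e1 imulp0.
Qed.

Lemma minv_fix m xi : mb m xi = xi -> mb (minv m) xi = xi.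
Proof. by move=> e; rewrite -{1}e; exact: mbK. Qed.

Lemma mj_minv m xi : mb m xi = xi -> mj (minv m) xi = (mj m xi)^-1.
Proof. by move=> /minv_fix /= ->. Qed.

Lemma fix_infty_two m : mb m None = None -> mj m None <> 1 ->
  exists2 q, mb m (Some q) = Some q & forall p, mb m (Some p) = Some p -> p = q.
Proof.
move=> mN j1; have [c [f [c0 c2 mS fc _]]] := mob_fix_infty mN.
have c1 : c <> 1 by move=> e; apply: j1; rewrite -[LHS]invrK -c2 e expr1n invr1.
have [q qf] : exists q, f q = q.
  (* For c > 1 the inverse is a contraction with the same fixed points. *)
  case: (ltgtP c 1) => // cc; first by apply: contraction_fixpoint fc => //; exact: ltW.
  have [c' [f' [c0' c2' mS' fc' _]]] := mob_fix_infty (minv_fix mN).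
  have [||q qf] := contraction_fixpoint _ _ fc'; first exact: ltW.
    rewrite -(@ltr_pXn2r _ 2) ?nnegrE ?ltW // expr1n c2' mj_minv // invrK.
    by rewrite -[mj _ _]invrK -c2 invf_lt1 ?exprn_gt0 // expr_gt1 // ltW.
  exists q; apply: Some_inj; rewrite -mS -{1}qf -mS'; exact: mbVK.
exists q; first by rewrite mS qf.
move=> p; rewrite mS => -[pf]; apply: idist_eq0; apply/eqP.
have := fc p q; rewrite pf qf => /eqP; rewrite -subr_eq0 -{1}[idist p q]mul1r -mulrBl.
by rewrite mulf_eq0 subr_eq0 => /orP[/eqP/esym//|].
Qed.

Lemma iter_mob m (f : X -> X) j p : (forall p, mb m (Some p) = Some (f p)) ->
  iter j (mb m) (Some p) = Some (iter j f p).
Proof. by move=> mS; elim: j => //= j ->. Qed.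

Lemma iter_sim (f : X -> X) (c : R) j p q :
  (forall p q, idist (f p) (f q) = c * idist p q) ->
  idist (iter j f p) (iter j f q) = c ^+ j * idist p q.
Proof. by move=> fc; elim: j => [|j IH]; rewrite ?expr0 ?mul1r //= fc IH exprS mulrA. Qed.

Lemma attracting_point m q : mb m None = None -> mb m (Some q) = Some q ->
  1 < mj m None -> attracting (mh m) (Some q).
Proof.
move=> mN mq j1; have [c [f [c0 c2 mS fc _]]] := mob_fix_infty mN.
have c1 : c < 1.
  rewrite -(@ltr_pXn2r _ 2) ?nnegrE ?ltW // expr1n c2 invf_lt1 ?mj_gt0 //.
have fq : f q = q by apply: Some_inj; rewrite -mS.
exists [set x | if x is Some p then idist q p < 1 else False]; first by exists 1.
move=> V [e e0 eV]; have [N Nh] := exists_expr_lt (ltW c0) c1 e0.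
exists N => j /Nh je _ [[p|] //= pU <-]; rewrite bact_mobF (iter_mob _ _ mS).
apply: eV; have <- : iter j f q = q by elim: (j) => //= i ->.
rewrite (iter_sim _ _ _ fc) (le_lt_trans _ je) // ler_piMr ?exprn_ge0 ?ltW //.
Qed.

Lemma attracting_infty m q : mb m None = None -> mb m (Some q) = Some q ->
  mj m None < 1 -> attracting (mh m) None.
Proof.
move=> mN mq j1; have [c [f [c0 c2 mS fc _]]] := mob_fix_infty mN.
have c1 : c^-1 < 1.
  rewrite -(@ltr_pXn2r _ 2) ?nnegrE ?invr_ge0 ?ltW // expr1n exprVn c2 invrK //.
have fq : f q = q by apply: Some_inj; rewrite -mS.
exists [set x | if x is Some p then 1 < idist q p else True].
  apply/bnbhsN; split=> //; exists (gam q 0 + 1) => p pq.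
  by have := idist_triangle O q p; rewrite !idist0p /=; lra.
move=> V /bnbhsN[VN [M MV]].
have K0 : 0 < (`|M| + gam q 0 + 1)^-1 by rewrite invr_gt0 ltr_wpDl // addr_ge0 ?gam_ge0.
have [|N Nh] := exists_expr_lt _ c1 K0; first by rewrite invr_ge0 ltW.
exists N => j /Nh je _ [[p|] /= pU <-]; rewrite bact_mobF; last first.
  by rewrite (_ : iter _ _ _ = None) //; elim: (j) => //= i ->.
rewrite (iter_mob _ _ mS); apply: MV.
have fjq : iter j f q = q by elim: (j) => //= i ->.
have := iter_sim j q p fc; rewrite fjq => h.
have h1 : `|M| + gam q 0 + 1 < c ^+ j.
  move: je; rewrite exprVn ltf_pV2 ?posrE ?exprn_gt0 //.
  by rewrite ltr_wpDl // addr_ge0 ?gam_ge0.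
have h2 : c ^+ j <= idist q (iter j f p) by rewrite h ler_peMr ?exprn_ge0 ?ltW.
have := idist_triangle q O (iter j f p); rewrite (idistC q O) !idist0p.
by have := ler_norm M; lra.
Qed.

Lemma exists_gauge (r : R) : (0 < n)%N -> 0 <= r -> exists p, gam p 0 = r.
Proof.
move=> n0 r0; pose z : 'rV[quat R]_n := \row_(i < n) (if val i == 0%N then qreal r else 0).
have zP : ipoint_pred k (z, 0).
  apply: ipointP => // [i|]; last exact: (in_scalars_real k 0).
  by rewrite mxE; case: ifP => _; [exact: in_scalars_real|exact: (in_scalars_real k 0)].
exists (IPoint zP); apply/eqP; rewrite -(@eqrXn2 _ 4) ?gam_ge0 // gam4E addr0.
rewrite (_ : vnorm2 _ = r ^+ 2); last first.
  rewrite /vnorm2 (bigD1 (Ordinal n0)) //= mxE big1 ?addr0 /=.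
    by rewrite /qnorm2 /= !expr0n /= !addr0.
  move=> i i0; rewrite mxE ifF; first by apply/eqP; rewrite qnorm2_eq0.
  by apply/negbTE; apply: contraNneq i0 => e; apply/eqP/val_inj.
rewrite (_ : qnorm2 _ = 0) ?addr0 -?exprM //; by apply/eqP; rewrite qnorm2_eq0.
Qed.

(** The inverse acts on [X] by an isometry [f]. If infinity were attracting, some iterate of [f]
    would take the ball of radius 2|M| + 1 into the ball of radius |M|; but the origin and a point
    of gauge 2|M| + 1 would then end up at distance at most 2|M|. *)
Lemma not_attracting_infty m : (0 < n)%N -> mb m None = None -> mj m None = 1 ->
  ~ attracting (mh m) None.
Proof.
move=> n0 mN j1 [U /bnbhsN[_ [M MU]] hU].
have [c [f [c0 c2 mS fc _]]] := mob_fix_infty (minv_fix mN).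
have {}c2 : c = 1.
  apply/eqP; rewrite -(@eqrXn2 _ 2) // ?ltW // c2 mj_minv // j1 !invr1 expr1n //.
have M0 := normr_ge0 M.
have [|y yM] := @exists_gauge (2 * `|M| + 1) n0; first by lra.
pose V : set bX := [set x | if x is Some p then 2 * `|M| + 1 < gam p 0 else True].
have [|N /(_ N (leqnn _)) NV] := hU V.
  by apply/bnbhsN; split=> //; exists (2 * `|M| + 1).
have key p : gam p 0 <= 2 * `|M| + 1 -> gam (iter N f p) 0 <= `|M|.
  move=> pM; rewrite leNgt; apply/negP => h.
  have /MU Up := le_lt_trans (ler_norm M) h.
  have := NV (Some p); rewrite bact_mobF.
  have -> : ((iter N (mb m) @` U) (Some p)) = True.
    apply/propext; split=> // _; exists (Some (iter N f p)) => //.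
    rewrite -(iter_mob N p mS); elim: (N) => // i IH.
    by rewrite [X in iter _ _ X]iterS iterSr /= mbVK.
  by move=> /(_ I) /=; lra.
have := key y; rewrite yM lexx => /(_ isT) h1.
have := key O; rewrite gam_origin // sqrtr0 => /(_ _) h2.
have := iter_sim N O y fc; rewrite c2 expr1n mul1r idist0p yM.
have := idist_triangle (iter N f O) O (iter N f y); rewrite (idistC _ O) !idist0p.
have := h2 (ltac:(lra)); lra.
Qed.

Lemma repelling_minv m xi : repelling (mh m) xi <-> attracting (mh (minv m)) xi.
Proof.
rewrite /repelling /attracting !bact_mobF /=.
have e j (U : set bX) : iter j (mb m) @^-1` U = iter j (mbV m) @` U.
  have h1 x : iter j (mb m) (iter j (mbV m) x) = x.
    by elim: j x => // j IH x; rewrite [X in iter _ _ X]iterS iterSr mbVK.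
  have h2 x : iter j (mbV m) (iter j (mb m) x) = x.
    by elim: j x {h1} => // j IH x; rewrite [X in iter _ _ X]iterS iterSr mbK.
  apply/seteqP; split=> [x /= Ux|_ [x Ux <-]]; first by exists (iter j (mb m) x).
  by rewrite /= h1.
by split=> -[U xU h]; exists U => // V /h[N NV]; exists N => j /NV; rewrite e.
Qed.

Definition mconj ka m := mcomp ka (mcomp m (minv ka)).

Lemma mb_conj ka m xi : mb (mconj ka m) (mb ka xi) = mb ka (mb m xi).
Proof. by rewrite /= mbK. Qed.

Lemma mj_conj ka m xi : mb m xi = xi -> mj (mconj ka m) (mb ka xi) = mj m xi.
Proof.
by move=> e; rewrite /= mbK e mulrCA divff ?mulr1 // gt_eqF ?mj_gt0.
Qed.

Lemma mh_conjK ka m : mh (mconj (minv ka) (mconj ka m)) = mh m.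
Proof. by apply/funext => h; rewrite /= !mhK. Qed.

(** The boundary map is recovered from the isometry as a limit, so equalities between elements of
    the modular group transfer to the boundary. *)
Lemma mb_ext m m' : mh m = mh m' -> mb m = mb m'.
Proof. by rewrite -!bact_mobF => ->. Qed.

Lemma attracting_conj ka m xi :
  attracting (mh m) xi -> attracting (mh (mconj ka m)) (mb ka xi).
Proof.
rewrite /attracting !bact_mobF => -[U xU h].
exists (mbV ka @^-1` U); first by apply: mobV_cont; rewrite mbK.
move=> V /mob_cont /h[N NV]; exists N => j /NV jV _ [x Ux <-].
have -> : iter j (mb (mconj ka m)) x = mb ka (iter j (mb m) (mbV ka x)).
  by elim: (j) => [|i IH]; rewrite ?iterS ?IH /= ?mbVK ?mbK.
by apply: jV; exists (mbV ka x).
Qed.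

Lemma repelling_conj ka m xi :
  repelling (mh m) xi -> repelling (mh (mconj ka m)) (mb ka xi).
Proof.
move=> /repelling_minv/(attracting_conj ka) h; apply/repelling_minv.
rewrite (_ : mh (minv (mconj ka m)) = mh (mconj ka (minv m))) //.
Qed.

Lemma mob_fix_two m xi : mb m xi = xi -> mj m xi <> 1 ->
  exists eta, [/\ eta <> xi, mb m eta = eta &
    forall zeta, mb m zeta = zeta -> zeta = xi \/ zeta = eta].
Proof.
move=> mx jx; have [ka kx] := mob_to_infinity xi.
have [||q qf qu] := @fix_infty_two (mconj ka m).
- by rewrite -kx mb_conj mx.
- by rewrite -kx mj_conj.
exists (mbV ka (Some q)); split.
- by move=> e; have := mbVK ka (Some q); rewrite e kx.
- by move: qf => /(congr1 (mbV ka)) /=; rewrite mbK.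
- move=> zeta mz; case ez : (mb ka zeta) => [p|]; last first.
    by left; apply: (can_inj (mbK ka)); rewrite ez kx.
  right; rewrite -(qu p) -?ez ?mbK //.
  by rewrite mb_conj mz.
Qed.

(** After [xi] is moved to infinity, [fix_infty_two] supplies the other fixed point. A factor below
    1 makes [xi] the attracting point, a factor above 1 the repelling one. *)
Lemma mob_loxodromic m xi : mb m xi = xi -> mj m xi <> 1 -> loxodromic (mh m).
Proof.
move=> mx jx; split; first exact: mob_isometry.
have [ka kx] := mob_to_infinity xi; pose m' := mconj ka m.
have m'N : mb m' None = None by rewrite -kx mb_conj mx.
have j'N : mj m' None = mj m xi by rewrite -kx mj_conj.
have [|q qf qu] := fix_infty_two m'N; first by rewrite j'N.
have fixq : mb m (mbV ka (Some q)) = mbV ka (Some q).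
  by move: qf => /(congr1 (mbV ka)) /=; rewrite mbK.
have xE : xi = mbV ka None by rewrite -kx mbK.
have neq : mbV ka (Some q) <> xi.
  by move=> e; have := mbVK ka (Some q); rewrite e kx.
have two zeta : mb m zeta = zeta -> zeta = xi \/ zeta = mbV ka (Some q).
  move=> mz; case ez : (mb ka zeta) => [p|].
    by right; rewrite -(qu p) -?ez ?mbK // mb_conj mz.
  by left; apply: (can_inj (mbK ka)); rewrite ez kx.
case: (ltgtP (mj m xi) 1) => // j1.
- exists xi, (mbV ka (Some q)); split=> //; rewrite /bfixed ?bact_mob //; first exact: nesym.
  + by move=> zeta; rewrite bact_mob; exact: two.
  + rewrite -(mh_conjK ka) xE; apply: attracting_conj.
    by apply: attracting_infty qf _; rewrite // -/m' j'N.
  + rewrite -(mh_conjK ka); apply: repelling_conj; apply/repelling_minv.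
    apply: attracting_point; [exact: minv_fix|exact: minv_fix|].
    by rewrite mj_minv // -/m' j'N invf_gt1 ?mj_gt0.
- exists (mbV ka (Some q)), xi; split=> //; rewrite /bfixed ?bact_mob //.
  + by move=> zeta; rewrite bact_mob => /two[]; [right|left].
  + rewrite -(mh_conjK ka); apply: attracting_conj.
    by apply: attracting_point => //; rewrite -/m' j'N.
  + rewrite -(mh_conjK ka) xE; apply: repelling_conj; apply/repelling_minv.
    apply: (@attracting_infty _ q); [exact: minv_fix|exact: minv_fix|].
    by rewrite mj_minv // -/m' j'N invf_lt1 ?mj_gt0.
Qed.

Lemma not_attracting m xi : (0 < n)%N -> mb m xi = xi -> mj m xi = 1 ->
  ~ attracting (mh m) xi /\ ~ repelling (mh m) xi.
Proof.
move=> n0 mx jx; have [ka kx] := mob_to_infinity xi.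
have aux (m0 : mob R k n) : mb m0 xi = xi -> mj m0 xi = 1 -> ~ attracting (mh m0) xi.
  move=> mx0 jx0 /(attracting_conj ka); rewrite kx; apply: not_attracting_infty => //.
    by rewrite -kx mb_conj mx0.
  by rewrite -kx mj_conj.
split; first exact: aux.
move/repelling_minv; apply: aux; first exact: minv_fix.
by rewrite mj_minv // jx invr1.
Qed.

End FixedPoints.

(** * Rigidity of the extensions of isometries of [X] to hyperbolic space *)

Section Extension.
Context {R : realType} {k : scalars} {n : nat}.
Local Notation X := (ipoint R k n).
Local Notation H := (hpoint R k n).
Local Notation bX := (bpoint R k n).
Local Notation O := (iorigin k n : X).
Implicit Types (p q r : X) (h : H) (xi eta : bX).

Definition hlim (F : H -> R) xi (l : R) : Prop :=
  forall e : R, 0 < e -> hnbhs xi [set h | `|F h - l| < e].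

Lemma hlim_unique F xi l l' : hlim F xi l -> hlim F xi l' -> l = l'.
Proof.
move=> h h'; apply/eqP; rewrite -subr_eq0 -normr_eq0 eq_le normr_ge0 andbT leNgt.
apply/negP => e0; have e2 : 0 < `|l - l'| / 2 by rewrite divr_gt0.
have [x /= h1 h2] := hnbhs_meet (h _ e2) (h' _ e2).
have := ler_distD (F x) l l'; rewrite leNgt => /negP; apply.
by rewrite [ltRHS]splitr ltrD // distrC.
Qed.

Lemma hlim_comp g F xi eta l : btends g xi eta -> hlim F eta l -> hlim (F \o g) xi l.
Proof. by move=> ge Fl e e0; exact: (ge _ (Fl e e0)). Qed.

Lemma hlimZ F xi l (c : R) : 0 < c -> hlim F xi l -> hlim (fun h => c * F h) xi (c * l).
Proof.
move=> c0 Fl e e0; have := Fl _ (divr_gt0 e0 c0).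
rewrite (_ : [set h | `|F h - l| < e / c] = [set h | `|c * F h - c * l| < e]) //.
apply/seteqP; split=> h /=; rewrite -mulrBr normrM (gtr0_norm c0) ltr_pdivlMr // mulrC //.
Qed.

Lemma hlim_gam p (a : R) q : 0 <= a ->
  hlim (fun h => gam (imul (iinv p) h.1) (a + h.2%:num)) (Some q)
    (gam (imul (iinv p) q) a).
Proof.
move=> a0 e e0; apply/hnbhsS; exists e => // h he /=.
have s0 := ltW (hgt_gt0 h).
have h1 := gam_triangle p q h.1 a0 s0.
have := gam_triangle p h.1 q (addr_ge0 a0 s0) (lexx 0); rewrite addr0.
have := gam_homo (imul (iinv p) q) a0 (_ : a <= a + h.2%:num); rewrite lerDl => /(_ s0).
have := gam_homo (imul (iinv q) h.1) (lexx 0) s0.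
rewrite -(gamV (imul (iinv h.1) q)) iinvM iinvK ltr_norml => *.
by apply/andP; split; lra.
Qed.

(** Numerator and denominator differ by at most the constant [D] while the denominator tends to
    infinity. *)
Lemma hlim_ratio h1 h2 :
  hlim (fun h => gam (imul (iinv h1.1) h.1) (h1.2%:num + h.2%:num) /
                 gam (imul (iinv h2.1) h.1) (h2.2%:num + h.2%:num)) None 1.
Proof.
move=> e e0; apply/hnbhsN.
pose D := gam (imul (iinv h1.1) h2.1) h1.2%:num + gam (imul (iinv h2.1) h1.1) h2.2%:num.
have D0 : 0 <= D by rewrite addr_ge0 ?gam_ge0.
exists (D / e + gam h2.1 0) => h hM /=.
have s0 := ltW (hgt_gt0 h).
have bnd (x y : H) : gam (imul (iinv x.1) h.1) (x.2%:num + h.2%:num) <=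
    gam (imul (iinv x.1) y.1) x.2%:num + gam (imul (iinv y.1) h.1) (y.2%:num + h.2%:num).
  have xs := ltW (hgt_gt0 x); have ys := ltW (hgt_gt0 y).
  rewrite (le_trans (gam_triangle x.1 y.1 h.1 xs s0)) // lerD2l gam_homo //.
  by rewrite lerDr.
have := bnd h1 h2; have := bnd h2 h1.
set x := gam _ (h1.2%:num + _); set y := gam _ (h2.2%:num + _) => b1 b2.
have y1 : D / e < y.
  have := gamM h2.1 (imul (iinv h2.1) h.1) (lexx 0) s0; rewrite imulKV add0r.
  have : gam (imul (iinv h2.1) h.1) h.2%:num <= y by rewrite gam_homo // lerDr.
  by move: hM; lra.
have y0 : 0 < y by rewrite (le_lt_trans _ y1) // divr_ge0 // ltW.
rewrite -[X in _ - X](divff (lt0r_neq0 y0)) -mulrBl normrM normfV (gtr0_norm y0).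
rewrite ltr_pdivrMr // (@le_lt_trans _ _ D) //.
  have := gam_ge0 (imul (iinv h1.1) h2.1) h1.2%:num.
  have := gam_ge0 (imul (iinv h2.1) h1.1) h2.2%:num.
  by rewrite ler_norml /D => *; apply/andP; split; lra.
by move: y1; rewrite ltr_pdivrMr // mulrC.
Qed.

(** The extension is known only through its boundary limits. Limits at infinity of the invariant
    [cdist] show that [g] scales all heights by one factor, limits at finite points show that [f]
    scales distances by its square root, and since [f] is an isometry the factor is 1. *)
Lemma extends_hmap g (f : X -> X) : (0 < n)%N ->
  (forall p q, idist (f p) (f q) = idist p q) -> extends g f ->
  giso f /\ g = hmap f.
Proof.
move=> n0 fi [[gi _] gS gN].
have gC h h' : cdist (g h) (g h') = cdist h h' by apply/hdist_cdist.
have scale h1 h2 : (g h1).2%:num / h1.2%:num = (g h2).2%:num / h2.2%:num.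
  set s1 := h1.2%:num; set s2 := h2.2%:num.
  set S1 := (g h1).2%:num; set S2 := (g h2).2%:num.
  have [s1p s2p S1p S2p] : [/\ 0 < s1, 0 < s2, 0 < S1 & 0 < S2] by split; exact: hgt_gt0.
  (* Invariance of [cdist] makes [K] the constant quotient between the ratio of [hlim_ratio] for
     [g h1], [g h2] at [g h] and the one for [h1], [h2] at [h]. Both ratios tend to 1 as [h] tends
     to infinity, whence K = 1. *)
  pose K := Num.sqrt (Num.sqrt (s2 * S1 / (s1 * S2))).
  have Kp : 0 < s2 * S1 / (s1 * S2) by rewrite divr_gt0 ?mulr_gt0.
  have K0 : 0 < K by rewrite !sqrtr_gt0.
  have K4 : K ^+ 4 = s2 * S1 / (s1 * S2).
    by rewrite (exprM _ 2 2) sqr_sqrtr ?sqrtr_ge0 // sqr_sqrtr // ltW.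
  have l1 := hlim_comp gN (hlim_ratio (g h1) (g h2)).
  have := hlimZ K0 (hlim_ratio h1 h2); rewrite mulr1 => l2.
  have eqF : (fun h => K * (gam (imul (iinv h1.1) h.1) (h1.2%:num + h.2%:num) /
                 gam (imul (iinv h2.1) h.1) (h2.2%:num + h.2%:num))) =
     (fun h => gam (imul (iinv (g h1).1) h.1) ((g h1).2%:num + h.2%:num) /
                 gam (imul (iinv (g h2).1) h.1) ((g h2).2%:num + h.2%:num)) \o g.
    apply/funext => h /=; apply/eqP.
    rewrite -(@eqrXn2 _ 4) ?mulr_ge0 ?invr_ge0 ?gam_ge0 ?(ltW K0) //.
    rewrite !exprMn !exprVn K4; apply/eqP.
    have := gC h1 h; have := gC h2 h; rewrite /cdist -/s1 -/s2 -/S1 -/S2.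
    have p0 : gam (imul (iinv h2.1) h.1) (s2 + h.2%:num) != 0.
      by rewrite gt_eqF // gam_gt0 // addr_gt0.
    have p1 : gam (imul (iinv (g h2).1) (g h).1) (S2 + (g h).2%:num) != 0.
      by rewrite gt_eqF // gam_gt0 // addr_gt0.
    have : s1 != 0 by rewrite gt_eqF. have : s2 != 0 by rewrite gt_eqF.
    have : S1 != 0 by rewrite gt_eqF. have : S2 != 0 by rewrite gt_eqF.
    have : h.2%:num != 0 by rewrite gt_eqF.
    have : (g h).2%:num != 0 by rewrite gt_eqF.
    move: p0 p1; move: (gam _ (s2 + _)) (gam _ (S2 + _)) (gam _ (s1 + _)) (gam _ (S1 + _)).
    move: s1 s2 S1 S2 h.2%:num (g h).2%:num {K Kp K0 K4 l1 l2 s1p s2p S1p S2p}.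
    move=> s1 s2 S1 S2 s S y Y x Y1 y0 Y0 S0 s0 S20 S10 s20 s10 e2 e1.
    have -> : Y1 ^+ 4 = x ^+ 4 / (s1 * s) * (S1 * S) by rewrite -e1; field; rewrite S10 S0.
    have -> : Y ^+ 4 = y ^+ 4 / (s2 * s) * (S2 * S) by rewrite -e2; field; rewrite S20 S0.
    by field; rewrite ?y0 ?s10 ?s20 ?S10 ?S20 ?s0 ?S0.
  rewrite eqF in l2; have K1 := hlim_unique l1 l2.
  move: K4; rewrite -K1 expr1n => e.
  have : s1 * S2 = s2 * S1.
    by apply/esym; apply: divr1_eq.
  move=> e'; apply/eqP; rewrite (eqr_div _ _ (lt0r_neq0 s1p) (lt0r_neq0 s2p)).
  by rewrite (mulrC S1) (mulrC S2) e'.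
pose mu := Num.sqrt ((g (hone O)).2%:num).
have mu2 : mu ^+ 2 = (g (hone O)).2%:num by rewrite sqr_sqrtr.
have mu0 : 0 < mu by rewrite sqrtr_gt0.
have gh2 h : (g h).2%:num = mu ^+ 2 * h.2%:num.
  by have := scale h (hone O); rewrite mu2 /= divr1 => <-; rewrite divfK // gt_eqF.
(* Let the second point of [cdist] tend to the boundary point [q]: its height cancels up to the
   factor [mu]. *)
have key h q : gam (imul (iinv (g h).1) (f q)) (g h).2%:num =
    mu * gam (imul (iinv h.1) q) h.2%:num.
  have l1 := hlim_comp (gS q) (hlim_gam (g h).1 (f q) (ltW (hgt_gt0 (g h)))).
  have l2 := hlimZ mu0 (hlim_gam h.1 q (ltW (hgt_gt0 h))).
  apply: hlim_unique l1 _; move: l2; congr hlim; apply/funext => h' /=; apply/eqP.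
  rewrite -(@eqrXn2 _ 4) ?mulr_ge0 ?gam_ge0 ?(ltW mu0) // exprMn; apply/eqP.
  have := gC h h'; rewrite /cdist !gh2.
  have : h.2%:num != 0 by rewrite gt_eqF.
  have : h'.2%:num != 0 by rewrite gt_eqF.
  have : mu != 0 by rewrite gt_eqF.
  move: (gam _ _) (gam _ _) => y x m0 s0' s0 /esym e.
  have -> : y ^+ 4 = y ^+ 4 / (h.2%:num * h'.2%:num) * (h.2%:num * h'.2%:num).
    by field; rewrite s0 s0'.
  by rewrite e; field; rewrite s0 s0' m0.
have fmu p q : idist (f p) (f q) = mu * idist p q.
  rewrite (idistC p) (idistC (f p)) !idistE.
  have := hlim_comp (gS p) (hlim_gam (f q) (f p) (lexx 0)).
  have := hlimZ mu0 (hlim_gam q p (lexx 0)).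
  move=> l2 l1; apply: hlim_unique l1 _; move: l2; congr hlim; apply/funext => h /=.
  rewrite !add0r -[gam _ h.2%:num]gamV iinvM iinvK -key.
  by rewrite -[RHS]gamV iinvM iinvK.
have mu1 : mu = 1.
  have [p p1] := @exists_gauge R k n 1 n0 ler01.
  by have := fmu O p; rewrite fi idist0p p1 mulr1.
(* Taking [q = h.1] in [key] gives the minimal value of [gam] at that height, so [g h] lies straight
   above [f h.1]. *)
have gE : g = hmap f.
  apply/funext => h; apply: hpoint_eq; last by rewrite gh2 mu1 expr1n mul1r.
  have := key h h.1; rewrite imulVp mu1 mul1r gam_origin //= => e.
  have /gam_min_eq0 : gam (imul (iinv (g h).1) (f h.1)) (g h).2%:num ^+ 4 = (g h).2%:num ^+ 2.
    by rewrite e (exprM _ 2 2) sqr_sqrtr // gh2 mu1 expr1n mul1r.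
  by move=> /(_ (ltW (hgt_gt0 _))) e1; rewrite -[RHS](imulKV (g h).1) e1 imulp0.
split=> // a p q; rewrite le_eqVlt => /predU1P[<-|a0]; first by rewrite -!idistE.
by have := key (p, PosNum a0) q; rewrite gE mu1 mul1r.
Qed.

End Extension.

(** * Pigeonhole principle and uniform estimates in hyperbolic space *)

Section Pigeonhole.

(** A substitute for precompactness: finitely many colours, and equal colours imply the relation.
    Unlike the mere existence of a related pair, this is stable under conjunction, so coordinates
    can be treated one at a time. *)
Definition fincolor (P : nat -> nat -> Prop) : Prop :=
  exists (T : finType) (c : nat -> T), forall i j, c i = c j -> P i j.

Lemma fincolorW (P Q : nat -> nat -> Prop) :
  (forall i j, P i j -> Q i j) -> fincolor P -> fincolor Q.
Proof. by move=> PQ [T [c h]]; exists T, c => i j /h/PQ. Qed.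

Lemma fincolorI (P Q : nat -> nat -> Prop) :
  fincolor P -> fincolor Q -> fincolor (fun i j => P i j /\ Q i j).
Proof.
move=> [T [c h]] [T' [c' h']]; exists (T * T')%type, (fun i => (c i, c' i)).
by move=> i j [/h ? /h' ?].
Qed.

Lemma fincolor_all (I : eqType) (s : seq I) (P : I -> nat -> nat -> Prop) :
  (forall x, x \in s -> fincolor (P x)) ->
  fincolor (fun i j => forall x, x \in s -> P x i j).
Proof.
elim: s => [|x s IH] h; first by exists unit, (fun=> tt).
have {}IH : fincolor (fun i j => forall x, x \in s -> P x i j).
  by apply: IH => y ys; apply: h; rewrite inE ys orbT.
have := fincolorI (h x (mem_head _ _)) IH; apply: fincolorW => i j [Px Ps] y.
by rewrite inE => /orP[/eqP->|/Ps].
Qed.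

Lemma fincolor_infinite P : fincolor P ->
  exists c : nat -> Prop, (forall N, exists2 i, (N <= i)%N & c i) /\
    forall i j, c i -> c j -> P i j.
Proof.
move=> [T [c h]].
suff [t tP] : exists t, forall N, exists2 i, (N <= i)%N & c i = t.
  by exists (fun i => c i = t); split=> // i j ci cj; apply: h; rewrite ci cj.
(* Otherwise each colour [t] no longer occurs from some index [B t] on, which is absurd for the
   colour of the index [\max_t B t]. *)
apply: contrapT => H.
have /choice[B BP] t : exists N, forall i, (N <= i)%N -> c i <> t.
  apply: contrapT => H'; apply: H; exists t => N; apply: contrapT => H2.
  by apply: H'; exists N => i Ni ct; apply: H2; exists i.
exact: (BP (c (\max_t B t)) (\max_t B t) (leq_bigmax _)).
Qed.

Lemma fincolor_pair P : fincolor P -> exists i j, (i < j)%N /\ P i j.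
Proof.
move=> /fincolor_infinite[c [inf h]].
have [i _ ci] := inf 0%N; have [j ij cj] := inf i.+1.
by exists i, j; split=> //; exact: h.
Qed.

Lemma fincolor_triple P : fincolor P ->
  exists i j l, [/\ (i < j)%N, (j < l)%N, P i l, P j l & P i j].
Proof.
move=> /fincolor_infinite[c [inf h]].
have [i _ ci] := inf 0%N; have [j ij cj] := inf i.+1; have [l jl cl] := inf j.+1.
by exists i, j, l; split=> //; exact: h.
Qed.

Context {R : realType}.

(** The colour of [i] is the integer part of (u_i + B) / e. *)
Lemma fincolor_real (u : nat -> R) (B e : R) : 0 < e ->
  (forall i, `|u i| <= B) -> fincolor (fun i j => `|u i - u j| < e).
Proof.
move=> e0 uB; have B0 : 0 <= B by apply: le_trans (uB 0%N).
have v0 i : 0 <= (u i + B) / e.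
  have := uB i; rewrite ler_norml => /andP[h _].
  by apply: divr_ge0; [lra|exact: ltW].
pose N := (Num.truncn ((B + B) / e)).+1.
have vN i : (Num.truncn ((u i + B) / e) < N)%N.
  rewrite ltnS; apply: le_truncn.
  by rewrite ler_pM2r ?invr_gt0 // lerD2r (le_trans (ler_norm _)).
exists 'I_N, (fun i => Ordinal (vN i)) => i j [] h.
have := truncn_itv (v0 i); have := truncn_itv (v0 j); rewrite -h.
move: (Num.truncn _) => t; rewrite -natr1 !ler_pdivlMr // !ltr_pdivrMr // !mulrDl !mul1r.
by move=> /andP[h1 h2] /andP[h3 h4]; rewrite ltr_norml; apply/andP; split; lra.
Qed.

Lemma fincolor_quat (u : nat -> quat R) (B e : R) : 0 < e ->
  (forall i, qnorm (u i) <= B) -> fincolor (fun i j => qnorm (u i - u j) < e).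
Proof.
move=> e0 uB; have e4 : 0 < e / 4 by rewrite divr_gt0.
have b1 : fincolor (fun i j => `|qre (u i) - qre (u j)| < e / 4).
  by apply: fincolor_real => // i; apply: le_trans (uB i); have [] := norm_coord_le (u i).
have b2 : fincolor (fun i j => `|qi (u i) - qi (u j)| < e / 4).
  by apply: fincolor_real => // i; apply: le_trans (uB i); have [] := norm_coord_le (u i).
have b3 : fincolor (fun i j => `|qj (u i) - qj (u j)| < e / 4).
  by apply: fincolor_real => // i; apply: le_trans (uB i); have [] := norm_coord_le (u i).
have b4 : fincolor (fun i j => `|qk (u i) - qk (u j)| < e / 4).
  by apply: fincolor_real => // i; apply: le_trans (uB i); have [] := norm_coord_le (u i).
have := fincolorI (fincolorI b1 b2) (fincolorI b3 b4).
apply: fincolorW => i j [[h1 h2] [h3 h4]].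
by rewrite (le_lt_trans (qnorm_le_coord _)) //=; lra.
Qed.

Context {k : scalars} {n : nat}.
Local Notation X := (ipoint R k n).
Local Notation H := (hpoint R k n).
Local Notation O := (iorigin k n : X).

Lemma fincolor_ipoint (u : nat -> X) (B e : R) : 0 < e ->
  (forall i, gam (u i) 0 <= B) -> fincolor (fun i j => idist (u i) (u j) < e).
Proof.
move=> e0 uB; have B0 : 0 <= B by apply: le_trans (gam_ge0 _ _) (uB 0%N).
pose D : R := n%:R + 1.
have D1 : 1 <= D by rewrite lerDr.
have D0 : 0 <= D by rewrite (le_trans _ D1).
have nD : n%:R <= D by rewrite lerDl.
have d0 : 0 < D ^+ 2 + 1 + 2 * B * D.
  by rewrite ltr_wpDr ?mulr_ge0 ?(le_trans _ D1) // ltr_wpDl ?sqr_ge0.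
(* By [idist_coord_le], coordinates within [d] of each other give a squared distance of at most (D^2
   + 1 + 2BD) d, where d <= 1 allows d^2 to be replaced by d. *)
pose d := Num.min 1 (e ^+ 2 / (D ^+ 2 + 1 + 2 * B * D)).
have dp : 0 < d by rewrite lt_min ltr01 divr_gt0 ?exprn_gt0.
have zB i l : qnorm (zc (u i) 0 l) <= B.
  apply: le_trans (uB i); apply: le_trans (vnorm_gam (u i) (lexx 0)).
  rewrite ler_wsqrtr // /vnorm2 (bigD1 l) //= lerDl.
  by apply: sumr_ge0 => *; exact: qnorm2_ge0.
have tB i : qnorm (tc (u i)) <= B ^+ 2.
  rewrite (@le_trans _ _ (gam (u i) 0 ^+ 2)) //; last by rewrite ler_pXn2r ?nnegrE ?gam_ge0.
  rewrite -(@ler_pXn2r _ 2) ?nnegrE ?exprn_ge0 ?gam_ge0 ?qnorm_ge0 //.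
  by rewrite sqr_qnorm -exprM gam4E addr0 lerDr sqr_ge0.
have c1 : fincolor (fun i j => forall l, l \in enum 'I_n ->
    qnorm (zc (u i) 0 l - zc (u j) 0 l) < d).
  by apply: fincolor_all => l _; apply: (fincolor_quat dp (fun i => zB i l)).
have := fincolorI c1 (fincolor_quat dp tB).
apply: fincolorW => i j [h1 h2].
have {}h1 l : qnorm (zc (u i) 0 l - zc (u j) 0 l) <= d by rewrite ltW // h1 // mem_enum.
rewrite -(@ltr_pXn2r _ 2) ?nnegrE ?idist_ge0 ?ltW // idistC.
have d1 : d <= 1 by rewrite ge_min lexx.
have vn : vnorm2 (zc (u i) - zc (u j)) <= (n%:R * d) ^+ 2.
  by apply: vnorm2_le; [exact: ltW|move=> l; rewrite !mxE].
have nd : 0 <= n%:R * d by rewrite mulr_ge0 // ltW.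
have vs : Num.sqrt (vnorm2 (zc (u i) - zc (u j))) <= n%:R * d.
  by rewrite -(ger0_norm nd) -sqrtr_sqr ler_wsqrtr.
rewrite (le_lt_trans (idist_coord_le _ _)) //.
have g1 : gam (u j) 0 * Num.sqrt (vnorm2 (zc (u i) - zc (u j))) <= B * (n%:R * d).
  by rewrite ler_pM ?gam_ge0 ?sqrtr_ge0.
have dd : (D ^+ 2 + 1 + 2 * B * D) * d <= e ^+ 2.
  by rewrite mulrC -ler_pdivlMr // ge_min lexx orbT.
have : (n%:R * d) ^+ 2 + (d + 2 * (B * (n%:R * d))) <= (D ^+ 2 + 1 + 2 * B * D) * d.
  rewrite [leRHS]mulrDl [(D ^+ 2 + 1) * d]mulrDl mul1r -addrA; apply: lerD.
    rewrite exprMn ler_pM ?sqr_ge0 //; last by rewrite expr2 ler_piMl // ltW.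
    by rewrite ler_pXn2r ?nnegrE.
  have : B * (n%:R * d) <= B * (D * d).
    by rewrite ler_wpM2l // ler_wpM2r // ltW.
  by lra.
by move: vn h2 g1 dd; rewrite -mulrA; lra.
Qed.

Lemma acosh_lt (e : R) : 0 < e ->
  exists2 d : R, 0 < d & forall x, 0 < x -> x ^+ 2 <= 1 + d -> acosh x < e.
Proof.
(* With y = e/3 one gets x <= 1 + y and sqrt(x^2 - 1) <= y, so acosh x <= ln(1 + 2y) <= 2y < e. *)
move=> e0; exists ((e / 3) ^+ 2); first by rewrite exprn_gt0 // divr_gt0.
move=> x x0 xd; pose y := e / 3; have y0 : 0 < y by rewrite divr_gt0.
have s1 : Num.sqrt (x ^+ 2 - 1) <= y.
  by rewrite -(gtr0_norm y0) -sqrtr_sqr ler_wsqrtr // lerBlDl.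
have x1 : x <= 1 + y by have := xd; rewrite -/y; nra.
have s0 := sqrtr_ge0 (x ^+ 2 - 1).
rewrite /acosh (@le_lt_trans _ _ (ln (1 + (y + y)))) //.
  by rewrite ler_ln ?posrE; lra.
have := @le_ln1Dx _ (y + y); rewrite /y in y0 *; move=> /(_ _) h.
by apply: le_lt_trans (h _) _; lra.
Qed.

(** Heights confined between [b] and [B] make closeness in coordinates imply hyperbolic closeness
    uniformly. *)
Lemma cdist_close (b B e : R) : 0 < b -> 0 <= B -> 0 < e ->
  exists2 d : R, 0 < d & forall h h' : H,
    b <= h.2%:num -> b <= h'.2%:num -> h.2%:num <= B -> h'.2%:num <= B ->
    idist h.1 h'.1 < d -> `|h.2%:num - h'.2%:num| < d -> hdist h h' < e.
Proof.
move=> b0 B0 e0; have [ka ka0 kaP] := acosh_lt e0.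
have c0 : 0 < (3 + 4 * B) / b ^+ 2 by rewrite divr_gt0 ?exprn_gt0 // ltr_wpDr // mulr_ge0.
(* Since (s + s')^2 = 4ss' + (s - s')^2, the numerator of [cdist] exceeds 4ss' by at most (3 + 4B)
   d: one d each from (s - s')^2, v^2 and |t|^2, and 4Bd from 2v(s + s'). Dividing by ss' >= b^2
   gives the constant. *)
pose d := Num.min 1 (4 * ka / ((3 + 4 * B) / b ^+ 2)).
have dp : 0 < d by rewrite lt_min ltr01 divr_gt0 // mulr_gt0.
have d1 : d <= 1 by rewrite ge_min lexx.
exists d => // h h' hb hb' hB hB' dd sd; rewrite hdistE; apply: kaP.
  by rewrite sqrtr_gt0 divr_gt0 ?cdist_gt0.
have c4 : 0 <= cdist h h' / 4 by rewrite divr_ge0 // ltW // cdist_gt0.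
rewrite sqr_sqrtr // ler_pdivrMr //.
have bb : b ^+ 2 <= h.2%:num * h'.2%:num by rewrite expr2 ler_pM // ltW.
have bp : 0 < b ^+ 2 by rewrite exprn_gt0.
suff : h.2%:num * h'.2%:num * cdist h h' <=
    h.2%:num * h'.2%:num * (4 + (3 + 4 * B) / b ^+ 2 * d).
  rewrite ler_pM2l ?mulr_gt0 // => /le_trans; apply.
  have : (3 + 4 * B) / b ^+ 2 * d <= 4 * ka.
    by rewrite mulrC -ler_pdivlMr // ge_min lexx orbT.
  by lra.
rewrite /cdist mulrC divfK ?gt_eqF ?mulr_gt0 // gam4E.
set p := imul _ _.
have D2 : idist h.1 h'.1 ^+ 2 <= d.
  rewrite (le_trans _ (ler_piMl (ltW dp) d1)) // -expr2.
  by rewrite ler_pXn2r ?nnegrE ?idist_ge0 ?ltW.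
have v1 : vnorm2 (zc p) <= d.
  apply: le_trans D2; rewrite -(@sqr_sqrtr _ (vnorm2 _)) ?vnorm2_ge0 //.
  by rewrite ler_pXn2r ?nnegrE ?sqrtr_ge0 ?idist_ge0 // idistE vnorm_gam.
have q1 : qnorm2 (tc p) <= d ^+ 2.
  have : qnorm2 (tc p) <= (idist h.1 h'.1 ^+ 2) ^+ 2.
    by rewrite -exprM idistE gam4E addr0 lerDr sqr_ge0.
  by move=> /le_trans; apply; rewrite ler_pXn2r ?nnegrE ?sqr_ge0 // ltW.
have s2 : (h.2%:num - h'.2%:num) ^+ 2 <= d.
  rewrite -real_normK ?num_real // (le_trans _ (ler_piMl (ltW dp) d1)) // -expr2.
  by rewrite ler_pXn2r ?nnegrE ?normr_ge0 ?(ltW dp) // ltW.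
have v0 := vnorm2_ge0 (zc p).
have E : (3 + 4 * B) * d <= h.2%:num * h'.2%:num * ((3 + 4 * B) / b ^+ 2 * d).
  rewrite (_ : _ * (_ / b ^+ 2 * d) = (3 + 4 * B) * d * (h.2%:num * h'.2%:num / b ^+ 2)).
    rewrite ler_peMr ?ler_pdivlMr ?mul1r // mulr_ge0 ?(ltW dp) // addr_ge0 // mulr_ge0 //.
  by ring.
rewrite mulrDr; move: E s2 q1 v1 v0 hB hB' d1 dp hb hb' b0; rewrite -/d.
move: h.2%:num h'.2%:num (vnorm2 _) (qnorm2 _) (_ * (_ * d)).
move=> s s' v q Z E s2 q1 v1 v0 hB hB' d1 dp hb hb' b0.
have : (v + (s + s')) ^+ 2 <= (s + s') ^+ 2 + 4 * B * d + d.
  have : v * (s + s') <= d * (B + B) by rewrite ler_pM //; lra.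
  have : v * v <= d * 1 by rewrite ler_pM // (le_trans v1).
  by rewrite !expr2; nra.
have : d ^+ 2 <= d by rewrite expr2 ler_piMl // ltW.
by move: s2 E q1; nra.
Qed.

(** Both (s + s')^2 and the fourth power of the distance of the base points are at most the
    numerator of [cdist]. *)
Lemma cdist_bound (h h' : H) (D : R) : cdist h h' <= D ->
  [/\ h.2%:num <= D * h'.2%:num, h'.2%:num <= D * h.2%:num &
      idist h.1 h'.1 ^+ 4 <= D * (h.2%:num * h'.2%:num)].
Proof.
rewrite /cdist ler_pdivrMr ?mulr_gt0 // => hD.
have s0 := hgt_gt0 h; have s0' := hgt_gt0 h'.
have : idist h.1 h'.1 ^+ 4 <= gam (imul (iinv h.1) h'.1) (h.2%:num + h'.2%:num) ^+ 4.
  by rewrite idistE -gam_leX gam_homo // addr_ge0 // ltW.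
have : (h.2%:num + h'.2%:num) ^+ 2 <= gam (imul (iinv h.1) h'.1) (h.2%:num + h'.2%:num) ^+ 4.
  rewrite gam4E; have := vnorm2_ge0 (zc (imul (iinv h.1) h'.1)).
  have := qnorm2_ge0 (tc (imul (iinv h.1) h'.1)).
  by move: (vnorm2 _) (qnorm2 _) s0 s0' => v q; nra.
move: (gam _ _ ^+ 4) hD => G hD h1 h2; split; last exact: le_trans hD.
- have : h.2%:num * h.2%:num <= D * h'.2%:num * h.2%:num.
    by move: h1 hD s0 s0'; move: h.2%:num h'.2%:num => s s'; nra.
  by rewrite ler_pM2r.
- have : h'.2%:num * h'.2%:num <= D * h.2%:num * h'.2%:num.
    by move: h1 hD s0 s0'; move: h.2%:num h'.2%:num => s s'; nra.
  by rewrite ler_pM2r.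
Qed.

Lemma gam4_le (p : X) (a : R) : 0 <= a -> gam p a ^+ 4 <= (gam p 0 + Num.sqrt a) ^+ 4.
Proof. by move=> a0; rewrite ler_pXn2r ?nnegrE ?addr_ge0 ?gam_ge0 ?sqrtr_ge0 ?gam_le_gauge. Qed.

End Pigeonhole.

(** * Discreteness as finiteness, and displacement near a fixed point *)

Section Discreteness.
Context {R : realType} {k : scalars} {n : nat}.
Local Notation X := (ipoint R k n).
Local Notation H := (hpoint R k n).
Local Notation bX := (bpoint R k n).
Local Notation O := (iorigin k n : X).
Implicit Types (p q : X) (h : H) (xi eta : bX) (m : mob R k n).

Lemma map_group_minv (G : set (H -> H)) m : map_group G -> G (mh m) -> G (mh (minv m)).
Proof.
move=> [_ _ GV] /GV[g [Gg gK _]]; suff -> : mh (minv m) = g by [].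
by apply/funext => h /=; rewrite -{2}(mhVK m h) gK.
Qed.

Lemma map_group_mcomp (G : set (H -> H)) m m' : map_group G ->
  G (mh m) -> G (mh m') -> G (mh (mcomp m m')).
Proof. by move=> [_ GM _]; exact: GM. Qed.

Lemma map_group_mconj (G : set (H -> H)) m m' : map_group G ->
  G (mh m) -> G (mh m') -> G (mh (mconj m m')).
Proof.
by move=> gG Gm Gm'; do !apply: map_group_mcomp => //; exact: map_group_minv.
Qed.

Lemma le_of_expr4 (t K : R) : 0 <= t -> t ^+ 4 <= K -> t <= 1 + K.
Proof.
move=> t0 tK; have [t1|t1] := leP t 1; first by have := exprn_ge0 4 t0; lra.
rewrite (le_trans _ (_ : K <= 1 + K)) ?lerDr // (le_trans _ tK) //.
by rewrite -{1}(expr1 t) ler_eXn2l.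
Qed.

(** Isometries moving points of a bounded part of height 1 by bounded amounts send each test point
    into a bounded region. Colouring its images for all test points of the finite set [F] makes
    e_j^-1 e_i close to the identity, hence equal to it. *)
Lemma discrete_fincolor (G : set (H -> H)) (e : nat -> mob R k n) (x : nat -> X) (B D : R) :
  map_group G -> discrete_maps (@hdist R k n) G -> (forall i, G (mh (e i))) ->
  (forall i, gam (x i) 0 <= B) ->
  (forall i, cdist (mh (e i) (hone (x i))) (hone (x i)) <= D) ->
  fincolor (fun i j => mh (e i) = mh (e j)).
Proof.
move=> gG dG Ge xB eD.
have [G1 _ _] := gG.
(* Discreteness is used at the identity only. *)
have [F [eps [/finite_seqP[s ->] eps0 sP]]] := dG _ G1.
have B0 : 0 <= B by apply: le_trans (gam_ge0 _ _) (xB 0%N).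
have D0 : 0 < D by apply: lt_le_trans (cdist_gt0 _ _) (eD 0%N).
pose E i := mh (e i) (hone (x i)).
have Eb i : [/\ (E i).2%:num <= D, 1 <= D * (E i).2%:num & gam (E i).1 0 <= B + (1 + D * D)].
  have [h1 h2 h3] := cdist_bound (eD i); rewrite /= !mulr1 in h1 h2 h3; split=> //.
  have h4 : idist (x i) (E i).1 <= 1 + D * D.
    rewrite idistC; apply: le_of_expr4; first exact: idist_ge0.
    by rewrite (le_trans h3) // ler_wpM2l // ltW.
  have := idist_triangle O (x i) (E i).1; rewrite !idist0p; have := xB i; lra.
have cl (y : H) : y \in s -> fincolor (fun i j => hdist (mh (e i) y) (mh (e j) y) < eps).
  move=> _; pose Dy := (gam y.1 0 + B + Num.sqrt (y.2%:num + 1)) ^+ 4 / y.2%:num.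
  have cy i : cdist (mh (e i) y) (E i) <= Dy.
    rewrite mob_cdist /cdist /= mulr1 ler_pM2r ?invr_gt0 //.
    have s1 : 0 <= y.2%:num + 1 by rewrite addr_ge0.
    rewrite (le_trans (gam4_le _ s1)) // ler_pXn2r ?nnegrE //.
    - rewrite lerD2r -idistE; have := idist_triangle y.1 O (x i).
      by rewrite (idistC _ O) !idist0p; have := xB i; lra.
    - by rewrite addr_ge0 ?gam_ge0 ?sqrtr_ge0.
    - by rewrite !addr_ge0 ?gam_ge0 ?sqrtr_ge0.
  have Dy0 : 0 < Dy by apply: lt_le_trans (cdist_gt0 _ _) (cy 0%N).
  (* The heights of the images of [y] stay between two positive constants and their base points stay
     bounded: compare with [E i], which is controlled by [Eb]. *)
  have bnd i : [/\ (D * Dy)^-1 <= (mh (e i) y).2%:num, (mh (e i) y).2%:num <= Dy * D &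
      gam (mh (e i) y).1 0 <= B + (1 + D * D) + (1 + Dy * (Dy * D * D))].
    have [h1 h2 h3] := cdist_bound (cy i); have [g1 g2 g3] := Eb i.
    have h1' : (mh (e i) y).2%:num <= Dy * D by rewrite (le_trans h1) // ler_wpM2l // ltW.
    split=> //.
      rewrite -div1r ler_pdivrMr; last exact: mulr_gt0.
      by rewrite (le_trans g2) // [leRHS]mulrC -mulrA ler_wpM2l // ltW.
    have h4 : idist (E i).1 (mh (e i) y).1 <= 1 + Dy * (Dy * D * D).
      rewrite idistC; apply: le_of_expr4; first exact: idist_ge0.
      by rewrite (le_trans h3) // ler_wpM2l ?(ltW Dy0) // ler_pM.
    have := idist_triangle O (E i).1 (mh (e i) y).1; rewrite !idist0p; lra.
  have [||d d0 dP] := @cdist_close R k n (D * Dy)^-1 (Dy * D) eps _ _ eps0.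
  - by rewrite invr_gt0 mulr_gt0.
  - by rewrite mulr_ge0 // ltW.
  have f1 : fincolor (fun i j => idist (mh (e i) y).1 (mh (e j) y).1 < d).
    by apply: fincolor_ipoint d0 _ => i; have [_ _] := bnd i; apply.
  have f2 : fincolor (fun i j => `|(mh (e i) y).2%:num - (mh (e j) y).2%:num| < d).
    apply: (@fincolor_real _ _ (Dy * D) _ d0) => i.
    by rewrite ger0_norm //; have [_ + _] := bnd i; apply.
  have := fincolorI f1 f2; apply: fincolorW => i j [l1 l2].
  by have [a1 a2 _] := bnd i; have [b1 b2 _] := bnd j; exact: dP.
have := fincolor_all cl; apply: fincolorW => i j h.
suff : mh (mcomp (minv (e j)) (e i)) = idfun.
  by move=> E0; apply/funext => y; have := congr1 (fun g => mh (e j) (g y)) E0; rewrite /= mhVK.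
apply: sP; first by apply: map_group_mcomp => //; exact: map_group_minv.
move=> y ys; have := h y ys.
suff -> : hdist (mh (e i) y) (mh (e j) y) = hdist (mhV (e j) (mh (e i) y)) y by [].
by apply/hdist_cdist; rewrite -(mob_cdist (e j) _ y) mhVK.
Qed.

(** The two inequalities cut out, inside a horoball at [xi], a cone around the geodesic from [eta]
    to [xi]. With [xi] at infinity the cone consists of points whose distance to the vertical over
    [w] is at most a multiple of the square root of their height, and a similarity displaces these
    by a bounded amount. *)
Lemma displacement_bound m xi eta (A : R) : mb m xi = xi -> xi <> eta ->
  exists D : R, forall h, bus xi h <= 1 -> bus xi h * bus eta h <= A ->
    cdist (mh m h) h <= D.
Proof.
move=> mx xe; have [ka kx] := mob_to_infinity xi.
have [w ke] : exists w, mb ka eta = Some w.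
  case e : (mb ka eta) => [w|]; first by exists w.
  by case: xe; apply: (can_inj (mbK ka)); rewrite kx e.
have [|c [f [c0 _ mS fc mhE]]] := @mob_fix_infty _ _ _ (mconj ka m).
  by rewrite -kx mb_conj mx.
pose a := mj ka xi; pose b := mj ka eta.
have a0 : 0 < a by exact: mj_gt0.
have b0 : 0 < b by exact: mj_gt0.
pose K := a * b * A; pose d0 := idist (f w) w.
(* In units of the square root of the height: (c + 1)(1 + K) accounts for the distance to [w] before
   and after the map, d0 sqrt(a) for the displacement of [w], as heights are at least 1/a, and the
   last term for the two heights. *)
pose W := (c + 1) * (1 + K) + d0 * Num.sqrt a + Num.sqrt (c ^+ 2 + 1).
exists (W ^+ 4 / c ^+ 2) => h h1 h2; pose y := mh ka h.
have -> : cdist (mh m h) h = cdist (mh (mconj ka m) y) y.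
  by rewrite /= /y mhK mob_cdist.
have bx : y.2%:num^-1 = a * bus xi h by have := mob_bus ka xi h; rewrite kx.
have be : gam (imul (iinv y.1) w) y.2%:num ^+ 4 / y.2%:num = b * bus eta h.
  by have := mob_bus ka eta h; rewrite ke.
have s0 := hgt_gt0 y; set s := y.2%:num in bx be s0.
have sa : 1 <= a * s.
  rewrite -[leLHS](mulVf (lt0r_neq0 s0)) ler_pM2r // bx ler_piMr // ltW //.
have K0 : gam (imul (iinv y.1) w) s ^+ 4 <= K * s ^+ 2.
  have -> : gam (imul (iinv y.1) w) s ^+ 4 =
     gam (imul (iinv y.1) w) s ^+ 4 / s * s^-1 * s ^+ 2 by field; rewrite gt_eqF.
  rewrite ler_wpM2r ?sqr_ge0 // be bx /K.
  rewrite (_ : b * bus eta h * (a * bus xi h) = a * b * (bus xi h * bus eta h)); last by ring.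
  by rewrite ler_wpM2l // ltW // mulr_gt0.
have r0 : 0 < Num.sqrt s by rewrite sqrtr_gt0.
have r4 : Num.sqrt s ^+ 4 = s ^+ 2 by rewrite (exprM _ 2 2) sqr_sqrtr // ltW.
pose t := idist y.1 w.
have t1 : t <= (1 + K) * Num.sqrt s.
  rewrite -ler_pdivrMr //; apply: le_of_expr4; first by rewrite divr_ge0 ?idist_ge0 ?ltW.
  rewrite exprMn exprVn r4 ler_pdivrMr ?exprn_gt0 // (le_trans _ K0) //.
  by rewrite /t idistE -gam_leX gam_homo // ltW.
have ra : 1 <= Num.sqrt a * Num.sqrt s by rewrite -sqrtrM ?(ltW a0) // -[leLHS]sqrtr1 ler_wsqrtr.
have [E1 E2] := mhE y.
rewrite /cdist E1 E2 -/s.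
have cs : 0 <= c ^+ 2 * s + s by rewrite addr_ge0 ?mulr_ge0 ?sqr_ge0 ?ltW.
have d0p : 0 <= d0 by exact: idist_ge0.
have gb : gam (imul (iinv (f y.1)) y.1) 0 + Num.sqrt (c ^+ 2 * s + s) <= W * Num.sqrt s.
  have -> : Num.sqrt (c ^+ 2 * s + s) = Num.sqrt (c ^+ 2 + 1) * Num.sqrt s.
    by rewrite -sqrtrM ?addr_ge0 ?sqr_ge0 // mulrDl mul1r.
  rewrite /W [leRHS]mulrDl lerD2r -idistE.
  have := idist_triangle (f y.1) (f w) y.1; have := idist_triangle (f w) w y.1.
  rewrite fc -/t -/d0 (idistC w) -/t => T1 T2.
  have D1 : d0 <= d0 * (Num.sqrt a * Num.sqrt s) by rewrite ler_peMr.
  have T3 : (c + 1) * t <= (c + 1) * ((1 + K) * Num.sqrt s).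
    by rewrite ler_wpM2l // addr_ge0 // ltW.
  rewrite (le_trans T2) // (le_trans (lerD (lexx _) T1)) //.
  rewrite (_ : c * t + (d0 + t) = (c + 1) * t + d0); last by ring.
  by rewrite [leRHS]mulrDl lerD // -mulrA.
have c20 : 0 < c ^+ 2 by rewrite exprn_gt0.
rewrite ler_pdivrMr ?mulr_gt0 // (le_trans (gam4_le _ cs)) //.
have -> : W ^+ 4 / c ^+ 2 * (c ^+ 2 * s * s) = (W * Num.sqrt s) ^+ 4.
  by rewrite exprMn r4; field; rewrite gt_eqF.
rewrite ler_pXn2r ?nnegrE //; first by rewrite addr_ge0 ?gam_ge0 ?sqrtr_ge0.
by rewrite (le_trans _ gb) // addr_ge0 ?gam_ge0 ?sqrtr_ge0.
Qed.

End Discreteness.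

(** * The modular group, digits and Gauss orbits *)

Section Modular.
Context {R : realType} {k : scalars} {n : nat} (n_gt0 : (0 < n)%N) (cf : iwasawaCF R k n).
Local Notation X := (ipoint R k n).
Local Notation H := (hpoint R k n).
Local Notation bX := (bpoint R k n).
Local Notation O := (iorigin k n : X).
Local Notation M := (modular_group cf).
Local Notation T := (gauss_map cf).
Implicit Types (p q x y : X) (h : H) (xi eta : bX) (m L : mob R k n).

Lemma isometry_bij (f : X -> X) : isometry (@idist R k n) f ->
  exists2 g, cancel f g & cancel g f.
Proof.
move=> [fi /choice[g fg]]; exists g => // p; apply: idist_eq0.
by rewrite -fi fg idistxx.
Qed.

Lemma modular_gen g :
  ([set g | exists2 f, cfZ cf f & extends g f] `|`
   [set g \o @iota_hyp R k n | g in [set g | extends g (cfO cf)]]) g -> M g.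
Proof. by move=> Sg A [_]; apply. Qed.

(** By [extends_hmap] the extension of [f] is [hmap f], which preserves heights; hence the factor
    1. *)
Lemma cfZ_mob f : cfZ cf f -> exists F : mob R k n,
  [/\ M (mh F), forall xi, mb F xi = omap f xi & forall xi, mj F xi = 1].
Proof.
move=> Zf; have [fi _] := cfZ_isometry Zf; have [g ge] := cfZ_extends Zf.
have [f' fK f'K] := isometry_bij (cfZ_isometry Zf).
have [gi gE] := extends_hmap n_gt0 fi ge.
exists (mob_iso fK f'K gi); split=> //=; rewrite -gE.
by apply: modular_gen; left; exists f.
Qed.

Lemma iota_mob : exists I : mob R k n,
  [/\ M (mh I), forall xi, mb I xi = omap (cfO cf) (biota xi) & forall xi, mj I xi = jiota xi].
Proof.
have [fi _] := cfO_isometry cf; have [g ge] := cfO_extends cf.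
have [f' fK f'K] := isometry_bij (cfO_isometry cf).
have [gi gE] := extends_hmap n_gt0 fi ge.
exists (mcomp (mob_iso fK f'K gi) miota); split=> //=; last by move=> xi; rewrite mul1r.
by apply: modular_gen; right; exists g => //; rewrite gE.
Qed.

Lemma modular_mob g : M g -> exists m, mh m = g.
Proof.
move=> Mg; apply: (Mg [set g | exists m, mh m = g]); split.
  split; first by exists mid; apply/funext => -[].
    by move=> _ _ [m <-] [m' <-]; exists (mcomp m m').
  by move=> _ [m <-]; exists (mhV m); split; [exists (minv m)|exact: mhK|exact: mhVK].
move=> g' [[f Zf ge]|[g0 ge <-]].
  have [fi _] := cfZ_isometry Zf; have [f' fK f'K] := isometry_bij (cfZ_isometry Zf).
  have [gi gE] := extends_hmap n_gt0 fi ge.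
  by exists (mob_iso fK f'K gi); rewrite gE.
have [fi _] := cfO_isometry cf; have [f' fK f'K] := isometry_bij (cfO_isometry cf).
have [gi gE] := extends_hmap n_gt0 fi ge.
by exists (mcomp (mob_iso fK f'K gi) miota); rewrite gE.
Qed.

(** The generated group is an intersection, and each group in it provides its own inverse of a given
    map. All of these coincide with the inverse [mhV m] supplied by [modular_mob]. *)
Lemma modular_map_group : map_group M.
Proof.
split.
- by move=> A [[A1 _ _] _].
- by move=> f g Mf Mg A AP; have [[_ AM _] _] := AP; exact: AM (Mf _ AP) (Mg _ AP).
- move=> f Mf; have [m mf] := modular_mob Mf; subst f.
  exists (mhV m); split; [|exact: mhK|exact: mhVK].
  by move=> A AP; have [gA _] := AP; exact: (map_group_minv gA (Mf _ AP)).
Qed.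

Lemma modular_mcomp m m' : M (mh m) -> M (mh m') -> M (mh (mcomp m m')).
Proof. exact: (map_group_mcomp modular_map_group). Qed.

Lemma modular_minv m : M (mh m) -> M (mh (minv m)).
Proof. exact: (map_group_minv modular_map_group). Qed.

Lemma modular_mconj m m' : M (mh m) -> M (mh m') -> M (mh (mconj m m')).
Proof. exact: (map_group_mconj modular_map_group). Qed.

Lemma pinv_cfZ f p : cfZ cf f -> f (pinv [set: X] f p) = p.
Proof.
move=> /cfZ_isometry[_ /(_ p)[q <-]].
by rewrite (pinvK (fun=> point)) // inE; exists q.
Qed.

Lemma cf_floorP p : cfZ cf (cf_floor cf p) /\ cfK cf (cf_frac cf p).
Proof.
rewrite /cf_frac /cf_floor; case: xgetP => [f _ []//|].
by have [f [fP _]] := cfK_fundamental cf p => /(_ f).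
Qed.

Lemma cf_floor_frac p : cf_floor cf p (cf_frac cf p) = p.
Proof. by rewrite pinv_cfZ //; have [] := cf_floorP p. Qed.

Lemma cfZ_inj f : cfZ cf f -> injective f.
Proof. by move=> /cfZ_isometry/isometry_bij[g fK _]; exact: can_inj fK. Qed.

(** If [h] is the element bringing [p] into [K], then [f \o h] brings it to the same point because
    [f] fixes [p]; uniqueness gives h = f h. *)
Lemma cfZ_free f p : cfZ cf f -> f p = p -> f = idfun.
Proof.
move=> Zf fp; have [h [[Zh Kh] hu]] := cfK_fundamental cf p.
have Zfh : cfZ cf (f \o h) by have [_ ZM _] := cfZ_group cf; exact: ZM.
have e : h = f \o h.
  apply: hu; split=> //; suff -> : pinv [set: X] (f \o h) p = pinv [set: X] h p by [].
  by apply: (cfZ_inj Zfh); rewrite pinv_cfZ //= pinv_cfZ.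
apply/funext => x; rewrite -{1}(pinv_cfZ x Zh).
by have := congr1 (fun g => g (pinv [set: X] h x)) e; rewrite /= pinv_cfZ.
Qed.

(** A point of gauge 2 lies outside the unit ball, so its floor cannot be the identity. *)
Lemma cfZ_nontrivial : exists2 f, cfZ cf f & forall p, f p <> p.
Proof.
have [p p2] := @exists_gauge R k n 2 n_gt0 (ler0n _ _).
have [Zf Kp] := cf_floorP p; exists (cf_floor cf p) => // q /(cfZ_free Zf) e.
have := cf_floor_frac p; rewrite e /= => fp.
by have := cfK_ball Kp; rewrite fp gaugeE p2; lra.
Qed.

Lemma infinity_parabolic : exists F : mob R k n,
  [/\ M (mh F), mb F None = None, mj F None = 1 & forall p, mb F (Some p) <> Some p].
Proof.
have [f Zf fp] := cfZ_nontrivial; have [F [MF bF jF]] := cfZ_mob Zf.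
by exists F; split=> // p; rewrite bF /= => -[/fp].
Qed.

Lemma cfK_gauss y : cfK cf (T y).
Proof. by have [] := cf_floorP (cf_iota cf y). Qed.

(** The Gauss map is the inversion followed by an element of [cfZ cf]; the latter and [cfO cf] have
    factor 1 and fix infinity, so the factor is that of the Koranyi inversion and the origin goes to
    infinity. *)
Lemma step_mob y : y <> O -> exists S : mob R k n,
  [/\ M (mh S), mb S (Some y) = Some (T y), mb S (Some O) = None &
      forall xi, mj S xi = jiota xi].
Proof.
move=> y0; have [I [MI bI jI]] := iota_mob.
have [Zf _] := cf_floorP (cf_iota cf y); have [F [MF bF jF]] := cfZ_mob Zf.
exists (mcomp (minv F) I); split.
- exact: (modular_mcomp (modular_minv MF) MI).
- have /eqP/negbTE yO := y0.
  have -> : Some (T y) = mbV F (mb F (Some (T y))) by rewrite mbK.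
  by rewrite bF /= cf_floor_frac bI /= yO.
- by rewrite /= bI /= eqxx; exact: (minv_fix (bF None)).
- by move=> xi; rewrite /= jF jI invr1 mul1r.
Qed.

Lemma orbit_to_infinity y i : iter i T y = O ->
  exists2 m, M (mh m) & mb m (Some y) = None.
Proof.
have [I [MI bI _]] := iota_mob.
have base : exists2 m, M (mh m) & mb m (Some O) = None.
  by exists I => //; rewrite bI /= eqxx.
elim: i y => [|i IH] y; first by move=> /= ->.
have [->//|/eqP y0] := eqVneq y O; rewrite iterSr => /IH[m Mm mT].
have [S [MS bS _ _]] := step_mob y0; exists (mcomp m S).
  exact: (modular_mcomp Mm MS).
by rewrite /= bS.
Qed.

(** The point of [K] whose Gauss orbit produces the digits; outside [K] the expansion has one extra
    leading digit, the floor of [x]. *)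
Definition cf_start x : X := if `[< cfK cf x >] then x else cf_frac cf x.

Lemma cf_startK x : cfK cf (cf_start x).
Proof. by rewrite /cf_start; case: asboolP => // _; have [] := cf_floorP x. Qed.

Lemma start_mob x : exists2 m, M (mh m) & mb m (Some x) = Some (cf_start x).
Proof.
have [Zf _] := cf_floorP x; have [F [MF bF _]] := cfZ_mob Zf.
rewrite /cf_start; case: asboolP => _.
  exists (mcomp (minv F) F); last by rewrite /= mbK.
  exact: (modular_mcomp (modular_minv MF) MF).
exists (minv F); first exact: modular_minv.
have -> : Some x = mb F (Some (cf_frac cf x)) by rewrite bF /= cf_floor_frac.
exact: mbK.
Qed.

Lemma cf_digit_None y i : cf_digit cf y i = None <-> exists2 j, (j <= i)%N & iter j T y = O.
Proof.
rewrite /cf_digit; case: hasP => [[j]|h].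
  by rewrite mem_iota add0n ltnS => ji /eqP jO; split=> // _; exists j.
split=> // -[j ji jO]; case: h; exists j; last by rewrite jO.
by rewrite mem_iota add0n ltnS.
Qed.

Lemma finite_expansionE x :
  finite_expansion cf x <-> exists i, iter i T (cf_start x) = O.
Proof.
rewrite /finite_expansion /cf_expansion /cf_start; case: asboolP => _; split.
- by move=> [i /cf_digit_None[j _ jO]]; exists j.
- by move=> [i iO]; exists i; apply/cf_digit_None; exists i.
- by move=> [[|i] //= /cf_digit_None[j _ jO]]; exists j.
- by move=> [i iO]; exists i.+1; apply/cf_digit_None; exists i.
Qed.

Lemma infinite_expansionE x :
  (forall i, cf_expansion cf x i <> None) <-> forall i, iter i T (cf_start x) <> O.
Proof.
have := finite_expansionE x; rewrite /finite_expansion => -[h1 h2]; split=> h i e.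
  by have [|j /h] := h2; first by exists i.
by have [|j /h] := h1; first by exists i.
Qed.

Lemma cf_digit_infinite y i : (forall j, iter j T y <> O) ->
  cf_digit cf y i = Some (cf_floor cf (cf_iota cf (iter i T y))).
Proof.
move=> h; rewrite /cf_digit; by case: hasP => // -[j _ /eqP/h].
Qed.

Lemma idist_cf_iota p q : p <> O -> q <> O ->
  idist (cf_iota cf p) (cf_iota cf q) = idist p q / (gam p 0 * gam q 0).
Proof. by move=> p0 q0; have [fi _] := cfO_isometry cf; rewrite /cf_iota fi idist_iota. Qed.

(** * Proper and discrete continued fractions *)

Context (proper : cf_proper cf) (disc : cf_discrete cf).

Lemma radius : exists2 r : R, 0 < r < 1 & forall p, cfK cf p -> gam p 0 <= r.
Proof.
(* The maximum with 1/2 keeps the radius positive, so that it can be inverted. *)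
exists (Num.max (sup [set gauge p | p in cfK cf]) 2^-1).
  rewrite lt_max gt_max [X in _ || X]invr_gt0 ltr0n orbT /=; apply/andP; split; first exact: proper.
  by rewrite invf_lt1 // ltr1n.
move=> p Kp; rewrite le_max -gaugeE; apply/orP; left; apply: ub_le_sup; last by exists p.
by exists 1; move=> _ [q Kq <-]; exact: (cfK_ball Kq).
Qed.

(* Equal digits make the distance of the two orbits grow by the factor [r^-2]. *)
Lemma same_digits_eq y y' : cfK cf y -> cfK cf y' ->
  (forall i, iter i T y <> O) -> (forall i, iter i T y' <> O) ->
  (forall i, cf_digit cf y i = cf_digit cf y' i) -> y = y'.
Proof.
move=> Ky Ky' yO yO' dE; have [r /andP[r0 r1] rP] := radius.
have Ki i z : cfK cf z -> cfK cf (iter i T z) by case: i => // i _; exact: cfK_gauss.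
have r2 : 0 < r ^+ 2 by rewrite exprn_gt0.
have step i : idist (iter i T y) (iter i T y') <=
    r ^+ 2 * idist (iter i.+1 T y) (iter i.+1 T y').
  rewrite !iterS /gauss_map; have := dE i; rewrite !cf_digit_infinite // => -[e].
  set p := cf_iota cf _ in e *; set q := cf_iota cf _ in e *.
  have [Zf _] := cf_floorP p; have [fi _] := cfZ_isometry Zf.
  rewrite -(fi (cf_frac cf p)) {2}e !cf_floor_frac /p /q idist_cf_iota //.
  have gp : 0 < gam (iter i T y) 0 by exact: gam0_gt0.
  have gq : 0 < gam (iter i T y') 0 by exact: gam0_gt0.
  rewrite mulrC -mulrA ler_peMr ?idist_ge0 // mulrC ler_pdivlMr ?mulr_gt0 // mul1r.
  rewrite expr2; apply: ler_pM; [exact: ltW|exact: ltW| |].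
    by apply: rP; exact: Ki.
  by apply: rP; exact: Ki.
have grow i : idist y y' <= (r ^+ 2) ^+ i * idist (iter i T y) (iter i T y').
  elim: i => [|i IH]; first by rewrite expr0 mul1r.
  rewrite (le_trans IH) // (exprSr (r ^+ 2) i) -mulrA.
  by apply: ler_wpM2l; [exact/exprn_ge0/ltW|exact: step].
(* The constant 2 bounds the distance between two points of the unit ball. *)
apply: idist_eq0; apply: (@geometric_eq0 _ 2 (r ^+ 2)); first exact: ltW.
  by rewrite exprn_ilt1 // ltW.
move=> i; rewrite ger0_norm ?idist_ge0 // (le_trans (grow i)) // mulrC.
apply: ler_wpM2r; first exact/exprn_ge0/ltW.
rewrite (le_trans (idist_triangle _ O _)) //.
rewrite (idistC _ O) !idist0p; have := rP _ (Ki i _ Ky); have := rP _ (Ki i _ Ky').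
by lra.
Qed.

Lemma eventually_periodicE x : eventually_periodic_expansion cf x <->
  (forall i, iter i T (cf_start x) <> O) /\
  exists i j, (i < j)%N /\ iter i T (cf_start x) = iter j T (cf_start x).
Proof.
rewrite /eventually_periodic_expansion; split.
  move=> [/infinite_expansionE inf [N [m [m0 per]]]]; split=> //; exists N, (N + m)%N.
  split; first by rewrite -{1}(addn0 N) ltn_add2l.
  (* For [x] outside [K] the digit of index i is entry i + 1 of the expansion, so periodicity is
     used at both i and i + 1. *)
  have {}per i : (N <= i)%N -> cf_digit cf (cf_start x) (i + m) = cf_digit cf (cf_start x) i.
    move=> Ni; have := per i Ni; have := per i.+1 (leqW Ni).
    by rewrite /cf_expansion /cf_start addSn; case: asboolP.
  have Ki i : cfK cf (iter i T (cf_start x)).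
    by case: i => [|i]; [exact: cf_startK|exact: cfK_gauss].
  apply: same_digits_eq => // [i|i|i]; rewrite -?iterD //.
  have := per (N + i)%N (leq_addr _ _).
  rewrite !cf_digit_infinite //; try by move=> j; rewrite -iterD.
  by rewrite -!iterD (addnC i N) (addnC i (N + m)%N) (addnAC N m i) => ->.
move=> [inf [i [j [ij e]]]]; split; first exact/infinite_expansionE.
(* Starting at [i.+1] rather than [i] makes room for the possible leading floor. *)
exists i.+1, (j - i)%N.
split; first by rewrite subn_gt0.
have per l : (i <= l)%N -> iter (l + (j - i)) T (cf_start x) = iter l T (cf_start x).
  move=> il; rewrite -(subnK il) -addnA subnKC ?(ltnW ij) // !iterD e.
  by [].
have dig l : (i <= l)%N -> cf_digit cf (cf_start x) (l + (j - i)) = cf_digit cf (cf_start x) l.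
  by move=> il; rewrite !cf_digit_infinite // per.
case=> [//|l]; rewrite ltnS => il; have := dig l il; have := dig l.+1 (leqW il).
by rewrite /cf_expansion /cf_start addSn; case: asboolP.
Qed.

Lemma modular_mid : M (mh mid).
Proof.
have -> : mh mid = (idfun : H -> H) by apply/funext => -[].
by have [h _ _] := modular_map_group; exact: h.
Qed.

(* [rho] bounds the distance from [x_i] to the image of infinity from below:
   [d / (r (r + d)) >= rho] whenever [d >= rho = r^-1 - r]. *)
Definition separated (rho : R) y eta : Prop :=
  if eta is Some z then rho <= idist y z else True.

(** The bound is the fixed point of the increasing map taking d to d / (r (r + d)), which bounds the
    new distance from below. The image of infinity is treated apart, and the origin goes to
    infinity. *)
Lemma separated_step (r : R) y eta m : 0 < r < 1 -> y <> O -> gam y 0 <= r ->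
  mb m (Some y) = Some (T y) -> mb m (Some O) = None ->
  (forall xi, mj m xi = jiota xi) ->
  separated (r^-1 - r) y eta -> separated (r^-1 - r) (T y) (mb m eta).
Proof.
move=> /andP[r0 r1] y0 yr my mO mJ sep; case e : (mb m eta) => [z|//] /=.
have g0 := gam0_gt0 y0; have /eqP/negbTE yO := y0.
have := mob_bdist m (Some y) eta; rewrite my e !mJ [in jiota (Some y)]/jiota yO /= => D.
case: eta sep e D => [w|] /=.
  have [->|/eqP w0] := eqVneq w O; first by rewrite mO.
  move=> sep _ D; have gw := gam0_gt0 w0.
  have -> : idist (T y) z = idist y w / (gam y 0 * gam w 0).
    apply/eqP; rewrite -(@eqrXn2 _ 4) ?idist_ge0 ?divr_ge0 ?mulr_ge0 ?idist_ge0 ?gam_ge0 //.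
    by rewrite D; apply/eqP; field; rewrite !gt_eqF.
  rewrite ler_pdivlMr ?mulr_gt0 //.
  have rho0 : 0 < r^-1 - r by rewrite subr_gt0 (lt_trans r1) // invf_gt1.
  have w1 : gam w 0 <= r + idist y w.
    by have := idist_triangle O y w; rewrite !idist0p; lra.
  have h1 : gam y 0 * gam w 0 <= r * (r + idist y w) by rewrite ler_pM ?gam_ge0.
  rewrite (le_trans (ler_wpM2l (ltW rho0) h1)) //.
  have rr : (r^-1 - r) * r = 1 - r ^+ 2 by rewrite mulrBl mulVf ?gt_eqF // expr2.
  rewrite mulrA rr.
  (* The goal (1 - r^2)(r + d) <= d is r (1 - r^2) <= r^2 d, that is, d >= r^-1 - r. *)
  have : r * (r^-1 - r) * r <= r * idist y w * r by rewrite ler_pM2r // ler_pM2l.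
  by rewrite -mulrA rr; nra.
(* For [eta] at infinity the new distance is 1/|y| >= 1/r. *)
move=> _ _ D.
have -> : idist (T y) z = (gam y 0)^-1.
  apply/eqP; rewrite -(@eqrXn2 _ 4) ?idist_ge0 ?invr_ge0 ?gam_ge0 //.
  by rewrite D exprVn !mulr1.
have : r^-1 <= (gam y 0)^-1 by rewrite lef_pV2 ?posrE.
by move: r0; lra.
Qed.

(** The [i]-th map composes the first [i] steps. Each step multiplies the factor by |x_i|^-4 > 1,
    and separation starts from the identity, which fixes infinity. *)
Lemma orbit_mobs x : cfK cf x -> (forall i, iter i T x <> O) ->
  exists rho : R, exists m : nat -> mob R k n, [/\ 0 < rho,
    forall i, M (mh (m i)),
    forall i, mb (m i) (Some x) = Some (iter i T x),
    forall i, separated rho (iter i T x) (mb (m i) None) &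
    forall i, 1 <= mj (m i) (Some x) /\ mj (m i) (Some x) < mj (m i.+1) (Some x)].
Proof.
move=> Kx xO; have [r rr rP] := radius; have /andP[r0 r1] := rr.
have /choice[S SP] i : exists S : mob R k n, [/\ M (mh S), mb S (Some (iter i T x)) =
    Some (T (iter i T x)), mb S (Some O) = None & forall xi, mj S xi = jiota xi].
  exact: step_mob.
have Ki i : gam (iter i T x) 0 <= r.
  by apply: rP; case: i => // i; exact: cfK_gauss.
pose m := fix m i := if i is j.+1 then mcomp (S j) (m j) else mid.
have mx i : mb (m i) (Some x) = Some (iter i T x).
  by elim: i => // i IH; rewrite /= IH; have [_ -> _ _] := SP i.
have jS i : mj (m i.+1) (Some x) = (gam (iter i T x) 0 ^+ 4)^-1 * mj (m i) (Some x).
  rewrite /= mx; have [_ _ _ ->] := SP i; rewrite /=.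
  by have /eqP/negbTE -> := xO i.
have gt1 i : 1 < (gam (iter i T x) 0 ^+ 4)^-1.
  have g0 := gam0_gt0 (xO i).
  by rewrite invf_gt1 ?exprn_gt0 // exprn_ilt1 ?gam_ge0 // (le_lt_trans (Ki i)).
have lt i : mj (m i) (Some x) < mj (m i.+1) (Some x).
  by rewrite jS ltr_pMl ?mj_gt0.
exists (r^-1 - r), m; split=> //.
- by rewrite subr_gt0 (lt_trans r1) // invf_gt1.
- elim=> [|i IH]; first exact: modular_mid.
  by have [MS _ _ _] := SP i; exact: (modular_mcomp MS IH).
- elim=> [//|i IH]; have [_ h1 h2 h3] := SP i.
  exact: (separated_step rr (xO i) (Ki i) h1 h2 h3 IH).
- move=> i; split=> //; elim: i => [//|i IH]; exact: le_trans IH (ltW (lt i)).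
Qed.

(** The quotient of [bus xi h * bus eta h] by [bdist xi eta] is invariant. It is evaluated at the
    image, the point of height 1 over [z], where separation bounds it. *)
Lemma orbit_bus m x z (rho : R) : 0 < rho -> mb m (Some x) = Some z ->
  separated rho z (mb m None) -> 1 <= mj m (Some x) ->
  bus (Some x) (mhV m (hone z)) <= 1 /\
  bus (Some x) (mhV m (hone z)) * bus None (mhV m (hone z)) <= (1 + rho^-1) ^+ 4.
Proof.
move=> rho0 mx sep J1; set y := mhV m (hone z); set J := mj m (Some x) in J1.
have J0 : 0 < J by rewrite (lt_le_trans _ J1).
have b1 : bus (Some x) y = J^-1.
  have := mob_bus m (Some x) y; rewrite mx /y mhVK /= imulVp gam_origin // sqrtr1.
  by rewrite expr1n divr1 -/y -/J => /(congr1 (fun u => J^-1 * u)); rewrite mulr1 mulKf ?gt_eqF.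
split; first by rewrite b1 invf_le1.
have bN := mob_bus m None y; have DN := mob_bdist m (Some x) None.
rewrite mx -/J mulr1 in DN; rewrite /y mhVK -/y in bN.
have j0 := mj_gt0 m None.
have -> : bus (Some x) y * bus None y = bus (mb m None) (hone z) / bdist (Some z) (mb m None).
  by rewrite bN DN b1; field; rewrite !gt_eqF.
case: (mb m None) sep => [w|] /= sep; last first.
  by rewrite invr1 mulr1 exprn_ege1 // lerDl invr_ge0 ltW.
rewrite divr1 -expr_div_n; apply: lerXn2r; rewrite ?nnegrE.
- by rewrite divr_ge0 ?gam_ge0 ?idist_ge0.
- by rewrite addr_ge0 // invr_ge0 ltW.
have d0 : 0 < idist z w by rewrite (lt_le_trans rho0).
rewrite ler_pdivrMr // (le_trans (gam_le_gauge _ ler01)) // sqrtr1 -idistE mulrDl mul1r lerD2l.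
by rewrite mulrC ler_pdivlMr // mul1r.
Qed.

(** The displacement of (x_i, 1) under m_i L m_i^-1 is that of m_i^-1 (x_i, 1) under [L]. By
    [orbit_bus] the latter point lies in the cone between infinity and [x] of [displacement_bound],
    so the displacements are bounded and [discrete_fincolor] applies. *)
Lemma orbit_fincolor x L (rho : R) (m : nat -> mob R k n) : cfK cf x -> M (mh L) ->
  mb L (Some x) = Some x -> 0 < rho -> (forall i, M (mh (m i))) ->
  (forall i, mb (m i) (Some x) = Some (iter i T x)) ->
  (forall i, separated rho (iter i T x) (mb (m i) None)) ->
  (forall i, 1 <= mj (m i) (Some x)) ->
  fincolor (fun i j => mh (mconj (m i) L) = mh (mconj (m j) L)).
Proof.
move=> Kx ML Lx rho0 Mm mx sep J1.
have [|D DP] := @displacement_bound R k n L (Some x) None ((1 + rho^-1) ^+ 4) Lx; first by [].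
have [r _ rP] := radius.
apply: (@discrete_fincolor _ _ _ M (fun i => mconj (m i) L) (fun i => iter i T x) r D).
- exact: modular_map_group.
- exact: disc.
- by move=> i; exact: modular_mconj.
- by move=> i; apply: rP; case: i => // i; exact: cfK_gauss.
move=> i; have [h1 h2] := orbit_bus rho0 (mx i) (sep i) (J1 i).
rewrite -{2}(mhVK (m i) (hone (iter i T x))) /= mob_cdist.
exact: DP.
Qed.

(** Three indices i < j < l with the same conjugate give three fixed points of [L], the preimages of
    x_i, x_j and x_l under m_l. As [L] has at most two, a pair of them coincides. *)
Lemma fixed_orbit_periodic x L a b : cfK cf x -> (forall i, iter i T x <> O) ->
  M (mh L) -> mb L (Some x) = Some x ->
  (forall zeta, mb L zeta = zeta -> zeta = a \/ zeta = b) ->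
  exists i j, (i < j)%N /\ iter i T x = iter j T x.
Proof.
move=> Kx xO ML Lx ab; have [rho [m [rho0 Mm mx sep J]]] := orbit_mobs Kx xO.
have [i [j [l [ij jl eil ejl eij]]]] :=
  fincolor_triple (orbit_fincolor Kx ML Lx rho0 Mm mx sep (fun i => proj1 (J i))).
(* The common conjugate fixes x_u; pulling back by m_v gives a fixed point of [L]. *)
have fixd u v : mh (mconj (m u) L) = mh (mconj (m v) L) ->
    mb L (mbV (m v) (Some (iter u T x))) = mbV (m v) (Some (iter u T x)).
  move=> /mb_ext/(congr1 (fun g => g (mb (m u) (Some x)))).
  rewrite mb_conj Lx mx /= => /(congr1 (mbV (m v))).
  by rewrite mbK => <-.
have back u v w : mbV (m v) (Some (iter u T x)) = mbV (m v) (Some (iter w T x)) ->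
    iter u T x = iter w T x.
  by move=> /(can_inj (mbVK (m v))) [].
have self v : mbV (m v) (Some (iter v T x)) = Some x by rewrite -mx mbK.
have il := ltn_trans ij jl.
have := (ab _ (fixd _ _ eil), ab _ (fixd _ _ ejl), ab _ Lx); rewrite -(self l).
move=> [[A B] C].
case: A => A; case: B => B; case: C => C.
- by exists i, l; split=> //; apply: (back _ l); rewrite A C.
- by exists i, j; split=> //; apply: (back _ l); rewrite A B.
- by exists i, l; split=> //; apply: (back _ l); rewrite A C.
- by exists j, l; split=> //; apply: (back _ l); rewrite B C.
- by exists j, l; split=> //; apply: (back _ l); rewrite B C.
- by exists i, l; split=> //; apply: (back _ l); rewrite A C.
- by exists i, j; split=> //; apply: (back _ l); rewrite A B.
- by exists i, l; split=> //; apply: (back _ l); rewrite A C.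
Qed.

(* If [L] is conjugated to the same element at times [i < j], then
   [m_j^-1 m_i] commutes with [L], fixes [x] and is not parabolic there, so [L]
   also fixes its other fixed point. *)
Lemma parabolic_orbit_finite x L : cfK cf x -> M (mh L) -> mb L (Some x) = Some x ->
  (forall zeta, mb L zeta = zeta -> zeta = Some x) -> exists i, iter i T x = O.
Proof.
move=> Kx ML Lx Lu; apply: contrapT => nO.
have xO i : iter i T x <> O by move=> e; apply: nO; exists i.
have [rho [m [rho0 Mm mx sep J]]] := orbit_mobs Kx xO.
have [i [j [ij e]]] :=
  fincolor_pair (orbit_fincolor Kx ML Lx rho0 Mm mx sep (fun i => proj1 (J i))).
have {}e := mb_ext e.
have comm zeta : mb (mcomp (minv (m j)) (m i)) (mb L zeta) =
                 mb L (mb (mcomp (minv (m j)) (m i)) zeta).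
  have := congr1 (fun g => mbV (m j) (g (mb (m i) zeta))) e.
  by rewrite mb_conj /= mbK.
set g := mcomp _ _ in comm.
have gx : mb g (Some x) = Some x by apply: Lu; rewrite -comm Lx.
have mji : mj (m i) (Some x) < mj (m j) (Some x).
  have lt u : mj (m u) (Some x) < mj (m u.+1) (Some x) by have [] := J u.
  elim: j ij {e comm g gx} => // j IH; rewrite ltnS leq_eqVlt => /predU1P[->//|/IH h].
  exact: lt_trans h (lt j).
have jg : mj g (Some x) <> 1.
  by rewrite mj_quot // => /divr1_eq E; move: mji; rewrite E ltxx.
have [eta [ex ge gu]] := mob_fix_two gx jg.
have : mb L eta = eta.
  have [E|//] : mb L eta = Some x \/ mb L eta = eta by apply: gu; rewrite comm ge.
  by case: ex; apply: (can_inj (mbK L)); rewrite E Lx.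
by move/Lu.
Qed.

(** Conjugating by powers of [L] a parabolic [F] fixing infinity yields maps that move the finite
    fixed point [q] of [L] by c^i times a positive constant: infinitely many distinct elements with
    bounded displacement at (q, 1). *)
Lemma no_loxodromic_infinity L : M (mh L) -> mb L None = None -> mj L None <> 1 -> False.
Proof.
(* Up to inversion of [L], the induced similarity of [X] is a contraction. *)
wlog : L / 1 < mj L None.
  move=> wl ML LN j1; case: (ltgtP (mj L None) 1) => // j2; last exact: (wl L).
  apply: (wl (minv L)); [|exact: modular_minv|exact: minv_fix|].
    by rewrite mj_minv // invf_gt1 ?mj_gt0.
  by rewrite mj_minv // => /(congr1 GRing.inv); rewrite invrK invr1.
move=> L1 ML LN j1; have [F [MF FN jF Fp]] := infinity_parabolic.
have [q Lq _] := fix_infty_two LN j1.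
have [c [f [c0 c2 LS fc _]]] := mob_fix_infty LN.
have c1 : c < 1 by rewrite -(@ltr_pXn2r _ 2) ?nnegrE ?(ltW c0) // expr1n c2 invf_lt1 ?mj_gt0.
have fq : f q = q by apply: Some_inj; rewrite -LS.
have [_ [f0 [_ _ FS _ _]]] := mob_fix_infty FN.
have d0 : 0 < idist (f0 q) q by apply: idist_gt0 => E; apply: (Fp q); rewrite FS E.
pose A i := iter i (mcomp L) mid.
have MA i : M (mh (A i)).
  elim: i => [|i IH]; first exact: modular_mid.
  exact: (modular_mcomp ML IH).
have AN i : mb (A i) None = None by elim: i => //= i ->.
have AS i p : mb (A i) (Some p) = Some (iter i f p) by elim: i => //= i ->; rewrite LS.
have fiq i : iter i f q = q by elim: i => //= i ->.
have eq0 i : mb (mconj (A i) F) (Some q) = Some (iter i f (f0 q)).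
  by rewrite -{1}(fiq i) -AS mb_conj FS AS.
(* The conjugates have factor 1 at infinity, so they keep the height 1, and they move [q] by at most
   its displacement under [F]. *)
pose D := (idist (f0 q) q + Num.sqrt (1 + 1)) ^+ 4.
suff fin : fincolor (fun i j => mh (mconj (A i) F) = mh (mconj (A j) F)).
  have [i [j [ij e]]] := fincolor_pair fin.
  have := congr1 (fun g => g (Some q)) (mb_ext e); rewrite !eq0 => -[E].
  have si := iter_sim i (f0 q) q fc; have := iter_sim j (f0 q) q fc.
  rewrite fiq in si; rewrite fiq -E si => /(mulIf (lt0r_neq0 d0)) /eqP.
  by rewrite gt_eqF // ltr_iXn2l.
apply: (@discrete_fincolor _ _ _ M (fun i => mconj (A i) F) (fun=> q) (gam q 0) D).
- exact: modular_map_group.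
- exact: disc.
- by move=> i; exact: (modular_mconj (MA i) MF).
- by move=> i.
move=> i.
have [|ci [fi [ci0 ci2 eS _ eh]]] := @mob_fix_infty _ _ _ (mconj (A i) F).
  by rewrite -{1}(AN i) mb_conj FN AN.
have ci1 : ci ^+ 2 = 1 by rewrite ci2 -(AN i) mj_conj // jF invr1.
have [h1 h2] := eh (hone q).
have fiE : fi q = iter i f (f0 q) by apply: Some_inj; rewrite -eS eq0.
rewrite /cdist h1 h2 ci1 /= !mulr1 divr1 fiE.
have d2 : (0 : R) <= 1 + 1 by [].
rewrite (le_trans (gam4_le _ d2)) // ler_pXn2r ?nnegrE ?addr_ge0 ?gam_ge0 ?sqrtr_ge0 ?idist_ge0 //.
rewrite lerD2r -idistE -{2}(fiq i) (iter_sim _ _ _ fc) ler_piMl ?idist_ge0 //.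
by rewrite exprn_ile1 // ltW.
Qed.

Lemma finite_iff_parabolic x : finite_expansion cf x <->
  exists g, [/\ M g, parabolic g & bfixed g (Some x)].
Proof.
have [m0 Mm0 m0x] := start_mob x; rewrite finite_expansionE; split.
  move=> [i /orbit_to_infinity[m Mm my]].
  have [F [MF FN jF Fp]] := infinity_parabolic.
  (* Since [w] sends [x] to infinity, pulling the parabolic [F] back by [w] moves its only fixed
     point to [x]. *)
  pose w := mcomp m m0; have wx : mb w (Some x) = None by rewrite /= m0x.
  have Mw : M (mh w) := modular_mcomp Mm Mm0.
  pose P := mconj (minv w) F.
  have wN : mb (minv w) None = Some x by rewrite -wx; exact: mbK.
  have Px : mb P (Some x) = Some x by rewrite -wN mb_conj FN.
  have jP : mj P (Some x) = 1 by rewrite -wN mj_conj.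
  have [na nr] := not_attracting n_gt0 Px jP.
  exists (mh P); split; [exact: (modular_mconj (modular_minv Mw) MF)| |by rewrite /bfixed bact_mob].
  split; first exact: mob_isometry.
  exists (Some x); split; rewrite /bfixed ?bact_mob // => eta; rewrite bact_mob => Pe.
  have Fe : mb F (mb w eta) = mb w eta.
    have := mb_conj (minv w) F (mb w eta); rewrite [mb (minv w) (mb w eta)]mbK.
    by rewrite -/P Pe => {2}->; rewrite /= !mbVK.
  case E : (mb w eta) Fe => [p|] Fe; first by case: (Fp p).
  by apply: (can_inj (mbK w)); rewrite E wx.
move=> [g [Mg [_ [xi [gxi gu _ _]]] gx]]; have [L Lg] := modular_mob Mg; subst g.
have xe := gu _ gx; subst xi; rewrite /bfixed in gxi gu; rewrite bact_mob in gxi.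
apply: (@parabolic_orbit_finite _ (mconj m0 L)); [exact: cf_startK|exact: modular_mconj| |].
  by rewrite -m0x mb_conj gxi.
move=> zeta Pz; rewrite -m0x -(mbVK m0 zeta); congr (mb m0 _); apply: gu.
by rewrite bact_mob; move: Pz => /(congr1 (mbV m0)) /=; rewrite mbK.
Qed.

Lemma periodic_iff_loxodromic x : eventually_periodic_expansion cf x <->
  exists g, [/\ M g, loxodromic g & bfixed g (Some x)].
Proof.
have [m0 Mm0 m0x] := start_mob x; rewrite eventually_periodicE; split.
  move=> [xO [i [j [ij e]]]].
  have [rho [m [_ Mm mx _ J]]] := orbit_mobs (cf_startK x) xO.
  (* The repetition x_i = x_j makes [g] fix the start of the orbit, with a factor below 1 because
     the factors of the [m i] increase strictly. *)
  pose g := mcomp (minv (m j)) (m i); set y := cf_start x in e mx J m0x.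
  have gy : mb g (Some y) = Some y by rewrite /= mx e -mx mbK.
  have mji : mj (m i) (Some y) < mj (m j) (Some y).
    have lt u : mj (m u) (Some y) < mj (m u.+1) (Some y) by have [] := J u.
    elim: j ij {e g gy} => // j IH; rewrite ltnS leq_eqVlt => /predU1P[->//|/IH h].
    exact: lt_trans h (lt j).
  have jg : mj g (Some y) <> 1.
    by rewrite mj_quot // => /divr1_eq E; move: mji; rewrite E ltxx.
  pose P := mconj (minv m0) g.
  have m0y : mb (minv m0) (Some y) = Some x by rewrite -m0x; exact: mbK.
  have Px : mb P (Some x) = Some x by rewrite -m0y mb_conj gy.
  have jP : mj P (Some x) <> 1 by rewrite -m0y mj_conj.
  exists (mh P); split; [|exact: mob_loxodromic Px jP|by rewrite /bfixed bact_mob].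
  apply: (modular_mconj (modular_minv Mm0)).
  exact: (modular_mcomp (modular_minv (Mm j)) (Mm i)).
move=> [g [Mg [_ [a [b [_ _ gu ga gb]]]] gx]]; have [L Lg] := modular_mob Mg; subst g.
rewrite /bfixed bact_mob in gx.
have {}gu zeta : mb L zeta = zeta -> zeta = a \/ zeta = b.
  by move=> Lz; apply: gu; rewrite /bfixed bact_mob.
(* With factor 1 the point [x] would be neither attracting nor repelling, though it is one of the
   two fixed points [a] and [b]. *)
have jx : mj L (Some x) <> 1.
  move=> /(not_attracting n_gt0 gx)[na nr].
  by case: (gu _ gx) => E; [apply: na; rewrite E|apply: nr; rewrite E].
have Px : mb (mconj m0 L) (Some (cf_start x)) = Some (cf_start x).
  by rewrite -m0x mb_conj gx.
(* A finite orbit would carry [x] to infinity and produce an element fixing infinity with factor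
   different from 1. *)
have xO i : iter i T (cf_start x) <> O.
  move=> /orbit_to_infinity[m Mm my]; pose w := mcomp m m0.
  have wx : mb w (Some x) = None by rewrite /= m0x.
  apply: (@no_loxodromic_infinity (mconj w L)).
  - exact: (modular_mconj (modular_mcomp Mm Mm0) Mg).
  - by rewrite -wx mb_conj gx.
  - by rewrite -wx mj_conj.
split=> //.
apply: (@fixed_orbit_periodic _ (mconj m0 L) (mb m0 a) (mb m0 b)) => //.
- exact: cf_startK.
- exact: modular_mconj.
move=> zeta Pz; have /gu[E|E] : mb L (mbV m0 zeta) = mbV m0 zeta.
- by move: Pz => /(congr1 (mbV m0)) /=; rewrite mbK.
- by left; rewrite -E mbVK.
- by right; rewrite -E mbVK.
Qed.

End Modular.

Theorem theorem1p1 (R : realType) (k : scalars) (n : nat) (n_gt0 : (0 < n)%N)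
    (cf : iwasawaCF R k n) (cf_prop : cf_proper cf) (cf_disc : cf_discrete cf) :
  (forall x : ipoint R k n,
     finite_expansion cf x <->
     exists g, [/\ modular_group cf g, parabolic g & bfixed g (Some x)]) /\
  (forall x : ipoint R k n,
     eventually_periodic_expansion cf x <->
     exists g, [/\ modular_group cf g, loxodromic g & bfixed g (Some x)]).
Proof.
split=> x; first exact: finite_iff_parabolic.
exact: periodic_iff_loxodromic.
Qed.
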